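(* Let $k$ be a positive integer with $k>2$. Let $\mathcal{F}$ be a family of meromorphic functions in a domain $D\subset\mathbb{C}$. Assume that for each compact set $K\subset D$ there exist a set $E=E(K)\subset\mathbb{C}$ consisting of three distinct points and a positive constant $M=M(K)$ such that $$\left(f^{(j)}\right)^{\#}(z)\leq M,\qquad j=0,1,\ldots,k-1,$$ for all $f\in\mathcal{F}$ and all $z\in K\cap f^{-1}(E)$. Then $\mathcal{F}$ is normal on $D$.
   Context: For a meromorphic function $f$ and an integer $j\ge 0$, $f^{(j)}$ denotes the $j$-th derivative of $f$, with $f^{(0)}:=f$, and the spherical derivative of $f^{(j)}$ is $$\left(f^{(j)}\right)^{\#}(z)=\frac{|f^{(j+1)}(z)|}{1+|f^{(j)}(z)|^2}.$$ A family $\mathcal{F}$ of meromorphic functions on a domain $\Omega\subset\mathbb{C}$ is called normal on $\Omega$ (in the sense of Montel) if every sequence in $\mathcal{F}$ contains a subsequence which converges spherically uniformly (i.e. uniformly with respect to the spherical metric) on each compact subset of $\Omega$ to a meromorphic function, which may be identically $\infty$. *)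

(* Defs.v *)
(* MathComp + MathComp-Analysis; C is R[i] for an arbitrary R : realType. *)
From HB Require Import structures.
From mathcomp Require Import all_boot all_order all_algebra.
From mathcomp Require Import all_classical all_reals all_analysis.
From mathcomp Require Import complex.

Set Implicit Arguments.
Unset Strict Implicit.
Unset Printing Implicit Defensive.

Import Order.TTheory GRing.Theory Num.Theory.
Import numFieldNormedType.Exports.

Local Open Scope classical_set_scope.
Local Open Scope ring_scope.

(* The topology of R[i] is that of its modulus, as for any numFieldType, and
   R[i] is a normed module over itself: [derivable f z 1] and [derive1] are
   therefore differentiability and differentiation in the complex sense. *)
HB.instance Definition _ (R : realType) :=
  NormedModule.copy R[i] (R[i] : numFieldType)^o.

(* The norm of R[i] is R[i]-valued; this is the modulus as an element of R. *)
Definition cmod (R : realType) (z : R[i]) : R := complex.Re `|z|.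

(* The Riemann sphere; [None] is the point at infinity. *)
Definition sphere (R : realType) := option R[i].

Definition chordal (R : realType) (a b : sphere R) : R :=
  match a, b with
  | Some x, Some y =>
      cmod (x - y) / (Num.sqrt (1 + cmod x ^+ 2) * Num.sqrt (1 + cmod y ^+ 2))
  | Some x, None | None, Some x => (Num.sqrt (1 + cmod x ^+ 2))^-1
  | None, None => 0
  end.

Definition domain (R : realType) (D : set R[i]) : Prop :=
  [/\ open D, connected D & D !=set0].

(* The value 0 at poles is arbitrary: [finpart f] is only looked at on the
   open set where f is finite. *)
Definition finpart (R : realType) (f : R[i] -> sphere R) : R[i] -> R[i] :=
  fun z => odflt 0 (f z).

Definition finite_holo_at (R : realType) (f : R[i] -> sphere R) (z : R[i]) :
  Prop := isSome (f z) /\ derivable (finpart f) z 1.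

(* Either f is finite and holomorphic near z, or z is a pole of f: an isolated
   singularity at which |f| tends to infinity and f takes the value infinity.
   In particular the constant infinity is not meromorphic. *)
Definition meromorphic_at (R : realType) (f : R[i] -> sphere R) (z : R[i]) :
    Prop :=
  (\forall w \near z, finite_holo_at f w) \/
  [/\ f z = None,
      (\forall w \near z^', finite_holo_at f w) &
      cmod (finpart f w) @[w --> z^'] --> +oo].

Definition meromorphic (R : realType) (D : set R[i]) (f : R[i] -> sphere R) :
  Prop := forall z, D z -> meromorphic_at f z.

(* f^(j) at the points where f is finite *)
Definition mderiv (R : realType) (f : R[i] -> sphere R) (j : nat) :
  R[i] -> R[i] := derive1n j (finpart f).

(* (f^(j))^#; meaningful at the points where f is finite *)
Definition sph_deriv (R : realType) (f : R[i] -> sphere R) (j : nat)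
    (z : R[i]) : R :=
  cmod (mderiv f j.+1 z) / (1 + cmod (mderiv f j z) ^+ 2).

Definition cvg_spherically_locally_uniformly (R : realType) (D : set R[i])
    (u : nat -> R[i] -> sphere R) (g : R[i] -> sphere R) : Prop :=
  forall K : set R[i], compact K -> K `<=` D ->
  forall e : R, 0 < e ->
  \forall n \near \oo, forall z, K z -> chordal (u n z) (g z) < e.

Definition normal_family (R : realType) (D : set R[i])
    (F : set (R[i] -> sphere R)) : Prop :=
  forall u : nat -> R[i] -> sphere R, (forall n, F (u n)) ->
  exists phi : nat -> nat, {homo phi : m n / (m < n)%N} /\
  exists g : R[i] -> sphere R,
    (meromorphic D g \/ (forall z, D z -> g z = None)) /\
    cvg_spherically_locally_uniformly D (u \o phi) g.

(* Main.v *)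
(* Zalcman rescaling followed by a Picard-type rigidity statement.

   If the family is not normal at p, one finds functions f_n of the family,
   points z_n -> p and radii rho_n -> 0 such that f_n(z_n + rho_n zeta) converges
   to a nonconstant g, meromorphic in the plane.  Where g takes one of the three
   values a_i, Hurwitz's theorem gives nearby a_i-points of the rescaled
   functions; there the hypotheses for j = 0, 1, 2 bound the first three
   derivatives of f_n, and the factors rho_n^j make those of g vanish.  So g
   takes each a_i with multiplicity at least 4.

   Then H = g'^4 / prod (g - a_i)^3 and P = g H extend to entire functions, and
   their Wronskian W = g' H^2 satisfies W^4 = prod (P - a_i H)^3.  The two sides
   have degrees 8 and 9 in (H, P), so rescaling at a point of a large disc
   |z| < L where (L - |z|)^4 (|H| + |P|) is almost maximal makes |H| + |P| bounded on large
   discs and 1 at the centre; then (H, P) is almost constant, W is small, and g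
   is close to some a_i.  There phi = g - a_i solves phi'^4 = h phi^3 with h
   almost constant and nonzero.  A zero of phi would have order 4 and a leading
   coefficient h/256, too large for a small phi; without zeros, chi = phi / phi'
   is small although 4 chi' = 1 - chi h'/h is close to 1. *)
Require Import Defs.
From mathcomp Require Import all_boot all_order all_algebra.
From mathcomp Require Import all_classical all_reals all_analysis.
From mathcomp Require Import complex ring lra zify.
Import Order.TTheory GRing.Theory Num.Theory.
Import numFieldNormedType.Exports.
Local Open Scope classical_set_scope.
Local Open Scope ring_scope.

Set Implicit Arguments.
Unset Strict Implicit.
Unset Printing Implicit Defensive.

(** * Modulus and continuity *)

Section Modulus.
Variable (R : realType).
Local Notation C := R[i].
Implicit Types (x y z w : C) (a b e : R).
Local Open Scope complex_scope.

(** Three values of multiplicity at least 4 have total defect 3 (1 - 1/4) = 9/4 > 2, the hyperbolic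
    case. Multiplicity 3 would give exactly 2 and admits elliptic functions with
    [g'^3 = prod (g - a_i)^2]; hence the need for [j = 2], that is [k > 2]. The exponents of [H] are
    read off from orders: m - 4 at a value [a_i] of multiplicity m; at a pole of order n, 5 n - 4
    for [H] and 4 n - 4 for [P]. Passing to the pair removes the poles of [g], so the rigidity
    argument concerns entire functions only and rests on the homogeneity of a polynomial identity.
    Normality is expressed throughout by chordal oscillation instead of spherical derivatives:
    oscillation at most 1/10 on a disc keeps a function or its inverse bounded there, so Cauchy's
    estimates replace Marty's criterion, and the rescaling can be selected by comparing radii of
    discs. *)

Lemma normE z : `|z| = (cmod z)%:C.
Proof. by rewrite /cmod normc_def. Qed.

Lemma cmodE z : cmod z = Num.sqrt (complex.Re z ^+ 2 + complex.Im z ^+ 2).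
Proof. by rewrite /cmod normc_def. Qed.

Lemma cmod_ge0 z : 0 <= cmod z.
Proof. by rewrite cmodE sqrtr_ge0. Qed.

Lemma cmod0 : cmod (0 : C) = 0.
Proof. by rewrite /cmod normr0. Qed.

Lemma cmod1 : cmod (1 : C) = 1.
Proof. by rewrite /cmod normr1. Qed.

Lemma cmod_eq0 z : (cmod z == 0) = (z == 0).
Proof. by rewrite -(normr_eq0 z) normE -(inj_eq (@complexI R)). Qed.

Lemma cmod_gt0 z : (0 < cmod z) = (z != 0).
Proof. by rewrite lt_def cmod_ge0 andbT cmod_eq0. Qed.

Lemma cmodM x y : cmod (x * y) = cmod x * cmod y.
Proof. by apply: (@complexI R); rewrite rmorphM /= -!normE normrM. Qed.

Lemma cmodV x : cmod x^-1 = (cmod x)^-1.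
Proof. by apply: (@complexI R); rewrite fmorphV /= -!normE normfV. Qed.

Lemma cmodX x n : cmod (x ^+ n) = cmod x ^+ n.
Proof. by apply: (@complexI R); rewrite rmorphXn /= -!normE normrX. Qed.

Lemma cmodN x : cmod (- x) = cmod x.
Proof. by rewrite /cmod normrN. Qed.

Lemma cmodB x y : cmod (x - y) = cmod (y - x).
Proof. by rewrite -cmodN opprB. Qed.

Lemma cmodD x y : cmod (x + y) <= cmod x + cmod y.
Proof. by rewrite -lecR rmorphD /= -!normE ler_normD. Qed.

Lemma cmodDB x y : cmod (x - y) <= cmod x + cmod y.
Proof. by rewrite -(cmodN y) cmodD. Qed.

Lemma cmod_tri x y z : cmod (x - z) <= cmod (x - y) + cmod (y - z).
Proof. by rewrite (le_trans _ (cmodD _ _))// addrA subrK. Qed.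

Lemma cmod_leB x y : cmod x - cmod y <= cmod (x - y).
Proof. by rewrite lerBlDr (le_trans _ (cmodD _ _))// subrK. Qed.

Lemma cmod_leBr x y : cmod y - cmod x <= cmod (x - y).
Proof. by rewrite cmodB cmod_leB. Qed.

Lemma cmodr a : cmod a%:C = `|a|.
Proof. by rewrite cmodE /= expr0n addr0 sqrtr_sqr. Qed.

Lemma cmod_nat n : cmod (n%:R : C) = n%:R.
Proof. by rewrite -(rmorph_nat (real_complex R)) cmodr ger0_norm. Qed.

Lemma cmodJ z : cmod (z^*%C) = cmod z.
Proof. by rewrite /cmod normcJ. Qed.

Lemma cmod_conj z : z * z^*%C = (cmod z ^+ 2)%:C.
Proof. by rewrite -sqr_normc normE rmorphXn. Qed.

Lemma Re_le_cmod z : `|complex.Re z| <= cmod z.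
Proof. by rewrite -lecR -normE normc_ge_Re. Qed.

Lemma Im_le_cmod z : `|complex.Im z| <= cmod z.
Proof.
rewrite cmodE -sqrtr_sqr ler_wsqrtr// lerDr sqr_ge0 //.
Qed.

Lemma cmod_i : cmod ('i : C) = 1.
Proof. by rewrite cmodE /= expr0n expr1n add0r sqrtr1. Qed.

Lemma cmod_lim0 z : (forall e, 0 < e -> cmod z <= e) -> z = 0.
Proof.
move=> h; apply/eqP; rewrite -cmod_eq0 eq_le cmod_ge0 andbT.
by apply/ler_addgt0Pr => e e0; rewrite add0r h.
Qed.

Lemma nearC (z : C) (P : C -> Prop) :
  (\forall w \near z, P w) <->
  exists2 e, 0 < e & forall w, cmod (w - z) < e -> P w.
Proof.
split.
  move=> /nbhs_ballP[e /= e0 h].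
  have eE : e = (complex.Re e)%:C by rewrite RRe_real// gtr0_real.
  exists (complex.Re e); first by rewrite -ltcR -eE.
  move=> w hw; apply: h; rewrite /ball /= distrC normE eE ltcR //.
move=> [e e0 h]; apply/nbhs_ballP; exists e%:C => /=; first by rewrite ltcR.
move=> w; rewrite /ball /= => hw; apply: h.
by rewrite -ltcR -normE distrC.
Qed.

Lemma nearC' (z : C) (P : C -> Prop) :
  (\forall w \near z^', P w) <->
  exists2 e, 0 < e & forall w, 0 < cmod (w - z) < e -> P w.
Proof.
split.
  rewrite near_withinE => /nearC[e e0 h]; exists e => // w /andP[w0 we].
  by apply: h => //; rewrite -subr_eq0 -cmod_gt0.
move=> [e e0 h]; rewrite near_withinE; apply/nearC; exists e => // w we wz.
by apply: h; rewrite we cmod_gt0 subr_eq0 wz.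
Qed.

Lemma nearR a (P : R -> Prop) :
  (\forall b \near a, P b) <->
  exists2 e, 0 < e & forall b, `|b - a| < e -> P b.
Proof.
split.
  move=> /nbhs_ballP[e /= e0 h]; exists e => // b hb; apply: h.
  by rewrite /ball /= distrC.
move=> [e e0 h]; apply/nbhs_ballP; exists e => //= b.
by rewrite /ball /= distrC; exact: h.
Qed.

Lemma ctC (T : topologicalType) (f : T -> C) t :
  {for t, continuous f} <->
  forall e, 0 < e -> \forall u \near t, cmod (f u - f t) < e.
Proof.
split=> [h e e0|h].
  have : nbhs (f t) [set w | cmod (w - f t) < e] by apply/nearC; exists e.
  by move=> /h.
by move=> A /nearC[e e0 hA]; apply: filterS (h e e0) => u; exact: hA.
Qed.

Lemma ctR (T : topologicalType) (f : T -> R) t :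
  {for t, continuous f} <->
  forall e, 0 < e -> \forall u \near t, `|f u - f t| < e.
Proof.
split=> [h e e0|h].
  have : nbhs (f t) [set w | `|w - f t| < e] by apply/nearR; exists e.
  by move=> /h.
by move=> A /nearR[e e0 hA]; apply: filterS (h e e0) => u; exact: hA.
Qed.

Lemma continuous_real_complex : continuous (real_complex R).
Proof.
move=> x; apply/ctC => e e0; apply/nearR; exists e => // y.
by rewrite -rmorphB /= cmodr.
Qed.

Lemma continuous_Re : continuous (@complex.Re R : C -> R).
Proof.
move=> x; apply/ctR => e e0; apply/nearC; exists e => // y.
by apply: le_lt_trans; rewrite -raddfB Re_le_cmod.
Qed.

Lemma continuous_Im : continuous (@complex.Im R : C -> R).
Proof.
move=> x; apply/ctR => e e0; apply/nearC; exists e => // y.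
by apply: le_lt_trans; rewrite -raddfB Im_le_cmod.
Qed.

Lemma continuous_cmod : continuous (@cmod R).
Proof.
move=> x; apply/ctR => e e0; apply/nearC; exists e => // y.
by apply: le_lt_trans; rewrite ler_norml lerNl opprB cmod_leBr cmod_leB.
Qed.

(* A record rather than a definition, to stop unification from unfolding it. *)
Record ct (T : topologicalType) (f : T -> C) t : Prop :=
  Ct { ct_continuous : {for t, continuous f} }.

Lemma ct_cst (T : topologicalType) (c : C) (t : T) : ct (fun=> c) t.
Proof. by split; exact: cvg_cst. Qed.

Lemma ct_id z : ct id z.
Proof. by split; exact: cvg_id. Qed.

Lemma ct_real a : ct (real_complex R) a.
Proof. by split; exact: continuous_real_complex. Qed.

Lemma ctD (T : topologicalType) (f g : T -> C) t :
  ct f t -> ct g t -> ct (fun u => f u + g u) t.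
Proof. by move=> [hf] [hg]; split; exact: (continuousD hf hg). Qed.

Lemma ctN (T : topologicalType) (f : T -> C) t :
  ct f t -> ct (fun u => - f u) t.
Proof. by move=> [hf]; split; exact: (continuousN hf). Qed.

Lemma ctB (T : topologicalType) (f g : T -> C) t :
  ct f t -> ct g t -> ct (fun u => f u - g u) t.
Proof. by move=> hf hg; exact: (ctD hf (ctN hg)). Qed.

Lemma ctM (T : topologicalType) (f g : T -> C) t :
  ct f t -> ct g t -> ct (fun u => f u * g u) t.
Proof. by move=> [hf] [hg]; split; exact: (continuousM hf hg). Qed.

Lemma ctX (T : topologicalType) (f : T -> C) n t :
  ct f t -> ct (fun u => f u ^+ n) t.
Proof.
move=> hf; elim: n => [|n ih]; first exact: ct_cst.
by rewrite (_ : (fun u => _) = fun u => f u * f u ^+ n);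
  [exact: ctM|apply: funext => u; rewrite exprS].
Qed.

Lemma ctV (T : topologicalType) (f : T -> C) t :
  f t != 0 -> ct f t -> ct (fun u => (f u)^-1) t.
Proof. by move=> h [hf]; split; exact: (continuousV h hf). Qed.

Lemma ct_comp (S T : topologicalType) (f : S -> T) (g : T -> C) s :
  {for s, continuous f} -> ct g (f s) -> ct (fun u => g (f u)) s.
Proof. by move=> hf [hg]; split; exact: continuous_comp. Qed.

Lemma ctP (T : topologicalType) (f : T -> C) t :
  ct f t <-> forall e, 0 < e -> \forall u \near t, cmod (f u - f t) < e.
Proof. by split=> [[/ctC]//|h]; split; apply/ctC. Qed.

Lemma ct_near (T : topologicalType) (f g : T -> C) t :
  (\forall u \near t, f u = g u) -> ct f t -> ct g t.
Proof.
move=> fg /ctP hf; apply/ctP => e e0; near=> u.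
rewrite -(nbhs_singleton fg) -(_ : f u = g u); last by near: u.
by near: u; exact: hf.
Unshelve. all: by end_near. Qed.

(** Both values are limits along the punctured disc. This settles identities at isolated points
    where a vanishing factor cannot be divided out. *)
Lemma ct_unique (z : C) (f g : C -> C) e : 0 < e ->
  ct f z -> ct g z -> (forall w, 0 < cmod (w - z) < e -> f w = g w) -> f z = g z.
Proof.
move=> e0 /ctP hf /ctP hg fg; apply/eqP; rewrite -subr_eq0; apply/eqP.
apply: cmod_lim0 => d d0.
have d20 : 0 < d / 2 by lra.
have /nearC[e1 e10 h1] := hf _ d20; have /nearC[e2 e20 h2] := hg _ d20.
have [m [m0 l0 l1 l2]] : exists m, [/\ 0 < m, m <= e, m <= e1 & m <= e2].
  exists (Num.min e (Num.min e1 e2)).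
  by rewrite !lt_min e0 e10 e20 !ge_min !lexx !orbT.
have [w wz] : exists w, cmod (w - z) = m / 2.
  exists (z + (m / 2)%:C); rewrite addrC addKr cmodr ger0_norm//.
  by rewrite divr_ge0 // ltW.
have w0 : 0 < cmod (w - z) by rewrite wz divr_gt0.
have wm : cmod (w - z) < m by rewrite wz ltr_pdivrMr// ltr_pMr// ltr1n.
have a0 := fg w; rewrite w0 (lt_le_trans wm l0) in a0.
have {}a0 := a0 isT.
have a1 := h1 w (lt_le_trans wm l1); have a2 := h2 w (lt_le_trans wm l2).
have := cmod_tri (f z) (g w) (g z); rewrite (cmodB (f z) (g w)) -{1}a0.
move: a1 a2; move: (cmod _) (cmod _) (cmod _) => x1 x2 x3; clear.
lra.
Qed.

(** A closed subset of the image of a compact real square under [(u, v) |-> p + u + i v]. *)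
Lemma compact_disc (p : C) (r : R) : compact [set z | cmod (z - p) <= r].
Proof.
pose g (uv : R * R) := p + (uv.1%:C + 'i * uv.2%:C).
have cg uv : ct g uv.
  apply: ctD; first exact: ct_cst.
  apply: ctD; last (apply: ctM; first exact: ct_cst).
    by apply: ct_comp; [exact: cvg_fst|exact: ct_real].
  by apply: ct_comp; [exact: cvg_snd|exact: ct_real].
have cS : compact (g @` ([set u | u \in `[-r, r]] `*` [set u | u \in `[-r, r]])).
  apply: continuous_compact; last by apply: compact_setX; apply: segment_compact.
  by apply: continuous_subspaceT => x; exact: (ct_continuous (cg x)).
apply: (subclosed_compact _ cS).
  have -> : [set z | cmod (z - p) <= r] = (fun z => cmod (z - p)) @^-1` [set u | u <= r] by [].
  apply: closed_comp; last exact: closed_le.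
  move=> z _; have h : ct (fun z => z - p) z by apply: ctB; [exact: ct_id|exact: ct_cst].
  exact: (@continuous_comp _ _ _ (fun z => z - p) (@cmod R) z (ct_continuous h) (@continuous_cmod _)).
move=> z /= hz; exists (complex.Re (z - p), complex.Im (z - p)); last first.
  by rewrite /g /= -(complexE (z - p)) addrC subrK.
by split; rewrite /= in_itv /= -ler_norml; apply: le_trans hz;
  [exact: Re_le_cmod|exact: Im_le_cmod].
Qed.

End Modulus.

(** * Differentiation in Caratheodory form *)

Section Derivatives.
Variable (R : realType).
Local Notation C := R[i].
Implicit Types (z w l m : C).
Local Open Scope complex_scope.

(* Caratheodory form of the derivative along [e]; [e] is the identity of C or
   the embedding of the reals. *)
Variant dv (T : topologicalType) (e f : T -> C) (x : T) (l : C) : Prop :=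
  Dv s of ct s x & s x = l & \forall y \near x, f y - f x = s y * (e y - e x).

Section Rules.
Variables (T : topologicalType) (e : T -> C) (x : T).
Hypothesis ce : ct e x.
Implicit Types (f g : T -> C).

Lemma dv_near f g l : (\forall y \near x, f y = g y) -> dv e f x l -> dv e g x l.
Proof.
move=> fg [s cs sx hs]; apply: (Dv cs sx).
have fgx := nbhs_singleton fg.
by move: fg hs; apply: filterS2 => y <- <-; rewrite fgx.
Qed.

Lemma dv_ct f l : dv e f x l -> ct f x.
Proof.
move=> [s cs sx hs].
apply: (@ct_near _ _ (fun y => f x + s y * (e y - e x))).
  by apply: filterS hs => y <-; rewrite addrC subrK.
by apply: ctD; [exact: ct_cst|apply: ctM => //; apply: ctB => //; exact: ct_cst].
Qed.

Lemma dv_cst c : dv e (fun=> c) x 0.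
Proof.
apply: (@Dv _ _ _ _ _ (fun=> 0)) => //; first exact: ct_cst.
by near=> y; rewrite subrr mul0r.
Unshelve. all: by end_near. Qed.

Lemma dv_id : dv e e x 1.
Proof.
apply: (@Dv _ _ _ _ _ (fun=> 1)) => //; first exact: ct_cst.
by near=> y; rewrite mul1r.
Unshelve. all: by end_near. Qed.

Lemma dvD f g l m : dv e f x l -> dv e g x m -> dv e (fun y => f y + g y) x (l + m).
Proof.
move=> [s cs <- hs] [t ct <- ht]; apply: (@Dv _ _ _ _ _ (fun y => s y + t y)) => //.
  exact: ctD.
by move: hs ht; apply: filterS2 => y h1 h2; rewrite mulrDl -h1 -h2; ring.
Qed.

Lemma dvN f l : dv e f x l -> dv e (fun y => - f y) x (- l).
Proof.
move=> [s cs <- hs]; apply: (@Dv _ _ _ _ _ (fun y => - s y)) => //.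
  exact: ctN.
by move: hs; apply: filterS => y h1; rewrite mulNr -h1; ring.
Qed.

Lemma dvB f g l m : dv e f x l -> dv e g x m -> dv e (fun y => f y - g y) x (l - m).
Proof. by move=> hf hg; exact: (dvD hf (dvN hg)). Qed.

Lemma dvM f g l m : dv e f x l -> dv e g x m ->
  dv e (fun y => f y * g y) x (l * g x + f x * m).
Proof.
move=> hf hg; have cg := dv_ct hg.
move: hf hg => [s cs <- hs] [t ct <- ht].
apply: (@Dv _ _ _ _ _ (fun y => s y * g y + f x * t y)) => //.
  by apply: ctD; apply: ctM => //; exact: ct_cst.
move: hs ht; apply: filterS2 => y h1 h2.
rewrite mulrDl -mulrA (mulrC (g y)) mulrA -h1 -mulrA -h2; ring.
Qed.

Lemma dvZ f c l : dv e f x l -> dv e (fun y => c * f y) x (c * l).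
Proof. by move=> hf; have := dvM (dv_cst c) hf; rewrite mul0r add0r. Qed.

Lemma dvX f l n : dv e f x l ->
  dv e (fun y => f y ^+ n.+1) x (n.+1%:R * f x ^+ n * l).
Proof.
move=> hf; elim: n => [|n ih].
  by rewrite expr0 !mul1r (_ : (fun _ => _) = f)//; apply: funext => y; rewrite expr1.
rewrite (_ : (fun _ => _) = fun y => f y * f y ^+ n.+1); last first.
  by apply: funext => y; rewrite exprS.
have := dvM hf ih; congr (dv _ _ _ _).
rewrite [in RHS]mulrS exprS; ring.
Qed.

Lemma dvV f l : f x != 0 -> dv e f x l ->
  dv e (fun y => (f y)^-1) x (- l / f x ^+ 2).
Proof.
move=> f0 hf; have cf := dv_ct hf.
move: hf => [s cs <- hs].
apply: (@Dv _ _ _ _ _ (fun y => - s y / (f x * f y))) => //.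
  apply: ctM; first exact: ctN.
  by apply: ctV; [rewrite mulf_neq0|apply: ctM => //; exact: ct_cst].
have : \forall y \near x, f y != 0.
  have f1 : 0 < cmod (f x) by rewrite cmod_gt0.
  move/ctP : cf => /(_ _ f1); apply: filterS => y h.
  apply: contraTneq h => ->; rewrite sub0r cmodN ltxx //.
move: hs; apply: filterS2 => y h1 fy0.
rewrite mulrAC mulNr -h1; field.
by rewrite f0 fy0.
Qed.

Lemma dv_comp f (g : C -> C) l m : dv e f x l -> dv id g (f x) m ->
  dv e (fun y => g (f y)) x (m * l).
Proof.
move=> hf; have cf := dv_ct hf; move: hf => [s cs <- hs] [t ct <- ht].
apply: (@Dv _ _ _ _ _ (fun y => t (f y) * s y)) => //.
  by apply: ctM => //; apply: ct_comp => //; exact: ct_continuous.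
have h2 : \forall y \near x, g (f y) - g (f x) = t (f y) * (f y - f x) by exact: (ct_continuous cf) ht.
by move: hs h2; apply: filterS2 => y h1 ->; rewrite h1 mulrA.
Qed.

Lemma dv_est f l : dv e f x l -> forall a : R, 0 < a -> \forall y \near x,
  cmod (f y - f x - l * (e y - e x)) <= a * cmod (e y - e x).
Proof.
move=> [s cs <- hs] a a0; move/ctP : cs => /(_ _ a0).
move: hs; apply: filterS2 => y -> h.
by rewrite -mulrBl cmodM ler_wpM2r ?cmod_ge0// ltW.
Qed.

Lemma est_dv f l : (forall a : R, 0 < a -> \forall y \near x,
  cmod (f y - f x - l * (e y - e x)) <= a * cmod (e y - e x)) -> dv e f x l.
Proof.
move=> h; apply: (@Dv _ _ _ _ _ (fun y => if e y == e x then l else (f y - f x) / (e y - e x)));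
  last 2 first.
- by rewrite eqxx.
(* Where [e y = e x] the estimate forces [f y = f x], so the slope may take the value [l] there. *)
- apply: filterS (h 1 ltr01) => y; case: eqP => [->|/eqP exy _].
    rewrite !subrr !mulr0 subr0 cmod0 mulr0 => h0.
    by apply/eqP; rewrite -cmod_eq0 eq_le cmod_ge0 andbT.
  by rewrite divfK// subr_eq0.
apply/ctP => a a0; have a20 : 0 < a / 2 by rewrite divr_gt0.
apply: filterS (h _ a20) => y; rewrite eqxx.
case: eqP => [_ _|/eqP exy]; first by rewrite subrr cmod0.
have n0 : e y - e x != 0 by rewrite subr_eq0.
rewrite (_ : f y - f x - l * (e y - e x) =
  ((f y - f x) / (e y - e x) - l) * (e y - e x)); last by rewrite mulrBl divfK.
rewrite cmodM ler_pM2r ?cmod_gt0// => /le_lt_trans; apply.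
by rewrite ltr_pdivrMr// ltr_pMr// ltr1n.
Qed.

End Rules.

Lemma cvg0C (g : C -> C) l : (g h @[h --> 0^'] --> l) <->
  forall a : R, 0 < a -> exists2 d, 0 < d &
    forall h, 0 < cmod h < d -> cmod (g h - l) < a.
Proof.
split=> [gl a a0|h].
  have : nbhs l [set w | cmod (w - l) < a] by apply/nearC; exists a.
  by move=> /gl/nearC'[d d0 hd]; exists d => // k hk; apply: hd; rewrite subr0.
move=> A /nearC[a a0 hA]; have [d d0 hd] := h _ a0.
by apply/nearC'; exists d => // k; rewrite subr0 => /hd; exact: hA.
Qed.

Lemma dv_cvg (f : C -> C) z l : dv id f z l <->
  (fun h => h^-1 *: ((f \o shift z) (h *: 1) - f z)) @ 0^' --> l.
Proof.
have E (h : C) : h != 0 -> cmod (h^-1 * (f (h + z) - f z) - l) =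
    cmod (f (h + z) - f z - l * h) / cmod h.
  by move=> h0; rewrite -cmodV -cmodM mulrBl mulfK// mulrC.
split=> [hf|/cvg0C hf].
  apply/cvg0C => a a0; have a20 : 0 < a / 2 by rewrite divr_gt0.
  have /nearC[d d0 hd] := dv_est hf a20; exists d => // h /andP[h0 hhd].
  rewrite /= (_ : h *: 1 = h); last by rewrite [LHS]mulr1.
  rewrite [_^-1 *: _]/(_ * _) E -?cmod_gt0//.
  have := hd (h + z); rewrite addrK => /(_ hhd) h1.
  rewrite ltr_pdivrMr// (le_lt_trans h1)// ltr_pM2r//.
  by rewrite ltr_pdivrMr// ltr_pMr// ltr1n.
apply: est_dv => a a0; have [d d0 hd] := hf _ a0.
apply/nearC; exists d => // y hy /=.
have [->|yz] := eqVneq y z; first by rewrite !subrr mulr0 subr0 cmod0 mulr0.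
have yz0 : 0 < cmod (y - z) by rewrite cmod_gt0 subr_eq0.
have := hd (y - z); rewrite yz0 hy => /(_ isT).
rewrite /= (_ : (y - z) *: 1 = y - z); last by rewrite [LHS]mulr1.
rewrite [_^-1 *: _]/(_ * _) E ?subr_eq0// subrK.
by rewrite ltr_pdivrMr// => /ltW.
Qed.

Lemma dv_derivable (f : C -> C) z l : dv id f z l -> derivable f z 1.
Proof. by move=> /dv_cvg h; apply/cvg_ex; exists l. Qed.

Lemma dv_derive1 (f : C -> C) z l : dv id f z l -> derive1 f z = l.
Proof. by move=> /dv_cvg h; rewrite derive1E; apply: cvg_lim => //. Qed.

Lemma derivable_dv (f : C -> C) z : derivable f z 1 -> dv id f z (derive1 f z).
Proof.
move=> h; have /cvg_ex[l hl] := h.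
by rewrite (dv_derive1 ((dv_cvg _ _ _).2 hl)); apply/dv_cvg.
Qed.

Lemma derivable_ct (f : C -> C) z : derivable f z 1 -> ct f z.
Proof. by move/derivable_dv; apply: dv_ct; exact: ct_id. Qed.

End Derivatives.

(** * Primitives and integrals of complex functions of a real variable *)

Section Primitives.
Variable (R : realType).
Local Notation C := R[i].
Local Notation rc := (@real_complex_def R (Phant R)).
Local Notation mu := (@lebesgue_measure R).
Local Open Scope complex_scope.

Lemma nearR' (a : R) (P : R -> Prop) :
  (\forall b \near a^', P b) <->
  exists2 e, 0 < e & forall b, 0 < `|b - a| < e -> P b.
Proof.
split.
  rewrite near_withinE => /nearR[e e0 h]; exists e => // w /andP[w0 we].
  by apply: h => //; rewrite -subr_eq0 -normr_gt0.
move=> [e e0 h]; rewrite near_withinE; apply/nearR; exists e => // w we wz.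
by apply: h; rewrite we normr_gt0 subr_eq0 wz.
Qed.

Lemma cvg0R (g : R -> R) (l : R) : (g h @[h --> 0^'] --> l) <->
  forall a : R, 0 < a -> exists2 d, 0 < d &
    forall h, 0 < `|h| < d -> `|g h - l| < a.
Proof.
split=> [gl a a0|h].
  have : nbhs l [set w | `|w - l| < a] by apply/nearR; exists a.
  by move=> /gl/nearR'[d d0 hd]; exists d => // k hk; apply: hd; rewrite subr0.
move=> A /nearR[a a0 hA]; have [d d0 hd] := h _ a0.
by apply/nearR'; exists d => // k; rewrite subr0 => /hd; exact: hA.
Qed.

Lemma real_est_is_derive (f : R -> R) (x l : R) :
  (forall a : R, 0 < a -> \forall y \near x,
     `|f y - f x - l * (y - x)| <= a * `|y - x|) -> is_derive x 1 f l.
Proof.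
move=> h.
suff c : (fun h => h^-1 *: ((f \o shift x) (h *: 1) - f x)) @ 0^' --> l.
  split; first by apply/cvg_ex; exists l.
  exact: cvg_lim c.
apply/cvg0R => a a0; have a20 : 0 < a / 2 by rewrite divr_gt0.
have /nearR[d d0 hd] := h _ a20; exists d => // k /andP[k0 kd] /=.
rewrite [_ *: 1]mulr1 [_^-1 *: _]/(_ * _).
rewrite (_ : _ - l = (f (k + x) - f x - l * k) / k); last first.
  by rewrite [RHS]mulrBl mulfK -?normr_gt0// mulrC.
rewrite normrM normfV ltr_pdivrMr//.
have := hd (k + x); rewrite addrK => /(_ kd) /le_lt_trans; apply.
by rewrite ltr_pM2r// ltr_pdivrMr// ltr_pMr// ltr1n.
Qed.

Lemma is_derive_dv (f : R -> R) (x l : R) :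
  is_derive x 1 f l -> dv rc (fun y => (f y)%:C) x l%:C.
Proof.
move=> [/cvg_ex[m hm]] dl; have ml : m = l by rewrite -dl; apply/esym/cvg_lim.
subst m; apply: est_dv => a a0; move/cvg0R : hm => /(_ _ a0)[d d0 hd].
apply/nearR; exists d => // y hy.
rewrite -!rmorphB -rmorphM -rmorphB /= !cmodr.
have [->|yx] := eqVneq y x; first by rewrite !subrr mulr0 subrr normr0 mulr0.
have k0 : 0 < `|y - x| by rewrite normr_gt0 subr_eq0.
have := hd (y - x); rewrite k0 hy => /(_ isT) /=.
rewrite [_ *: 1]mulr1 [_^-1 *: _]/(_ * _) subrK.
rewrite (_ : _ - l = (f y - f x - l * (y - x)) / (y - x)); last first.
  by rewrite [RHS]mulrBl mulfK ?subr_eq0// mulrC.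
by rewrite normrM normfV ltr_pdivrMr// => /ltW.
Qed.

Lemma dv_is_derive_Re (G : R -> C) (x : R) (l : C) :
  dv rc G x l -> is_derive x 1 (fun y => complex.Re (G y)) (complex.Re l).
Proof.
set f := fun y => _.
move=> h; apply: real_est_is_derive => a a0.
have := dv_est h a0; apply: filterS => y; rewrite -rmorphB /= cmodr.
apply: le_trans; apply: le_trans (Re_le_cmod _).
have -> : f y - f x - complex.Re l * (y - x) =
    complex.Re (G y - G x - l * (y - x)%:C); last by [].
rewrite /f; case: (G y) (G x) l {h} => [g1 g2] [h1 h2] [l1 l2] /=; ring.
Qed.

(** Projecting [G] on the direction [w = G b - G a], that is taking the real part of [conj(w) G],
    reduces to the real mean value theorem; the increment of the projection is [|w|^2]. *)
Lemma mvt_le (G c : R -> C) (a b M : R) : a <= b ->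
  (forall x, a <= x <= b -> dv rc G x (c x)) ->
  (forall x, a <= x <= b -> cmod (c x) <= M) ->
  cmod (G b - G a) <= M * (b - a).
Proof.
move=> ab dG hc; set w := G b - G a.
have [w0|w0] := eqVneq w 0.
  rewrite w0 cmod0 mulr_ge0 ?subr_ge0//.
  by rewrite (le_trans (cmod_ge0 _) (hc a _))// lexx.
pose h y := complex.Re (w^* * G y).
have dh (x : R) : a <= x <= b -> is_derive x 1 h (complex.Re (w^* * c x)).
  move=> hx; apply: (@dv_is_derive_Re (fun y => w^* * G y)).
  by apply: dvZ; [exact: ct_real|exact: dG].
have [] := @MVT_segment R h (fun x => complex.Re (w^* * c x)) a b ab.
- by move=> x; rewrite in_itv /= => /andP[ax xb]; apply: dh; rewrite !ltW.
- apply: (@derivable_within_continuous _ _ _ `[a, b]).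
  by move=> x; rewrite in_itv /= => /dh[].
move=> x; rewrite in_itv /= => hx; rewrite /h -raddfB -mulrBr -/w mulrC cmod_conj /=.
move=> E; have w1 : 0 < cmod w by rewrite cmod_gt0.
rewrite -(ler_pM2l w1) -expr2 E mulrA ler_wpM2r ?subr_ge0//.
rewrite (le_trans (ler_norm _))// (le_trans (Re_le_cmod _))//.
by rewrite cmodM cmodJ ler_wpM2l ?cmod_ge0// hc.
Qed.

Lemma dv0_cst (G : R -> C) : (forall x, dv rc G x 0) -> forall a b, G a = G b.
Proof.
move=> dG; suff H a b : a <= b -> G a = G b.
  by move=> a b; case/orP: (le_total a b) => /H.
move=> ab; apply/esym/eqP; rewrite -subr_eq0 -cmod_eq0 eq_le cmod_ge0 andbT.
rewrite -(mul0r (b - a)); apply: mvt_le ab _ _ => [x _|x _]; first exact: dG.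
by rewrite cmod0.
Qed.

(** The fundamental theorem gives primitives to the right of a base point. Two base points give
    functions differing by a constant, so primitives normalised to vanish at 0 agree and can be
    glued along the whole line. *)
Lemma real_primitive (h : R -> R) : continuous h ->
  exists G : R -> R, forall x : R, is_derive x 1 G (h x).
Proof.
move=> ch.
pose F (a x : R) : R := (\int[mu]_(t in [set` `[a, x]]) (h t))%R.
have dF (a x : R) : a < x -> is_derive x 1 (F a) (h x).
  move=> ax.
  have ih : mu.-integrable `[a, x + 1] (EFin \o h).
    apply: continuous_compact_integrable; first exact: segment_compact.
    by apply: continuous_subspaceT.
  have x1 : x < x + 1 by rewrite ltrDl.
  have [d1 d2] := continuous_FTC1_closed x1 ih ax (ch x).
  by split; [exact: d1|rewrite -derive1E; exact: d2].
have dFF (a b x : R) : a < x -> b < x -> is_derive x 1 (F a \- F b) 0.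
  move=> ax bx; have [d1 e1] := dF _ _ ax; have [d2 e2] := dF _ _ bx.
  split; first exact: derivableB.
  by rewrite deriveB// e1 e2 subrr.
have Fcst (a b x y : R) : a < x -> b < x -> x <= y -> F a x - F b x = F a y - F b y.
  move=> ax bx xy.
  have H (z : R) : x <= z <= y -> is_derive z 1 (F a \- F b) 0.
    by case/andP => xz _; apply: dFF; apply: lt_le_trans xz.
  have [] := @MVT_segment R (F a \- F b) (fun=> 0) x y xy.
  - by move=> z; rewrite in_itv /= => /andP[z1 z2]; apply: H; rewrite !ltW.
  - apply: (@derivable_within_continuous _ _ _ `[x, y]).
    by move=> z; rewrite in_itv /= => /H[].
  by move=> z _; rewrite mul0r => /eqP; rewrite subr_eq0 => /eqP.
have {}Fcst (a b x y : R) : a < x -> b < x -> a < y -> b < y ->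
    F a x - F b x = F a y - F b y.
  move=> *; case/orP: (le_total x y) => xy; first exact: Fcst.
  by apply/esym/Fcst.
(* The base point [- |x| - 1] lies to the left of both [x] and 0; for [|y - x| < 1] the one of [y]
   can be traded for the fixed [- |x| - 2]. *)
pose G x := F (- `|x| - 1) x - F (- `|x| - 1) 0.
exists G => x.
have GE y : `|y - x| < 1 -> G y = F (- `|x| - 2) y - F (- `|x| - 2) 0.
  move=> yx.
  have y1 : `|y| < `|x| + 1.
    by rewrite -(subrK x y) (le_lt_trans (ler_normD _ _))// addrC ltrD2l.
  have := ler_norm (- y); have := normr_ge0 y; have := normr_ge0 x.
  rewrite normrN => x0 y0 yy.
  have /Fcst H : - `|y| - 1 < y by lra.
  have := H (- `|x| - 2) 0; rewrite /G => H2.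
  apply/eqP; rewrite subr_eq addrAC -subr_eq; apply/eqP.
  have : F (- `|y| - 1) y - F (- `|x| - 2) y = F (- `|y| - 1) 0 - F (- `|x| - 2) 0.
    by apply: H2; lra.
  lra.
have [d1 e1] : is_derive x 1 (F (- `|x| - 2)) (h x).
  by apply: dF; have := ler_norm (- x); rewrite normrN => x0; lra.
have := is_derive_dv (DeriveDef d1 e1) => d2.
apply: (@real_est_is_derive G x) => a a0.
have /nearR[d d0 hd] := dv_est d2 a0.
apply/nearR; exists (Num.min 1 d); first by rewrite lt_min ltr01 d0.
move=> y; rewrite lt_min => /andP[y1 yd].
have := hd y yd; rewrite -!rmorphB -rmorphM -rmorphB /= !cmodr.
by rewrite !GE ?subrr ?normr0//; apply: le_trans; rewrite le_eqVlt; apply/orP; left;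
   apply/eqP; congr (`| _ |); ring.
Qed.

Lemma primitive_ex (c : R -> C) : (forall x, ct c x) ->
  exists G : R -> C, forall x, dv rc G x (c x).
Proof.
move=> cc.
have [G1 h1] : exists G : R -> R, forall x : R, is_derive x 1 G (complex.Re (c x)).
  apply: real_primitive => x.
  exact: continuous_comp (ct_continuous (cc x)) (@continuous_Re _ _).
have [G2 h2] : exists G : R -> R, forall x : R, is_derive x 1 G (complex.Im (c x)).
  apply: real_primitive => x.
  exact: continuous_comp (ct_continuous (cc x)) (@continuous_Im _ _).
exists (fun y => (G1 y)%:C + 'i * (G2 y)%:C) => x.
rewrite (complexE (c x)); apply: dvD; first exact/is_derive_dv.
by apply: dvZ; [exact: ct_real|exact/is_derive_dv].
Qed.

Definition primitive (c : R -> C) : R -> C :=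
  xget (fun=> 0) [set G | forall x, dv rc G x (c x)].

Lemma primitiveP (c : R -> C) x : (forall x, ct c x) -> dv rc (primitive c) x (c x).
Proof. by move=> /primitive_ex[G hG]; rewrite /primitive; case: xgetP => [H _ /=|/(_ G)]; first exact. Qed.

(* Oriented integral of a continuous function, through an arbitrary primitive. *)
Definition Int (c : R -> C) (a b : R) : C := primitive c b - primitive c a.

Lemma IntE (c G : R -> C) a b : (forall x, dv rc G x (c x)) ->
  Int c a b = G b - G a.
Proof.
move=> hG.
have hP x : dv rc (primitive c) x (c x).
  rewrite /primitive; case: xgetP => [H _ /=|/(_ G)]; first exact.
  by move/(_ hG).
have E : primitive c b - G b = primitive c a - G a.
  apply: (@dv0_cst (fun x => primitive c x - G x)) => x.
  by rewrite -(subrr (c x)); exact: dvB.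
by rewrite /Int -[primitive c b](subrK (G b)) E; ring.
Qed.

Lemma IntZ (c : R -> C) k a b : (forall x, ct c x) ->
  Int (fun x => k * c x) a b = k * Int c a b.
Proof.
move=> hc; rewrite (@IntE _ (fun x => k * primitive c x)); first by rewrite /Int; ring.
by move=> x; apply: dvZ; [exact: ct_real|exact: primitiveP].
Qed.

Lemma IntB (c d : R -> C) a b : (forall x, ct c x) -> (forall x, ct d x) ->
  Int (fun x => c x - d x) a b = Int c a b - Int d a b.
Proof.
move=> hc hd; rewrite (@IntE _ (fun x => primitive c x - primitive d x)).
  by rewrite /Int; ring.
by move=> x; apply: dvB; exact: primitiveP.
Qed.

Lemma Int_le (c : R -> C) a b M : a <= b -> (forall x, ct c x) ->
  (forall x, a <= x <= b -> cmod (c x) <= M) -> cmod (Int c a b) <= M * (b - a).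
Proof.
by move=> ab hc hM; apply: mvt_le ab _ hM => x _; exact: primitiveP.
Qed.

End Primitives.

(** * Cauchy's theorem *)

Section Goursat.
Variable (R : realType).
Local Notation C := R[i].
Local Notation rc := (@real_complex_def R (Phant R)).
Local Open Scope complex_scope.

Lemma nested_point (x w : nat -> R) : (forall n, 0 <= w n) ->
  (forall n, x n <= x n.+1) -> (forall n, x n.+1 + w n.+1 <= x n + w n) ->
  exists s, forall n, x n <= s <= x n + w n.
Proof.
move=> w0 xn yn.
have xmono m n : (m <= n)%N -> x m <= x n.
  by move=> /subnK <-; elim: (n - m)%N => // k ih; rewrite addSn (le_trans ih).
have ymono m n : (m <= n)%N -> x n + w n <= x m + w m.
  by move=> /subnK <-; elim: (n - m)%N => // k ih; rewrite addSn (le_trans (yn _)).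
have xy m n : x m <= x n + w n.
  rewrite (le_trans (xmono _ _ (leq_maxl m n)))//.
  by rewrite (le_trans _ (ymono _ _ (leq_maxr m n)))// lerDl.
have hs : has_sup (range x).
  by split; [exists (x 0%N), 0%N|exists (x 0%N + w 0%N) => _ [m _ <-]].
exists (sup (range x)) => n; apply/andP; split.
  by apply: ub_le_sup; [exact: hs.2|exists n].
by apply: ge_sup; [exact: hs.1|move=> _ [m _ <-]].
Qed.

(** If all four quarters had modulus at most [k / 4^(n+1)], their sum would be at most [k / 4^n];
    choosing a bad quarter at every stage gives nested rectangles with a common point [(s, t)]. *)
Lemma bisection (J : R -> R -> R -> R -> C) (a b c d k : R) :
  (forall a m b c p d,
     J a b c d = J a m c p + J m b c p + J a m p d + J m b p d) ->
  a <= b -> c <= d -> k < cmod (J a b c d) ->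
  exists s t : R, forall n, exists x y : R,
    let u := (b - a) / 2 ^+ n in let v := (d - c) / 2 ^+ n in
    [/\ x <= s <= x + u, y <= t <= y + v &
       k / 4 ^+ n < cmod (J x (x + u) y (y + v))].
Proof.
move=> Jadd ab cd hJ.
pose u n : R := (b - a) / 2 ^+ n; pose v n : R := (d - c) / 2 ^+ n.
have uS n : u n = u n.+1 + u n.+1.
  by rewrite /u exprS; field; rewrite expf_neq0// pnatr_eq0.
have vS n : v n = v n.+1 + v n.+1.
  by rewrite /v exprS; field; rewrite expf_neq0// pnatr_eq0.
have u0 n : 0 <= u n by rewrite divr_ge0 ?subr_ge0// exprn_ge0.
have v0 n : 0 <= v n by rewrite divr_ge0 ?subr_ge0// exprn_ge0.
pose bad n (z : R * R) :=
  k / 4 ^+ n < cmod (J z.1 (z.1 + u n) z.2 (z.2 + v n)).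
have step n z : bad n z -> exists z' : R * R, [/\ bad n.+1 z',
    z.1 <= z'.1, z'.1 + u n.+1 <= z.1 + u n,
    z.2 <= z'.2 & z'.2 + v n.+1 <= z.2 + v n].
  case: z => x y bz; apply: contrapT => /forallNP H.
  have Hx x' y' : x' = x \/ x' = x + u n.+1 -> y' = y \/ y' = y + v n.+1 ->
      cmod (J x' (x' + u n.+1) y' (y' + v n.+1)) <= k / 4 ^+ n.+1.
    move=> hx hy; rewrite leNgt; apply/negP => hbad; apply: (H (x', y')).
    have := u0 n.+1; have := v0 n.+1; rewrite (uS n) (vS n) => v1 u1.
    split=> //=; [case: hx | case: hx | case: hy | case: hy] => ->; lra.
  move: bz; rewrite /bad /= uS vS !addrA (Jadd _ (x + u n.+1) _ _ (y + v n.+1)).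
  apply/negP; rewrite -leNgt.
  have -> : k / 4 ^+ n = k / 4 ^+ n.+1 + k / 4 ^+ n.+1 + k / 4 ^+ n.+1 + k / 4 ^+ n.+1.
    by rewrite exprS; field; rewrite expf_neq0// pnatr_eq0.
  rewrite (le_trans (cmodD _ _))// lerD//; last by apply: Hx; right.
  rewrite (le_trans (cmodD _ _))// lerD//; last by apply: Hx; [left|right].
  rewrite (le_trans (cmodD _ _))// lerD//; apply: Hx; by [left|right].
have b0 : bad 0%N (a, c).
  by rewrite /bad /u /v !expr0 !divr1 /= !(addrC _ (_ - _)) !subrK.
pose nx n z := xget z [set z' | bad n z -> [/\ bad n.+1 z',
    z.1 <= z'.1, z'.1 + u n.+1 <= z.1 + u n,
    z.2 <= z'.2 & z'.2 + v n.+1 <= z.2 + v n]].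
have nxP n z : bad n z -> [/\ bad n.+1 (nx n z),
    z.1 <= (nx n z).1, (nx n z).1 + u n.+1 <= z.1 + u n,
    z.2 <= (nx n z).2 & (nx n z).2 + v n.+1 <= z.2 + v n].
  move=> bz; rewrite /nx; case: xgetP => [z' _ /(_ bz)//|].
  by have [z' hz'] := step _ _ bz => /(_ z') /=; case.
pose Z := fix Z n := if n is m.+1 then nx m (Z m) else (a, c).
have bZ n : bad n (Z n) by elim: n => //= n /nxP[].
have [s hs] : exists s, forall n, (Z n).1 <= s <= (Z n).1 + u n.
  by apply: nested_point => // n; have [] := nxP _ _ (bZ n).
have [t ht] : exists t, forall n, (Z n).2 <= t <= (Z n).2 + v n.
  by apply: nested_point => // n; have [] := nxP _ _ (bZ n).
exists s, t => n; exists (Z n).1, (Z n).2; split; [exact: hs|exact: ht|exact: bZ].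
Qed.

(** [Q] is a primitive of the affine approximation [F P + l (z - P)], so the difference of the two
    increments is the integral of the approximation error along the side [g], with integrand at most
    [e r L]. *)
Lemma side_est (F Q : C -> C) (P l : C) (g g' : R -> C) (a b e r L : R) :
  (forall z, Q z = F P * z + l / 2 * (z - P) ^+ 2) ->
  a <= b -> 0 <= e ->
  (forall x, dv rc g x (g' x)) -> (forall x, ct g' x) ->
  (forall x, ct (fun y => F (g y)) x) ->
  (forall x, a <= x <= b -> cmod (g' x) <= L) ->
  (forall x, a <= x <= b -> cmod (g x - P) <= r) ->
  (forall z, cmod (z - P) <= r ->
     cmod (F z - F P - l * (z - P)) <= e * cmod (z - P)) ->
  cmod (primitive (fun x => F (g x) * g' x) b -
        primitive (fun x => F (g x) * g' x) a - (Q (g b) - Q (g a)))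
     <= e * r * L * (b - a).
Proof.
move=> QE ab e0 dg cg' cF bg' bg hF.
pose W x := primitive (fun x => F (g x) * g' x) x -
  (F P * g x + l / 2 * (g x - P) ^+ 2).
rewrite (_ : _ - _ - _ = W b - W a); last by rewrite /W !QE; ring.
apply: (@mvt_le _ _ (fun x => (F (g x) - F P - l * (g x - P)) * g' x) _ _ _ ab).
  move=> x _; rewrite mulrBl; rewrite mulrBl -addrA -opprD.
  apply: dvB; first by apply: primitiveP => y; exact: ctM.
  apply: dvD; first by apply: dvZ => //; exact: ct_real.
  have hd : dv rc (fun y => g y - P) x (g' x - 0) by apply: dvB => //; exact: dv_cst.
  have := dvZ (@ct_real R x) (l / 2) (dvX (@ct_real R x) 1 hd).
  by congr (dv _ _ _ _); rewrite subr0 expr1; field.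
move=> x hx; rewrite cmodM ler_pM ?cmod_ge0 ?bg'//.
by rewrite (le_trans (hF _ (bg _ hx)))// ler_wpM2l// bg.
Qed.

Section Homotopy.
Variables (F : C -> C) (Phi Phi1 Phi2 : R -> R -> C) (L : R).
Hypothesis L0 : 0 <= L.
Hypothesis dPhi1 : forall s t, dv rc (Phi^~ t) s (Phi1 s t).
Hypothesis dPhi2 : forall s t, dv rc (Phi s) t (Phi2 s t).
Hypothesis cPhi1 : forall s t, ct (Phi1^~ t) s.
Hypothesis cPhi2 : forall s t, ct (Phi2 s) t.
Hypothesis bPhi1 : forall s t, cmod (Phi1 s t) <= L.
Hypothesis bPhi2 : forall s t, cmod (Phi2 s t) <= L.
Hypothesis dF : forall s t, exists l, dv id F (Phi s t) l.

Let f1 t s := F (Phi s t) * Phi1 s t.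
Let f2 s t := F (Phi s t) * Phi2 s t.

Let J a b c d := Int (f2 b) c d - Int (f2 a) c d - (Int (f1 d) a b - Int (f1 c) a b).

Let cF1 s t : ct (fun y => F (Phi y t)) s.
Proof.
have [l hl] := dF s t.
by apply: dv_ct; last (apply: dv_comp; [|exact: dPhi1|exact: hl]); exact: ct_real.
Qed.

Let cF2 s t : ct (fun y => F (Phi s y)) t.
Proof.
have [l hl] := dF s t.
by apply: dv_ct; last (apply: dv_comp; [|exact: dPhi2|exact: hl]); exact: ct_real.
Qed.

Let Phi_lip s t s' t' : cmod (Phi s t - Phi s' t') <= L * (`|s - s'| + `|t - t'|).
Proof.
have lip1 u u' v : u <= u' -> cmod (Phi u' v - Phi u v) <= L * `|u - u'|.
  move=> uu; rewrite distrC ger0_norm ?subr_ge0//.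
  by apply: (@mvt_le _ (Phi^~ v) (Phi1^~ v) _ _ _ uu).
have lip2 u v v' : v <= v' -> cmod (Phi u v' - Phi u v) <= L * `|v - v'|.
  move=> vv; rewrite distrC ger0_norm ?subr_ge0//.
  by apply: (@mvt_le _ (Phi u) (Phi2 u) _ _ _ vv).
rewrite (le_trans (cmod_tri _ (Phi s' t) _))// mulrDr lerD//.
  by case/orP: (le_total s s') => /lip1 h; [rewrite cmodB|rewrite distrC].
by case/orP: (le_total t t') => /lip2 h; [rewrite cmodB|rewrite distrC].
Qed.

(** [J] is the integral of [F dz] along the image under [Phi] of the boundary of a rectangle. The
    increments of [Q] cancel around that boundary, so on the n-th bad rectangle only the errors
    remain: at most [2 e (L w)^2 / 4^n], against the lower bound [k / 4^n]. Pulling back by [Phi]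
    yields homotopy invariance at once. *)
Lemma goursat a b c d : a <= b -> c <= d -> J a b c d = 0.
Proof.
move=> ab cd; apply: cmod_lim0 => k k0; rewrite leNgt; apply/negP => hk.
have [s [t hst]] : exists s t : R, forall n, exists x y : R,
    let u := (b - a) / 2 ^+ n in let v := (d - c) / 2 ^+ n in
    [/\ x <= s <= x + u, y <= t <= y + v &
       k / 4 ^+ n < cmod (J x (x + u) y (y + v))].
  by apply: bisection ab cd hk => *; rewrite /J /Int; ring.
have [l hl] := dF s t.
pose Q z := F (Phi s t) * z + l / 2 * (z - Phi s t) ^+ 2.
have QE z : Q z = F (Phi s t) * z + l / 2 * (z - Phi s t) ^+ 2 by [].
pose w := (b - a) + (d - c); have w0 : 0 <= w by rewrite addr_ge0 ?subr_ge0.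
(* Twice the square of [L w] accounts for the errors of the four sides together; adding 1 keeps the
   denominator positive when [L w = 0]. *)
pose A := 2 * (L * w) * (L * w) + 1.
have A0 : 0 < A by rewrite ltr_wpDl// !mulr_ge0.
have e0 : 0 < k / A by rewrite divr_gt0.
have /nearC[eta eta0 heta] := dv_est hl e0.
have [n hn] : exists n, L * (w / 2 ^+ n) < eta.
  have [n hn] : exists n, (L * w + 1) / eta < 2 ^+ n.
    have p0 : 0 <= (L * w + 1) / eta.
      by rewrite divr_ge0 ?(ltW eta0)// addr_ge0// mulr_ge0.
    exists (Num.truncn ((L * w + 1) / eta)).+1.
    rewrite (lt_le_trans (truncnS_gt _))// -natrX ler_nat.
    exact/ltnW/ltn_expl.
  exists n; rewrite mulrA ltr_pdivrMr ?exprn_gt0// (mulrC eta).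
  move: hn; rewrite ltr_pdivrMr// => hn; rewrite (lt_trans _ hn)// ltrDl//.
have [x [y [/= /andP[s1 s2] /andP[t1 t2]]]] := hst n.
set u := (b - a) / _ in s2 *; set v := (d - c) / _ in t2 *.
have u0 : 0 <= u by rewrite divr_ge0 ?subr_ge0// exprn_ge0.
have v0 : 0 <= v by rewrite divr_ge0 ?subr_ge0// exprn_ge0.
have uv : u + v = w / 2 ^+ n by rewrite /u /v /w [RHS]mulrDl.
pose r := L * (u + v).
have r0 : 0 <= r by rewrite mulr_ge0// addr_ge0.
have Pr s' t' : x <= s' <= x + u -> y <= t' <= y + v ->
    cmod (Phi s' t' - Phi s t) <= r.
  move=> /andP[h1 h2] /andP[h3 h4]; rewrite (le_trans (Phi_lip _ _ _ _))// /r.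
  by rewrite ler_wpM2l// lerD// ler_norml; apply/andP; split; lra.
have hF z : cmod (z - Phi s t) <= r ->
    cmod (F z - F (Phi s t) - l * (z - Phi s t)) <= k / A * cmod (z - Phi s t).
  by move=> hz; apply: heta; rewrite (le_lt_trans hz)// /r uv.
have xu : x <= x + u by rewrite lerDl.
have yv : y <= y + v by rewrite lerDl.
have xx1 : x <= x <= x + u by rewrite lexx.
have xx2 : x <= x + u <= x + u by rewrite lexx andbT.
have yy1 : y <= y <= y + v by rewrite lexx.
have yy2 : y <= y + v <= y + v by rewrite lexx andbT.
have E2 s' : x <= s' <= x + u -> _ := fun h =>
  side_est QE yv (ltW e0) (dPhi2 s') (cPhi2 s') (cF2 s')
    (fun t' _ => bPhi2 s' t') (fun t' ht' => Pr s' t' h ht') hF.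
have E1 t' : y <= t' <= y + v -> _ := fun h =>
  side_est QE xu (ltW e0) (fun s' => dPhi1 s' t') (fun s' => cPhi1 s' t')
    (fun s' => cF1 s' t') (fun s' _ => bPhi1 s' t') (fun s' hs' => Pr s' t' hs' h) hF.
move: (E2 _ xx1) (E2 _ xx2) (E1 _ yy1) (E1 _ yy2) => {E1 E2} /=.
rewrite !(addrAC _ _ (- x)) !(addrAC _ _ (- y)) !subrr !add0r.
rewrite /J /Int /f1 /f2.
set p1 := primitive _ _ - primitive _ _; set q1 := Q (Phi x (y + v)) - Q (Phi x y) => H1.
set p2 := primitive _ _ - primitive _ _; set q2 := Q (Phi (x + u) (y + v)) - Q (Phi (x + u) y) => H2.
set p3 := primitive _ _ - primitive _ _; set q3 := Q (Phi (x + u) y) - Q (Phi x y) => H3.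
set p4 := primitive _ _ - primitive _ _; set q4 := Q (Phi (x + u) (y + v)) - Q (Phi x (y + v)) => H4.
apply/negP; rewrite -leNgt.
have -> : p2 - p1 - (p4 - p3) = (p2 - q2) - (p1 - q1) - ((p4 - q4) - (p3 - q3)).
  rewrite /q1 /q2 /q3 /q4; ring.
rewrite (le_trans (cmodDB _ _))//.
have h12 := cmodDB (p2 - q2) (p1 - q1); have h34 := cmodDB (p4 - q4) (p3 - q3).
apply: (@le_trans _ _ (k / A * r * L * (u + v) *+ 2)).
  move: H1 H2 H3 H4 h12 h34; rewrite mulrDr mulr2n; lra.
rewrite /r uv.
rewrite (_ : _ *+ 2 = k / A * (2 * (L * w) * (L * w)) / 4 ^+ n); last first.
  rewrite (_ : 4 = 2 * 2) ?exprMn; last by ring.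
  by field; rewrite expf_neq0 ?pnatr_eq0// gt_eqF.
rewrite ler_wpM2r ?invr_ge0 ?exprn_ge0//.
by rewrite -mulrA ler_piMr ?(ltW k0)// mulrC ler_pdivrMr// mul1r /A lerDl.
Qed.

End Homotopy.
End Goursat.

(** * Cauchy transforms over a circle *)

Section CauchyTransform.
Variable (R : realType).
Local Notation C := R[i].
Local Notation rc := (@real_complex_def R (Phant R)).
Local Open Scope complex_scope.
Implicit Types (p w z : C) (r : R).

Definition cis (t : R) : C := (cos t)%:C + 'i * (sin t)%:C.

Lemma cmod_cis t : cmod (cis t) = 1.
Proof.
have h := cos2Dsin2 t; rewrite cmodE /cis /=.
by rewrite !(mul0r, mul1r, subr0, addr0, add0r, mulr0) h sqrtr1.
Qed.

Lemma cis0 : cis 0 = 1.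
Proof. by rewrite /cis cos0 sin0 rmorph0 mulr0 addr0. Qed.

Lemma cis2pi : cis (pi *+ 2) = 1.
Proof. by rewrite /cis cos2pi sin2pi rmorph0 mulr0 addr0. Qed.

Lemma dv_cis t : dv rc cis t ('i * cis t).
Proof.
have h1 : dv rc (fun y => (cos y)%:C) t (- sin t)%:C by exact: is_derive_dv.
have h2 : dv rc (fun y => (sin y)%:C) t (cos t)%:C by exact: is_derive_dv.
have := dvD h1 (dvZ (@ct_real R t) 'i h2).
rewrite (_ : _ + _ = 'i * cis t)//.
by rewrite /cis mulrDr mulrA -expr2 sqr_i rmorphN /= mulN1r addrC.
Qed.

Definition circ p r t : C := p + r%:C * cis t.
Definition dcirc r t : C := r%:C * ('i * cis t).

Lemma dv_circ p r t : dv rc (circ p r) t (dcirc r t).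
Proof.
rewrite -[dcirc _ _]add0r; apply: dvD; first exact: dv_cst.
by apply: dvZ; [exact: ct_real|exact: dv_cis].
Qed.

Lemma ct_circ p r t : ct (circ p r) t.
Proof. by apply: dv_ct (dv_circ p r t); exact: ct_real. Qed.

Lemma ct_dcirc r t : ct (dcirc r) t.
Proof.
apply: ctM; first exact: ct_cst; apply: ctM; first exact: ct_cst.
by apply: dv_ct (dv_cis t); exact: ct_real.
Qed.

Lemma circP p r t : 0 <= r -> cmod (circ p r t - p) = r.
Proof. by move=> r0; rewrite /circ addrC addKr cmodM cmodr cmod_cis mulr1 ger0_norm. Qed.

Lemma cmod_dcirc r t : 0 <= r -> cmod (dcirc r t) = r.
Proof. by move=> r0; rewrite !cmodM cmodr cmod_cis cmod_i !mulr1 ger0_norm. Qed.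

Lemma circ_dist p r w t : 0 <= r -> r - cmod (w - p) <= cmod (circ p r t - w).
Proof.
move=> r0; rewrite lerBlDr -{1}(circP p t r0); exact: cmod_tri.
Qed.

Lemma circ_neq p r w t : cmod (w - p) < r -> circ p r t - w != 0.
Proof.
move=> wr; rewrite -cmod_gt0 (lt_le_trans _ (circ_dist p w t _))// ?subr_gt0//.
by rewrite (le_trans (cmod_ge0 _) (ltW wr)).
Qed.

Lemma ct_bounded (c : R -> C) a b : a <= b -> (forall t, ct c t) ->
  exists2 M : R, 0 <= M & forall t, a <= t <= b -> cmod (c t) <= M.
Proof.
move=> ab cc; have h : {within `[a, b], continuous (fun t => cmod (c t))}.
  apply: continuous_subspaceT => t.
  exact: (@continuous_comp _ _ _ c (@cmod R) t (ct_continuous (cc t)) (@continuous_cmod R _)).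
have [x _ hx] := EVT_max ab h.
by exists (cmod (c x)); [exact: cmod_ge0|move=> t ht; apply: hx; rewrite in_itv].
Qed.

(** The Cauchy transform with kernel of order [m]. The density [c] is any continuous function of the
    angle; the factor [dcirc] coming from [dz] is put into [c] when wanted. *)
Definition ctransf p r m (c : R -> C) w :=
  Int (fun t => c t / (circ p r t - w) ^+ m) 0 (pi *+ 2).

Lemma ct_ctransf p r m c w t : (forall t, ct c t) -> cmod (w - p) < r ->
  ct (fun t => c t / (circ p r t - w) ^+ m) t.
Proof.
move=> cc wr; apply: ctM; first exact: cc.
apply: ctV; first by rewrite expf_neq0// circ_neq.
by apply: ctX; apply: ctB; [exact: ct_circ|exact: ct_cst].
Qed.

Lemma tpi_ge0 : 0 <= (pi : R) *+ 2.
Proof. by rewrite mulrn_wge0// pi_ge0. Qed.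

Lemma ctransf_le p r m c w M : (forall t, ct c t) -> cmod (w - p) < r ->
  (forall t, 0 <= t <= pi *+ 2 -> cmod (c t) <= M) ->
  cmod (ctransf p r m c w) <= M / (r - cmod (w - p)) ^+ m * (pi *+ 2).
Proof.
move=> cc wr hM; rewrite -[X in _ * X]subr0.
have M0 : 0 <= M by apply: le_trans (cmod_ge0 _) (hM 0 _); rewrite lexx tpi_ge0.
have d0 : 0 < r - cmod (w - p) by rewrite subr_gt0.
apply: Int_le; [exact: tpi_ge0|by move=> t; exact: ct_ctransf|].
move=> t ht; rewrite cmodM cmodV cmodX.
rewrite ler_pM ?cmod_ge0 ?invr_ge0 ?exprn_ge0 ?cmod_ge0 ?hM//.
rewrite lef_pV2 ?posrE ?exprn_gt0 ?cmod_gt0 ?circ_neq//.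
apply: lerXn2r; rewrite ?nnegrE ?cmod_ge0 ?(ltW d0)// circ_dist//.
by rewrite (le_trans (cmod_ge0 _) (ltW wr)).
Qed.

(** Differentiation under the integral sign. [K] is the second-order remainder of the kernel [A^-m],
    divided by [h^2]; its uniform bound [B] makes the integrated remainder [O(h^2)]. *)
Lemma dv_ctransf_aux p r m m' n c w (K : C -> C -> C) B :
  (forall t, ct c t) -> cmod (w - p) < r ->
  (forall A h, A != 0 -> A - h != 0 -> (A - h) ^- m - A ^- m - n%:R * A ^- m' * h = h ^+ 2 * K A h) ->
  (forall A h, r - cmod (w - p) <= cmod A -> cmod h <= (r - cmod (w - p)) / 2 -> cmod (K A h) <= B) ->
  dv id (ctransf p r m c) w (n%:R * ctransf p r m' c w).
Proof.
move=> cc wr hK hB; set d := r - cmod (w - p) in hB.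
have d0 : 0 < d by rewrite subr_gt0.
have r0 : 0 <= r by rewrite (le_trans (cmod_ge0 _) (ltW wr)).
have [M M0 hM] := ct_bounded tpi_ge0 cc.
apply: est_dv => e e0; apply/nearC.
have B0 : 0 <= B.
  apply: le_trans (cmod_ge0 (K d%:C 0)) (hB _ _ _ _); first by rewrite cmodr ler_norm.
  by rewrite cmod0 divr_ge0// ltW.
pose D := M * B * (pi *+ 2) + 1.
have D0 : 0 < D.
  by rewrite ltr_wpDl//; apply: mulr_ge0; [exact: mulr_ge0|exact: tpi_ge0].
have m0 : 0 < Num.min (d / 2) (e / D).
  by rewrite lt_min; apply/andP; split; apply: divr_gt0.
exists (Num.min (d / 2) (e / D)) => //.
move=> w'; rewrite lt_min /= => /andP[hd he].
set h := w' - w in hd he *.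
have w'r : cmod (w' - p) < r.
  rewrite -(subrK w w') -addrA (le_lt_trans (cmodD _ _))// -/h.
  rewrite -ltrBrDr (lt_trans hd)// ltr_pdivrMr// ltr_pMr// ltr1n //.
have -> : ctransf p r m c w' - ctransf p r m c w - n%:R * ctransf p r m' c w * h =
   Int (fun t => h ^+ 2 * (c t * K (circ p r t - w) h)) 0 (pi *+ 2).
  rewrite (mulrAC _ _ h) -IntZ; last by move=> t; exact: ct_ctransf.
  rewrite -IntB; [|by move=> t; exact: ct_ctransf..].
  rewrite -IntB; last 2 first.
  - by move=> t; apply: ctB; exact: ct_ctransf.
  - by move=> t; apply: ctM; [exact: ct_cst|exact: ct_ctransf].
  congr (Int _ _ _); apply: funext => t.
  rewrite (mulrCA (h ^+ 2)) -hK ?circ_neq//; last first.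
    by rewrite -addrA -opprD /h (addrC w) subrK circ_neq.
  have -> : circ p r t - w' = circ p r t - w - h by rewrite /h; ring.
  by ring.
have cA t : ct (fun t => h ^+ 2 * (c t * K (circ p r t - w) h)) t.
  have E : (fun t => h ^+ 2 * (c t * K (circ p r t - w) h)) =
     (fun t => c t / (circ p r t - w') ^+ m - c t / (circ p r t - w) ^+ m -
        n%:R * h * (c t / (circ p r t - w) ^+ m')).
    apply: funext => t'.
    rewrite (mulrCA (h ^+ 2)) -hK ?circ_neq//; last first.
      by rewrite -addrA -opprD /h (addrC w) subrK circ_neq.
    have -> : circ p r t' - w' = circ p r t' - w - h by rewrite /h; ring.
    by ring.
  rewrite E; apply: ctB; first by apply: ctB; exact: ct_ctransf.
  by apply: ctM; [exact: ct_cst|exact: ct_ctransf].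
have := @Int_le _ _ 0 (pi *+ 2) (cmod h ^+ 2 * (M * B)) tpi_ge0 cA.
rewrite subr0 => /(_ _)/le_trans; apply.
  move=> t ht; rewrite cmodM cmodX ler_wpM2l ?exprn_ge0 ?cmod_ge0//.
  rewrite cmodM ler_pM ?cmod_ge0 ?hM// hB ?(ltW hd)//.
  exact: circ_dist.
have -> : cmod h ^+ 2 * (M * B) * (pi *+ 2) = cmod h * (M * B * (pi *+ 2)) * cmod h.
  by ring.
rewrite ler_wpM2r ?cmod_ge0// (le_trans (y := cmod h * D))//.
  by rewrite ler_wpM2l ?cmod_ge0// /D lerDl.
by move: he; rewrite ltr_pdivlMr// => /ltW.
Qed.

Lemma dv_ctransf1 p r c w : (forall t, ct c t) -> cmod (w - p) < r ->
  dv id (ctransf p r 1 c) w (ctransf p r 2 c w).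
Proof.
move=> cc wr; rewrite -[ctransf p r 2 c w]mul1r.
have d0 : 0 < r - cmod (w - p) by rewrite subr_gt0.
apply: (@dv_ctransf_aux _ _ _ _ 1 _ _ (fun A h => (A ^+ 2 * (A - h))^-1)
  ((r - cmod (w - p)) ^+ 2 * ((r - cmod (w - p)) / 2))^-1) => //.
  by move=> A h A0 Ah; rewrite mul1r; field; rewrite A0 Ah.
move=> A h hA hh; set d := r - _ in d0 hA hh *.
have d20 : 0 < d / 2 by rewrite divr_gt0.
have dh : d / 2 <= cmod (A - h) by have := cmod_leB A h; lra.
have A0 := lt_le_trans d0 hA; have Ah0 := lt_le_trans d20 dh.
rewrite cmodV cmodM cmodX lef_pV2 ?posrE ?mulr_gt0 ?exprn_gt0//.
rewrite ler_pM ?mulr_ge0 ?exprn_ge0 ?(ltW d0) ?(ltW d20)//.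
by apply: lerXn2r; rewrite ?nnegrE ?(ltW d0) ?(ltW A0).
Qed.

Lemma dv_ctransf2 p r c w : (forall t, ct c t) -> cmod (w - p) < r ->
  dv id (ctransf p r 2 c) w (2%:R * ctransf p r 3 c w).
Proof.
move=> cc wr.
have d0 : 0 < r - cmod (w - p) by rewrite subr_gt0.
(* The remainder of [A^-2]. With [d] the distance to the circle, its numerator is at most [4 |A|],
   and [|A| >= d], [|A - h| >= d / 2], whence [16 / d^4]. *)
apply: (@dv_ctransf_aux _ _ _ _ 2 _ _
    (fun A h => (3 * A - 2 * h) / (A ^+ 3 * (A - h) ^+ 2))
    (16 / (r - cmod (w - p)) ^+ 4)) => //.
  by move=> A h A0 Ah; field; rewrite A0 Ah.
move=> A h hA hh; set d := r - _ in d0 hA hh *.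
have d20 : 0 < d / 2 by rewrite divr_gt0.
have dh : d / 2 <= cmod (A - h) by have := cmod_leB A h; lra.
have A0 := lt_le_trans d0 hA; have Ah0 := lt_le_trans d20 dh.
have n1 : cmod (3 * A - 2 * h) <= 4 * cmod A.
  have := cmodDB (3 * A) (2 * h); rewrite !cmodM !cmod_nat; lra.
rewrite cmodM cmodV cmodM !cmodX ler_pdivrMr ?mulr_gt0 ?exprn_gt0//.
rewrite (le_trans n1)// mulrAC ler_pdivlMr ?exprn_gt0//.
have s1 : d ^+ 2 <= cmod A ^+ 2 by apply: lerXn2r; rewrite ?nnegrE ?(ltW d0) ?(ltW A0).
have s2 : (d / 2) ^+ 2 <= cmod (A - h) ^+ 2.
  by apply: lerXn2r; rewrite ?nnegrE ?(ltW d20) ?(ltW Ah0).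
have -> : 4 * cmod A * d ^+ 4 = 16 * (cmod A * (d ^+ 2 * (d / 2) ^+ 2)) by field.
rewrite ler_pM2l// (exprS (cmod A) 2) -(mulrA (cmod A) (cmod A ^+ 2)) ler_pM2l//.
by apply: ler_pM; [apply: exprn_ge0; exact: ltW|apply: exprn_ge0; exact: ltW|exact: s1|exact: s2].
Qed.

(** The derivative in [w] is the transform of order 2, which is 0 because its integrand has the
    primitive [- 1 / (z - w)] on the closed circle. The value is therefore that at the centre, where
    the integrand is the constant [i]. *)
Lemma ctransf_dcirc p r w : cmod (w - p) < r ->
  ctransf p r 1 (dcirc r) w = 'i * (pi *+ 2)%:C.
Proof.
move=> wr; have r0 : 0 < r by rewrite (le_lt_trans (cmod_ge0 _) wr).
have T2 z : cmod (z - p) < r -> ctransf p r 2 (dcirc r) z = 0.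
  move=> zr; rewrite /ctransf (@IntE _ _ (fun t => - (circ p r t - z)^-1)).
    by rewrite /circ cis0 cis2pi subrr.
  move=> t; have h : dv rc (fun t => circ p r t - z) t (dcirc r t - 0).
    by apply: dvB; [exact: dv_circ|exact: dv_cst].
  have := dvN (dvV (@ct_real R t) (circ_neq t zr) h).
  by rewrite subr0 mulNr opprK.
have E : ctransf p r 1 (dcirc r) p = 'i * (pi *+ 2)%:C.
  rewrite /ctransf (@IntE _ _ (fun t => 'i * t%:C)) ?rmorph0 ?mulr0 ?subr0//.
  move=> t; rewrite (_ : _ / _ = 'i * 1).
    by apply: dvZ; [exact: ct_real|exact: dv_id].
  have := @circ_neq p r p t; rewrite subrr cmod0 => /(_ r0).
  rewrite /circ addrC addKr /dcirc expr1 => h; rewrite mulr1 mulrCA mulfK//.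
rewrite -E.
pose g (x : R) := p + x%:C * (w - p).
have dg x : dv rc g x (w - p).
  rewrite -[X in dv _ _ _ X]add0r; apply: dvD; first exact: dv_cst.
  have := dvM (@ct_real R x) (dv_id rc x) (dv_cst rc x (w - p)).
  by rewrite mul1r mulr0 addr0.
have gr x : 0 <= x <= 1 -> cmod (g x - p) < r.
  case/andP => x0 x1; rewrite /g addrC addKr cmodM cmodr ger0_norm//.
  by rewrite (le_lt_trans _ wr)// ler_piMl// cmod_ge0.
have -> : w = g 1 by rewrite /g mul1r addrC subrK.
have -> : ctransf p r 1 (dcirc r) p = ctransf p r 1 (dcirc r) (g 0).
  by rewrite /g mul0r addr0.
apply/eqP; rewrite -subr_eq0 -cmod_eq0 eq_le cmod_ge0 andbT.
apply: (@le_trans _ _ (0 * (1 - 0))); last by rewrite mul0r.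
apply: (@mvt_le _ (fun x => ctransf p r 1 (dcirc r) (g x)) (fun=> 0) 0 1 0) => //.
  move=> x hx; rewrite -[X in dv _ _ _ X](mul0r (w - p)) -(T2 _ (gr _ hx)).
  apply: dv_comp; [exact: ct_real|exact: dg|].
  by apply: dv_ctransf1; [exact: ct_dcirc|exact: gr].
by move=> *; rewrite cmod0.
Qed.

End CauchyTransform.

(** * Cauchy's integral formula *)

Section CauchyFormula.
Variable (R : realType).
Local Notation C := R[i].
Local Notation rc := (@real_complex_def R (Phant R)).
Local Open Scope complex_scope.
Implicit Types (p w z : C) (r rho : R) (f : C -> C).

Definition hol p rho f := forall z, cmod (z - p) < rho -> derivable f z 1.

(** Homotopy parameter: it goes from 1 at [s = 0] to 0 at infinity without reaching 0, and its
    derivative is bounded on the whole line. Thus [w + (z - w) * tau s] shrinks the circle towards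
    [w] but never meets [w], where the difference quotient is singular. *)
Definition tau (s : R) : C := (1 + s%:C ^+ 2)^-1.
Definition dtau (s : R) : C := - (2 * s%:C) / (1 + s%:C ^+ 2) ^+ 2.

Lemma tau_real s : 1 + s%:C ^+ 2 = (1 + s ^+ 2)%:C :> C.
Proof. by rewrite rmorphD rmorph1 rmorphXn. Qed.

Lemma tau_pos (s : R) : 0 < 1 + s ^+ 2.
Proof. by rewrite ltr_wpDr// sqr_ge0. Qed.

Lemma tauE s : tau s = ((1 + s ^+ 2)^-1)%:C.
Proof. by rewrite /tau tau_real -fmorphV. Qed.

Lemma tau_neq0 s : (1 + s%:C ^+ 2 : C) != 0.
Proof. by rewrite tau_real -cmod_gt0 cmodr normr_gt0 gt_eqF// tau_pos. Qed.

Lemma dv_tau s : dv rc tau s (dtau s).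
Proof.
apply: dvV; [exact: ct_real|exact: tau_neq0|].
rewrite -[X in dv _ _ _ X]add0r; apply: dvD; first exact: dv_cst.
have := dvX (@ct_real R s) 1 (dv_id rc s).
by rewrite expr1 mulr1.
Qed.

Lemma ct_dtau s : ct dtau s.
Proof.
apply: ctM; first by apply: ctN; apply: ctM; [exact: ct_cst|exact: ct_real].
apply: ctV; first by rewrite expf_neq0// tau_neq0.
by apply: ctX; apply: ctD; [exact: ct_cst|apply: ctX; exact: ct_real].
Qed.

Lemma cmod_tau s : cmod (tau s) = (1 + s ^+ 2)^-1.
Proof. by rewrite tauE cmodr ger0_norm// invr_ge0 ltW// tau_pos. Qed.

Lemma tau_le1 s : (1 + s ^+ 2)^-1 <= 1 :> R.
Proof. by rewrite invf_le1 ?tau_pos// lerDl sqr_ge0. Qed.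

Lemma dtau_le1 s : cmod (dtau s) <= 1.
Proof.
rewrite /dtau tau_real cmodM cmodV cmodX cmodN cmodM !cmodr cmod_nat.
have h := tau_pos s; rewrite [X in _ / X ^+ 2]ger0_norm ?(ltW h)//.
rewrite ler_pdivrMr ?exprn_gt0// mul1r.
have h1 : 2 * `|s| <= 1 + s ^+ 2.
  rewrite -(real_normK (num_real s)); have := sqr_ge0 (`|s| - 1); rewrite sqrrB; lra.
have h2 : 0 <= s ^+ 2 := sqr_ge0 s.
by rewrite (le_trans h1)// expr2 ler_peMl ?(ltW h)// lerDl.
Qed.

Section Formula.
Variables (p w : C) (r rho : R) (f : C -> C).
Hypothesis hf : hol p rho f.
Hypothesis rrho : r < rho.
Hypothesis wr : cmod (w - p) < r.

Let r0 : 0 < r. Proof. exact: le_lt_trans (cmod_ge0 _) wr. Qed.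

Lemma ct_circ_comp t : ct (fun t => f (circ p r t)) t.
Proof.
apply: ct_comp; first exact: (ct_continuous (ct_circ p r t)).
by apply: derivable_ct; apply: hf; rewrite circP ?(ltW r0).
Qed.

Let Phi s t := w + (circ p r t - w) * tau s.

Let Phi_in s t : cmod (Phi s t - p) <= r.
Proof.
rewrite /Phi.
have -> : w + (circ p r t - w) * tau s - p =
    (1 - tau s) * (w - p) + tau s * (circ p r t - p) by ring.
have t1 : cmod (1 - tau s) = 1 - (1 + s ^+ 2)^-1.
  by rewrite tauE -(rmorph1 (real_complex R)) -rmorphB cmodr ger0_norm ?subr_ge0 ?tau_le1.
rewrite (le_trans (cmodD _ _))// !cmodM t1 cmod_tau circP ?(ltW r0)//.
have a0 : 0 <= 1 - (1 + s ^+ 2)^-1 by rewrite subr_ge0 tau_le1.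
have := ler_wpM2l a0 (ltW wr); lra.
Qed.

Let Phi_neq s t : Phi s t - w != 0.
Proof.
rewrite /Phi addrC addKr mulf_neq0 ?circ_neq//.
by rewrite /tau invr_eq0 tau_neq0.
Qed.

Let dPhi1 s t : dv rc (Phi^~ t) s ((circ p r t - w) * dtau s).
Proof.
rewrite -[X in dv _ _ _ X]add0r; apply: dvD; first exact: dv_cst.
by apply: dvZ; [exact: ct_real|exact: dv_tau].
Qed.

Let dPhi2 s t : dv rc (Phi s) t (dcirc r t * tau s).
Proof.
rewrite -[X in dv _ _ _ X]add0r; apply: dvD; first exact: dv_cst.
have h : dv rc (fun t => circ p r t - w) t (dcirc r t - 0).
  by apply: dvB; [exact: dv_circ|exact: dv_cst].
by have := dvM (@ct_real R t) h (dv_cst rc t (tau s)); rewrite mulr0 addr0 subr0.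
Qed.

Let F z := (f z - f w) / (z - w).

Let dF s t : exists l, dv id F (Phi s t) l.
Proof.
have h1 : dv id f (Phi s t) (derive1 f (Phi s t)).
  by apply: derivable_dv; apply: hf; rewrite (le_lt_trans (Phi_in _ _)).
have h2 : dv id (fun z => f z - f w) (Phi s t) (derive1 f (Phi s t) - 0).
  by apply: dvB => //; exact: dv_cst.
have h3 : dv id (fun z => z - w) (Phi s t) (1 - 0).
  by apply: dvB; [exact: dv_id|exact: dv_cst].
have := dvM (@ct_id R _) h2 (@dvV _ _ _ _ (@ct_id R _) (fun z => z - w) _ (Phi_neq s t) h3).
by move=> h; eexists; exact: h.
Qed.

Let K s := Int (fun t => F (Phi s t) * (dcirc r t * tau s)) 0 (pi *+ 2).

(** Goursat on the rectangle [[0, s] x [0, 2 pi]]: the loops being closed, the sides at angles 0 and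
    2 pi cancel. *)
Let K_eq s : 0 <= s -> K s = K 0.
Proof.
move=> s0.
have b1 s' t : cmod ((circ p r t - w) * dtau s') <= 2 * r.
  rewrite cmodM -[2 * r]mulr1 ler_pM ?cmod_ge0 ?dtau_le1//.
  rewrite (le_trans (cmod_tri _ p _))// circP ?(ltW r0)// mulr_natl mulr2n lerD2l.
  by rewrite cmodB ltW.
have b2 s' t : cmod (dcirc r t * tau s') <= 2 * r.
  rewrite cmodM cmod_dcirc ?(ltW r0)// cmod_tau (le_trans (y := r * 1))//.
    by rewrite ler_wpM2l ?(ltW r0)// tau_le1.
  by rewrite mulr1 ler_peMl ?(ltW r0)// ler1n.
have r20 : 0 <= 2 * r by rewrite mulr_ge0// ltW.
have c1 s' t : ct (fun s => (circ p r t - w) * dtau s) s'.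
  by apply: ctM; [exact: ct_cst|exact: ct_dtau].
have c2 s' t : ct (fun t => dcirc r t * tau s') t.
  by apply: ctM; [exact: ct_dcirc|exact: ct_cst].
have := goursat r20 dPhi1 dPhi2 c1 c2 b1 b2 dF s0 (@tpi_ge0 R) => /=.
have -> : (fun s => F (Phi s (pi *+ 2)) * ((circ p r (pi *+ 2) - w) * dtau s)) =
          (fun s => F (Phi s 0) * ((circ p r 0 - w) * dtau s)).
  by rewrite /Phi /circ cis2pi cis0.
by rewrite subrr subr0 => /eqP; rewrite subr_eq0 => /eqP.
Qed.

Let K0 : K 0 = 0.
Proof.
apply: cmod_lim0 => e e0.
have hw : dv id f w (derive1 f w) by apply: derivable_dv; apply: hf; rewrite (lt_trans wr).
have /nearC[eta eta0 heta] := dv_est hw (@ltr01 R).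
set l := derive1 f w in hw heta.
pose B := (cmod l + 1) * r * (pi *+ 2).
have B0 : 0 <= B.
  by rewrite mulr_ge0 ?tpi_ge0// mulr_ge0 ?(ltW r0)// addr_ge0// cmod_ge0.
(* The three terms give in turn [tau s <= 1 / s], a loop inside the [eta]-disc where the difference
   quotient is at most [|l| + 1], and an integral at most [e]. *)
pose s := 1 + 2 * r / eta + B / e.
have re0 : 0 <= 2 * r / eta by rewrite divr_ge0 ?(ltW eta0)// mulr_ge0// ltW.
have Be0 : 0 <= B / e by rewrite divr_ge0 ?(ltW e0).
have s1 : 1 <= s by rewrite /s; lra.
have ss : s <= 1 + s ^+ 2.
  by rewrite expr2 ler_wpDl// ler_peMl// (le_trans _ s1).
have s0 : 0 < s by rewrite (lt_le_trans _ s1).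
have ts : (1 + s ^+ 2)^-1 <= s^-1 by rewrite lef_pV2 ?posrE ?tau_pos.
have t0 : 0 < (1 + s ^+ 2)^-1 by rewrite invr_gt0 tau_pos.
rewrite -(K_eq (ltW s0)).
have hF t : cmod (F (Phi s t)) <= cmod l + 1.
  have hd : cmod (Phi s t - w) < eta.
    rewrite /Phi addrC addKr cmodM cmod_tau.
    have h2 : cmod (circ p r t - w) < 2 * r.
      rewrite (le_lt_trans (cmod_tri _ p _))// circP ?(ltW r0)// mulr_natl mulr2n ltrD2l.
      by rewrite cmodB.
    apply: lt_le_trans (_ : 2 * r * s^-1 <= _); last first.
      rewrite ler_pdivrMr// (mulrC eta) -ler_pdivrMr// /s; lra.
    by rewrite (lt_le_trans (y := 2 * r * (1 + s ^+ 2)^-1)) ?ltr_pM2r// ler_wpM2l// mulr_ge0// ltW.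
  have := heta _ hd; rewrite mul1r => h.
  have w0 : 0 < cmod (Phi s t - w) by rewrite cmod_gt0.
  rewrite /F cmodM cmodV ler_pdivrMr//.
  have -> : f (Phi s t) - f w = (f (Phi s t) - f w - l * (Phi s t - w)) + l * (Phi s t - w).
    by rewrite subrK.
  by rewrite (le_trans (cmodD _ _))// cmodM; lra.
have := @Int_le R (fun t => F (Phi s t) * (dcirc r t * tau s)) 0 (pi *+ 2)
  ((cmod l + 1) * (r * s^-1)) (@tpi_ge0 R).
rewrite subr0 => /(_ _ _)/le_trans; apply.
- move=> t; have [m hm] := dF s t; apply: ctM.
    by apply: dv_ct; last (apply: dv_comp; [|exact: dPhi2|exact: hm]); exact: ct_real.
  by apply: ctM; [exact: ct_dcirc|exact: ct_cst].
- move=> t _; rewrite cmodM ler_pM ?cmod_ge0// cmodM cmod_dcirc ?(ltW r0)// cmod_tau.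
  by rewrite ler_wpM2l// ltW.
rewrite mulrA mulrAC -/B ler_pdivrMr// (mulrC e) -ler_pdivrMr// /s; lra.
Qed.

(** [K 0 = 0] says that the difference quotient of [f] at [w] integrates to 0 over the circle; its
    term in [f w] is the transform of [dcirc], already computed. *)
Lemma cauchy_formula :
  ctransf p r 1 (fun t => f (circ p r t) * dcirc r t) w = f w * ('i * (pi *+ 2)%:C).
Proof.
rewrite -(ctransf_dcirc wr) /ctransf -IntZ; last first.
  by move=> t; apply: ct_ctransf => //; exact: ct_dcirc.
apply/eqP; rewrite -subr_eq0 -IntB; last 2 first.
- move=> t; apply: ct_ctransf => // t'.
  by apply: ctM; [exact: ct_circ_comp|exact: ct_dcirc].
- by move=> t; apply: ctM; [exact: ct_cst|apply: ct_ctransf => //; exact: ct_dcirc].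
rewrite -K0 /K; apply/eqP; congr (Int _ _ _); apply: funext => t.
have T : tau 0 = 1 by rewrite /tau rmorph0 expr0n addr0 invr1.
have -> : Phi 0 t = circ p r t by rewrite /Phi T mulr1 addrC subrK.
by rewrite /F T mulr1 expr1; ring.
Qed.

End Formula.
End CauchyFormula.

(** * Local theory of holomorphic functions *)

Section Holomorphic.
Variable (R : realType).
Local Notation C := R[i].
Local Notation rc := (@real_complex_def R (Phant R)).
Local Open Scope complex_scope.
Implicit Types (p w z : C) (r rho : R) (f g q : C -> C).

Lemma hol_sub p rho p' rho' f : cmod (p' - p) + rho' <= rho ->
  hol p rho f -> hol p' rho' f.
Proof.
move=> h hf z hz; apply: hf.
have := cmod_tri z p' p; lra.
Qed.

Lemma hol_dv p rho f z : hol p rho f -> cmod (z - p) < rho -> dv id f z (derive1 f z).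
Proof. by move=> hf hz; apply/derivable_dv/hf. Qed.

Lemma hol_ct p rho f z : hol p rho f -> cmod (z - p) < rho -> ct f z.
Proof. by move=> hf hz; apply/derivable_ct/hf. Qed.

Lemma near_disc p r z : cmod (z - p) < r -> \forall w \near z, cmod (w - p) < r.
Proof.
move=> zr; apply/nearC; exists (r - cmod (z - p)); first by rewrite subr_gt0.
by move=> w hw; have := cmod_tri w z p; lra.
Qed.

Let K2 : C := 'i * (pi *+ 2)%:C.

Let tpi_gt0 : 0 < (pi : R) *+ 2.
Proof. by rewrite mulrn_wgt0// pi_gt0. Qed.

Let cmodK2 : cmod K2 = pi *+ 2.
Proof. by rewrite cmodM cmod_i mul1r cmodr ger0_norm// tpi_ge0. Qed.

Let K2_neq0 : K2 != 0.
Proof. by rewrite -cmod_gt0 cmodK2. Qed.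

Section Disc.
Variables (p : C) (r rho : R) (f : C -> C).
Hypothesis hf : hol p rho f.
Hypothesis rrho : r < rho.
Let c t := f (circ p r t) * dcirc r t.

Lemma ct_boundary t : 0 < r -> ct c t.
Proof.
move=> r0; apply: ctM; last exact: ct_dcirc.
apply: (@ct_circ_comp _ p p _ _ _ hf rrho).
by rewrite subrr cmod0.
Qed.

Lemma hol_cauchy w : cmod (w - p) < r -> f w = K2^-1 * ctransf p r 1 c w.
Proof. by move=> wr; rewrite (cauchy_formula hf rrho wr) mulrC mulfK. Qed.

Lemma hol_derive1E w : cmod (w - p) < r -> derive1 f w = K2^-1 * ctransf p r 2 c w.
Proof.
move=> wr; have r0 : 0 < r := le_lt_trans (cmod_ge0 _) wr.
apply: dv_derive1.
apply: (@dv_near _ _ _ _ (fun w => K2^-1 * ctransf p r 1 c w)).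
  by apply: filterS (near_disc wr) => z zr; rewrite -hol_cauchy.
apply: dvZ; first exact: ct_id.
by apply: dv_ctransf1 => // t; exact: ct_boundary.
Qed.

Lemma hol_derivable_derive1 w : cmod (w - p) < r -> derivable (derive1 f) w 1.
Proof.
move=> wr; have r0 : 0 < r := le_lt_trans (cmod_ge0 _) wr.
apply: (@dv_derivable _ _ _ (K2^-1 * (2%:R * ctransf p r 3 c w))).
apply: (@dv_near _ _ _ _ (fun w => K2^-1 * ctransf p r 2 c w)).
  by apply: filterS (near_disc wr) => z zr; rewrite -hol_derive1E.
apply: dvZ; first exact: ct_id.
by apply: dv_ctransf2 => // t; exact: ct_boundary.
Qed.

(** A weak maximum principle straight from Cauchy's formula. The factor [r / (r - |w - p|)] is 1 at
    the centre, and elsewhere it is absorbed by a limit. *)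
Lemma hol_le w M : cmod (w - p) < r ->
  (forall t, 0 <= t <= pi *+ 2 -> cmod (f (circ p r t)) <= M) ->
  cmod (f w) <= M * r / (r - cmod (w - p)).
Proof.
move=> wr hM; have r0 : 0 < r := le_lt_trans (cmod_ge0 _) wr.
have hc t : 0 <= t <= pi *+ 2 -> cmod (c t) <= M * r.
  by move=> ht; rewrite cmodM cmod_dcirc ?(ltW r0)// ler_wpM2r ?hM// ltW.
have := ctransf_le 1 (fun t => ct_boundary t r0) wr hc.
rewrite hol_cauchy// cmodM cmodV cmodK2 expr1 => h.
by rewrite mulrC ler_pdivrMr.
Qed.

Lemma hol_derive1_le w M : cmod (w - p) < r ->
  (forall t, 0 <= t <= pi *+ 2 -> cmod (f (circ p r t)) <= M) ->
  cmod (derive1 f w) <= M * r / (r - cmod (w - p)) ^+ 2.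
Proof.
move=> wr hM; have r0 : 0 < r := le_lt_trans (cmod_ge0 _) wr.
have hc t : 0 <= t <= pi *+ 2 -> cmod (c t) <= M * r.
  by move=> ht; rewrite cmodM cmod_dcirc ?(ltW r0)// ler_wpM2r ?hM// ltW.
have := ctransf_le 2 (fun t => ct_boundary t r0) wr hc.
rewrite hol_derive1E// cmodM cmodV cmodK2 => h.
by rewrite mulrC ler_pdivrMr.
Qed.

End Disc.

Lemma hol_derive1 p rho f : hol p rho f -> hol p rho (derive1 f).
Proof.
move=> hf z hz; apply: (@hol_derivable_derive1 p ((cmod (z - p) + rho) / 2) rho f) => //.
  by rewrite ltr_pdivrMr//; lra.
by rewrite ltr_pdivlMr//; lra.
Qed.

Lemma hol_derive1_center p rho f M : 0 < rho -> hol p rho f ->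
  (forall z, cmod (z - p) < rho -> cmod (f z) <= M) ->
  cmod (derive1 f p) <= 2 * M / rho.
Proof.
move=> rho0 hf hM; have r0 : 0 < rho / 2 by rewrite divr_gt0.
have rr : rho / 2 < rho by rewrite ltr_pdivrMr// ltr_pMr// ltr1n.
have := @hol_derive1_le p (rho / 2) rho f hf rr p M.
rewrite subrr cmod0 subr0 => /(_ r0 _)/le_trans; apply.
  by move=> t _; apply: hM; rewrite circP ?(ltW r0).
rewrite le_eqVlt; apply/orP; left; apply/eqP; field.
by rewrite gt_eqF.
Qed.

(** Off [p] the quotient is plainly differentiable. Near [p] it is itself a Cauchy transform, of the
    boundary values of [f] divided by [z - p], hence differentiable at [p] too. *)
Lemma hol_divide p rho f : 0 < rho -> hol p rho f -> f p = 0 ->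
  exists2 q, hol p rho q & forall z, f z = (z - p) * q z.
Proof.
move=> rho0 hf fp0.
pose q z := if z == p then derive1 f p else f z / (z - p).
exists q; last first.
  move=> z; rewrite /q; case: eqP => [->|/eqP zp]; first by rewrite subrr mul0r.
  by rewrite mulrC divfK// subr_eq0.
move=> z zr; have [->|zp] := eqVneq z p; last first.
  have zp0 : z - p != 0 by rewrite subr_eq0.
  have h3 : dv id (fun z => z - p) z (1 - 0).
    by apply: dvB; [exact: dv_id|exact: dv_cst].
  have h := dvM (@ct_id R _) (hol_dv hf zr)
    (@dvV _ _ _ _ (@ct_id R _) (fun z => z - p) _ zp0 h3).
  apply: dv_derivable; apply: dv_near h.
  have : \forall w \near z, cmod (w - z) < cmod (z - p).
    by apply/nearC; exists (cmod (z - p)); rewrite ?cmod_gt0.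
  apply: filterS => w hw; rewrite /q; case: eqP => // wp; subst w.
  by rewrite cmodB ltxx in hw.
pose r := rho / 2; have r0 : 0 < r by rewrite divr_gt0.
have rr : r < rho by rewrite ltr_pdivrMr// ltr_pMr// ltr1n.
pose c t := f (circ p r t) * dcirc r t.
have cc t : ct c t by exact: ct_boundary hf rr t r0.
pose d t := c t / (circ p r t - p).
have pr : cmod (p - p) < r by rewrite subrr cmod0.
have cd t : ct d t.
  apply: ctM => //; apply: ctV; first exact: circ_neq.
  by apply: ctB; [exact: ct_circ|exact: ct_cst].
apply: (@dv_derivable _ _ _ (K2^-1 * ctransf p r 2 d p)).
apply: (@dv_near _ _ _ _ (fun w => K2^-1 * ctransf p r 1 d w)); last first.
  by apply: dvZ; [exact: ct_id|exact: dv_ctransf1].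
apply: filterS (near_disc pr) => w wr; rewrite /q; case: eqP => [->|/eqP wp].
  rewrite (hol_derive1E hf rr pr) /ctransf; congr (_ * Int _ _ _).
  by apply: funext => t; rewrite /d expr1 expr2 invfM mulrA.
apply: canRL (mulfK _) _; first by rewrite subr_eq0.
rewrite -[RHS]subr0 -fp0 (hol_cauchy hf rr pr) (hol_cauchy hf rr wr) -mulrBr.
rewrite mulrAC -mulrA; congr (_ * _).
rewrite /ctransf -IntZ; last by move=> t; exact: ct_ctransf.
rewrite -IntB; [|by move=> t; exact: ct_ctransf..].
congr (Int _ _ _); apply: funext => t; rewrite /d /c !expr1.
by field; rewrite !circ_neq.
Qed.

(** [(z - p)^2 f] is differentiable at [p] with derivative 0 because [f] is bounded; dividing it
    twice by [z - p] gives the extension. *)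
Lemma removable p rho f M : 0 < rho ->
  (forall z, 0 < cmod (z - p) < rho -> derivable f z 1) ->
  (forall z, 0 < cmod (z - p) < rho -> cmod (f z) <= M) ->
  exists2 g, hol p rho g & forall z, 0 < cmod (z - p) < rho -> g z = f z.
Proof.
move=> rho0 hf hM.
pose h z := (z - p) * (z - p) * f z.
have dzp z : dv id (fun z => z - p) z 1.
  rewrite -[X in dv _ _ _ X]subr0.
  by apply: dvB; [exact: dv_id|exact: dv_cst].
have hp : dv id h p 0.
  apply: est_dv => a a0; apply/nearC.
  have M1 : 0 < `|M| + 1 by rewrite ltr_wpDl.
  have m0 : 0 < Num.min rho (a / (`|M| + 1)).
    by rewrite lt_min rho0 divr_gt0.
  exists (Num.min rho (a / (`|M| + 1))) => //.
  move=> z; rewrite lt_min => /andP[zr za].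
  rewrite /h subrr !mul0r !subr0 /=.
  have [->|zp] := eqVneq z p; first by rewrite subrr !mul0r cmod0 mulr0.
  have zp0 : 0 < cmod (z - p) by rewrite cmod_gt0 subr_eq0.
  have fM := hM z; rewrite zp0 zr in fM; have {}fM := fM isT.
  rewrite -mulrA mulrC !cmodM ler_pM2r//.
  move: za; rewrite ltr_pdivlMr// => /ltW; apply: le_trans.
  by rewrite ler_wpM2l ?cmod_ge0// (le_trans fM)// (le_trans (ler_norm _))// lerDl.
have hh : hol p rho h.
  move=> z zr; have [->|zp] := eqVneq z p; first exact: dv_derivable hp.
  have /hf/derivable_dv dfz : 0 < cmod (z - p) < rho by rewrite zr cmod_gt0 subr_eq0 zp.
  exact: dv_derivable (dvM (@ct_id R _) (dvM (@ct_id R _) (dzp z) (dzp z)) dfz).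
have [|q hq hqE] := hol_divide rho0 hh; first by rewrite /h subrr !mul0r.
have qp : q p = 0.
  have pp : cmod (p - p) < rho by rewrite subrr cmod0.
  have := dvM (@ct_id R p) (dzp p) (hol_dv hq pp).
  rewrite mul1r [X in _ + X](_ : _ = 0) ?addr0 => [h2|]; last by rewrite subrr mul0r.
  have hE : h = fun z => (z - p) * q z by apply: funext.
  by rewrite -(dv_derive1 h2) -hE (dv_derive1 hp).
have [g hg hgE] := hol_divide rho0 hq qp.
exists g => // z /andP[z0 zr].
have zp0 : z - p != 0 by rewrite -cmod_gt0.
have := hqE z; rewrite hgE /h -mulrA => /(mulfI zp0)/(mulfI zp0) ->//.
Qed.

(** If [z - p] can be divided out [m] times for every [m], the estimate on a circle of radius [r]
    gives [|f z| <= (|z - p| / r)^m B], which tends to 0. *)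
Lemma hol_order p rho f : 0 < rho -> hol p rho f ->
  (forall z, cmod (z - p) < rho -> f z = 0) \/
  exists m q, [/\ hol p rho q, q p != 0 & forall z, f z = (z - p) ^+ m * q z].
Proof.
move=> rho0 hf.
have [|/forallNP H] := pselect (exists m q, [/\ hol p rho q, q p != 0 &
  forall z, f z = (z - p) ^+ m * q z]); [by right|left => z zr].
have Hm m : exists2 q, hol p rho q & forall z, f z = (z - p) ^+ m * q z.
  elim: m => [|m [q hq fE]]; first by exists f => // w; rewrite expr0 mul1r.
  have [qp|qp] := eqVneq (q p) 0; last by exfalso; apply: (H m); exists q.
  have [g hg gE] := hol_divide rho0 hq qp.
  by exists g => // w; rewrite fE gE exprS mulrA (mulrC (w - p)).
pose r := (cmod (z - p) + rho) / 2.
have zr' : cmod (z - p) < r by rewrite ltr_pdivlMr//; lra.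
have rr : r < rho by rewrite ltr_pdivrMr//; lra.
have r0 : 0 < r := le_lt_trans (cmod_ge0 _) zr'.
have cf t : ct (fun t => f (circ p r t)) t.
  by apply: (@ct_circ_comp _ p z _ _ _ hf rr).
have [M M0 hM] := ct_bounded (@tpi_ge0 R) cf.
have fm m : cmod (f z) <= (cmod (z - p) / r) ^+ m * (M * r / (r - cmod (z - p))).
  have [g hg gE] := Hm m.
  rewrite gE cmodM cmodX expr_div_n -(mulrA (cmod (z - p) ^+ m)) ler_wpM2l ?exprn_ge0 ?cmod_ge0//.
  have := @hol_le p r rho g hg rr z (M / r ^+ m) zr'.
  move=> /(_ _)/le_trans; apply.
    move=> t ht; have := hM t ht; rewrite gE cmodM cmodX circP ?(ltW r0)//.
    by rewrite ler_pdivlMr ?exprn_gt0// mulrC.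
  by rewrite le_eqVlt; apply/orP; left; apply/eqP; ring.
apply: cmod_lim0 => e e0; set B := M * r / _ in fm.
have B0 : 0 <= B by rewrite divr_ge0 ?subr_ge0 ?(ltW zr')// mulr_ge0// ltW.
have s1 : `|cmod (z - p) / r| < 1.
  have h0 : 0 <= cmod (z - p) / r by apply: divr_ge0; [exact: cmod_ge0|exact: ltW].
  by rewrite (ger0_norm h0) ltr_pdivrMr// mul1r.
have e1 : 0 < e / (B + 1) by rewrite divr_gt0// ltr_wpDl.
have /cvgrPdist_lt/(_ _ e1)[N _ hN] := cvg_expr s1.
have := hN N (leqnn N); rewrite /= sub0r normrN => h.
rewrite (le_trans (fm N))// (le_trans (y := e / (B + 1) * B))//.
  by rewrite ler_wpM2r// (le_trans (ler_norm _))// ltW.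
by rewrite mulrAC ler_pdivrMr ?ltr_wpDl// ler_wpM2l ?(ltW e0)// lerDl.
Qed.

Lemma hol_isolated p rho f : 0 < rho -> hol p rho f ->
  (forall z, cmod (z - p) < rho -> f z = 0) \/
  exists2 d, 0 < d <= rho & forall z, 0 < cmod (z - p) < d -> f z != 0.
Proof.
move=> rho0 hf; have [|[m [q [hq qp fE]]]] := hol_order rho0 hf; [by left|right].
have q0 : 0 < cmod (q p) by rewrite cmod_gt0.
have pp : cmod (p - p) < rho by rewrite subrr cmod0.
have /ctP/(_ _ q0)/nearC[d d0 hd] := hol_ct hq pp.
exists (Num.min d rho); first by rewrite lt_min d0 rho0 ge_min lexx orbT.
move=> z /andP[zp]; rewrite lt_min => /andP[/hd zd _].
rewrite fE mulf_neq0// ?expf_neq0 -?cmod_gt0//.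
by have := cmod_leBr (q z) (q p); lra.
Qed.

(** The Cauchy formula passes to the uniform limit, and a Cauchy transform of continuous data is
    differentiable. *)
Lemma weierstrass p rho (fn : nat -> C -> C) f :
  (forall n, hol p rho (fn n)) ->
  (forall e, 0 < e -> exists N, forall n, (N <= n)%N -> forall z,
     cmod (z - p) < rho -> cmod (fn n z - f z) <= e) ->
  hol p rho f.
Proof.
move=> hfn hlim z zr.
pose r := (cmod (z - p) + rho) / 2.
have zr' : cmod (z - p) < r by rewrite ltr_pdivlMr//; lra.
have rr : r < rho by rewrite ltr_pdivrMr//; lra.
have r0 : 0 < r := le_lt_trans (cmod_ge0 _) zr'.
pose c t := f (circ p r t) * dcirc r t.
have cin t : cmod (circ p r t - p) < rho by rewrite circP ?(ltW r0).
have cf t : ct (fun t => f (circ p r t)) t.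
  apply/ctP => e e0; have e3 : 0 < e / 3 by rewrite divr_gt0.
  have [N hN] := hlim _ e3; have {}hN := hN N (leqnn N).
  have /ctP/(_ _ e3) := @ct_circ_comp _ p z r rho (fn N) (hfn N) rr zr' t.
  apply: filterS => u hu.
  have a1 := hN _ (cin u); have a2 := hN _ (cin t).
  have := cmod_tri (f (circ p r u)) (fn N (circ p r u)) (f (circ p r t)).
  have := cmod_tri (fn N (circ p r u)) (fn N (circ p r t)) (f (circ p r t)).
  rewrite (cmodB (f (circ p r u)) (fn N _)).
  move: hu a1 a2; move: (cmod _) (cmod _) (cmod _) (cmod _) (cmod _) => x1 x2 x3 x4 x5.
  by clear; lra.
have cc t : ct c t by apply: ctM; [exact: cf|exact: ct_dcirc].
have E w : cmod (w - p) < r -> f w = K2^-1 * ctransf p r 1 c w.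
  move=> wr; apply/eqP; rewrite -subr_eq0; apply/eqP; apply: cmod_lim0 => e e0.
  have wr0 : 0 < r - cmod (w - p) by rewrite subr_gt0.
  pose B := r / (r - cmod (w - p)).
  have B0 : 0 < B by rewrite divr_gt0.
  have e1 : 0 < e / (1 + B) by rewrite divr_gt0// addr_gt0.
  have [N hN] := hlim _ e1; have {}hN := hN N (leqnn N).
  have wrho : cmod (w - p) < rho by rewrite (lt_trans wr).
  have h1 := hN _ wrho.
  pose cN t := fn N (circ p r t) * dcirc r t.
  have ccN t : ct cN t := ct_boundary (hfn N) rr t r0.
  have h2 : cmod (K2^-1 * ctransf p r 1 (fun t => cN t - c t) w) <= e / (1 + B) * B.
    have hM t : 0 <= t <= pi *+ 2 -> cmod (cN t - c t) <= e / (1 + B) * r.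
      move=> _; rewrite /cN /c -mulrBl cmodM cmod_dcirc ?(ltW r0)//.
      by rewrite ler_wpM2r ?(ltW r0)// hN.
    have := ctransf_le 1 (fun t => ctB (ccN t) (cc t)) wr hM.
    rewrite cmodM cmodV cmodK2 expr1 => h.
    by rewrite mulrC ler_pdivrMr// /B mulrA.
  have -> : f w - K2^-1 * ctransf p r 1 c w =
      K2^-1 * ctransf p r 1 (fun t => cN t - c t) w - (fn N w - f w).
    rewrite (hol_cauchy (hfn N) rr wr) -/cN.
    have -> : ctransf p r 1 (fun t => cN t - c t) w =
        ctransf p r 1 cN w - ctransf p r 1 c w.
      rewrite /ctransf -IntB; [|by move=> t; exact: ct_ctransf..].
      by congr (Int _ _ _); apply: funext => t; rewrite mulrBl.
    by ring.
  rewrite (le_trans (cmodDB _ _))//.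
  have := lerD h2 h1 => /le_trans; apply.
  rewrite le_eqVlt; apply/orP; left; apply/eqP; field.
  by rewrite gt_eqF// addr_gt0.
apply: (@dv_derivable _ _ _ (K2^-1 * ctransf p r 2 c z)).
apply: (@dv_near _ _ _ _ (fun w => K2^-1 * ctransf p r 1 c w)).
  by apply: filterS (near_disc zr') => w wr; rewrite -E.
by apply: dvZ; [exact: ct_id|exact: dv_ctransf1].
Qed.

Lemma hol_inv p rho f : hol p rho f -> (forall z, cmod (z - p) < rho -> f z != 0) ->
  hol p rho (fun z => (f z)^-1).
Proof.
move=> hf f0 z zr; exact: dv_derivable (dvV (@ct_id R _) (f0 _ zr) (hol_dv hf zr)).
Qed.

(** Were [fn n] without zeros near [p], its inverse would be holomorphic and Cauchy's formula would
    bound it at [p] by its values on a small circle. There [|f| >= mu], so [|fn n p| >= 7 mu / 8],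
    against [|fn n p| <= mu / 8] from [f p = 0]. *)
Lemma hurwitz p rho (fn : nat -> C -> C) f d : 0 < rho -> 0 < d ->
  (forall n, hol p rho (fn n)) -> hol p rho f ->
  (forall e, 0 < e -> exists N, forall n, (N <= n)%N -> forall z,
     cmod (z - p) < rho -> cmod (fn n z - f z) <= e) ->
  f p = 0 -> (exists2 z, cmod (z - p) < rho & f z != 0) ->
  exists N, forall n, (N <= n)%N -> exists2 z, cmod (z - p) < d & fn n z = 0.
Proof.
move=> rho0 d0 hfn hf hlim fp [z0 z0r fz0].
have [/(_ _ z0r)/eqP|[m [q [hq qp fE]]]] := hol_order rho0 hf.
  by rewrite (negbTE fz0).
have q0 : 0 < cmod (q p) / 2 by rewrite divr_gt0// cmod_gt0.
have pp : cmod (p - p) < rho by rewrite subrr cmod0.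
have /ctP/(_ _ q0)/nearC[d1 d10 hd1] := hol_ct hq pp.
have [r [r0 rd1 rd rrho]] : exists r, [/\ 0 < r, r < d1, r < d & r < rho].
  exists (Num.min d1 (Num.min d rho) / 2).
  have m0 : 0 < Num.min d1 (Num.min d rho) by rewrite !lt_min d10 d0 rho0.
  have mm : Num.min d1 (Num.min d rho) / 2 < Num.min d1 (Num.min d rho).
    by rewrite ltr_pdivrMr// ltr_pMr// ltr1n.
  split; first by rewrite divr_gt0.
  - by rewrite (lt_le_trans mm)// ge_min lexx.
  - by rewrite (lt_le_trans mm)// !ge_min lexx orbT.
  - by rewrite (lt_le_trans mm)// !ge_min lexx !orbT.
pose mu := r ^+ m * (cmod (q p) / 2).
have mu0 : 0 < mu by rewrite mulr_gt0// exprn_gt0.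
have fmu t : mu <= cmod (f (circ p r t)).
  rewrite fE cmodM cmodX circP ?(ltW r0)// /mu ler_wpM2l ?exprn_ge0 ?(ltW r0)//.
  have := hd1 (circ p r t); rewrite circP ?(ltW r0)// => /(_ rd1).
  have := cmod_leBr (q (circ p r t)) (q p); lra.
have mu8 : 0 < mu / 8 by rewrite divr_gt0.
have [N hN] := hlim _ mu8; exists N => n Nn; have {}hN := hN n Nn.
apply: contrapT => /forall2NP H.
have fn0 z : cmod (z - p) < d -> fn n z != 0.
  by move=> zd; apply/eqP => h; case: (H z).
have [rho1 [r1 r1d r1rho]] : exists rho1, [/\ r < rho1, rho1 <= d & rho1 <= rho].
  by exists (Num.min d rho); rewrite lt_min rd rrho !ge_min !lexx orbT.
have hn : hol p rho1 (fun z => (fn n z)^-1).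
  apply: hol_inv => z zr; last by apply: fn0; rewrite (lt_le_trans zr).
  by apply: hfn; rewrite (lt_le_trans zr).
have hc t : 0 <= t <= pi *+ 2 -> cmod (fn n (circ p r t))^-1 <= (mu * (7 / 8))^-1.
  move=> _; have := fmu t; have := hN (circ p r t).
  rewrite circP ?(ltW r0)// => /(_ rrho) h1 h2.
  have h3 : mu * (7 / 8) <= cmod (fn n (circ p r t)).
    have := cmod_leBr (fn n (circ p r t)) (f (circ p r t)); lra.
  have m7 : 0 < mu * (7 / 8) by rewrite mulr_gt0// divr_gt0.
  by rewrite cmodV lef_pV2// posrE// (lt_le_trans m7).
have := @hol_le p r rho1 _ hn r1 p _ _ hc.
rewrite subrr cmod0 subr0 => /(_ r0); rewrite mulfK ?gt_eqF// cmodV.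
have := hN p pp; rewrite fp subr0 => h1.
have fp0 : 0 < cmod (fn n p) by rewrite cmod_gt0 fn0// subrr cmod0.
have m7 : 0 < mu * (7 / 8) by rewrite mulr_gt0// divr_gt0.
by rewrite lef_pV2 ?posrE//; lra.
Qed.

End Holomorphic.

(** * The Riemann sphere *)

Section Chordal.
Variable (R : realType).
Local Notation C := R[i].
Local Open Scope complex_scope.
Implicit Types (x y z : C) (a b c : sphere R).

(** The Japanese bracket; the chordal distance of finite points is [|x - y|] divided by the product
    of their brackets. *)
Definition jap x : R := Num.sqrt (1 + cmod x ^+ 2).

Lemma jap_sqr x : jap x ^+ 2 = 1 + cmod x ^+ 2.
Proof. by rewrite sqr_sqrtr// addr_ge0// sqr_ge0. Qed.

Lemma jap_gt0 x : 0 < jap x.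
Proof. by rewrite sqrtr_gt0 ltr_pwDl// sqr_ge0. Qed.

Lemma jap_ge1 x : 1 <= jap x.
Proof. by rewrite -{1}sqrtr1 ler_wsqrtr// lerDl sqr_ge0. Qed.

Lemma cmod_le_jap x : cmod x <= jap x.
Proof.
by rewrite -{1}(ger0_norm (cmod_ge0 x)) -sqrtr_sqr ler_wsqrtr// lerDr.
Qed.

Lemma jap_le x (B : R) : cmod x <= B -> jap x <= 1 + B.
Proof.
move=> h; have h0 := cmod_ge0 x; have B0 := le_trans h0 h.
rewrite -(ler_pXn2r (n := 2)) ?nnegrE ?(ltW (jap_gt0 _)) ?addr_ge0// jap_sqr.
have : cmod x ^+ 2 <= B ^+ 2 by apply: lerXn2r; rewrite ?nnegrE.
rewrite sqrrD; nra.
Qed.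

Lemma japV x : x != 0 -> jap x^-1 = jap x / cmod x.
Proof.
move=> x0; have c0 : 0 < cmod x by rewrite cmod_gt0.
have h : 0 <= jap x / cmod x by rewrite divr_ge0 ?cmod_ge0// ltW// jap_gt0.
rewrite -[RHS](ger0_norm h) -sqrtr_sqr expr_div_n jap_sqr /jap cmodV; congr Num.sqrt.
by field; rewrite gt_eqF.
Qed.

Lemma jap_triangle x y : jap x <= cmod (x - y) + jap y.
Proof.
have h := cmod_tri x y 0; rewrite !subr0 in h.
have d0 := cmod_ge0 (x - y); have y1 := jap_gt0 y.
have cy := cmod_le_jap y.
rewrite -(ler_pXn2r (n := 2)) ?nnegrE ?(ltW (jap_gt0 _)) ?addr_ge0 ?(ltW y1)//.
rewrite jap_sqr sqrrD jap_sqr.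
have : cmod x ^+ 2 <= (cmod (x - y) + cmod y) ^+ 2.
  by apply: lerXn2r; rewrite ?nnegrE ?addr_ge0 ?cmod_ge0.
have := cmod_ge0 y; rewrite sqrrD; nra.
Qed.

Lemma cauchy_schwarz x y : cmod (1 + x * y) <= jap x * jap y.
Proof.
have h0 : 0 <= jap x * jap y by rewrite mulr_ge0// ltW// jap_gt0.
rewrite (le_trans (cmodD _ _))// cmod1 cmodM.
have hx := cmod_ge0 x; have hy := cmod_ge0 y.
rewrite -(ler_pXn2r (n := 2)) ?nnegrE ?h0 ?addr_ge0 ?(mulr_ge0 hx hy)//.
rewrite exprMn !jap_sqr; have := sqr_ge0 (cmod x - cmod y); nra.
Qed.

Lemma jap_J x : jap (x^*) = jap x.
Proof. by rewrite /jap cmodJ. Qed.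

Definition sinv a : sphere R :=
  match a with None => Some 0 | Some x => if x == 0 then None else Some x^-1 end.

Lemma sinvK a : sinv (sinv a) = a.
Proof.
case: a => [x|] /=; last by rewrite eqxx.
by case: (eqVneq x 0) => [->//|x0] /=; rewrite invr_eq0 (negbTE x0) invrK.
Qed.

Lemma chordalE x y : chordal (Some x) (Some y) = cmod (x - y) / (jap x * jap y).
Proof. by []. Qed.

Lemma chordalC a b : chordal a b = chordal b a.
Proof. by case: a b => [x|] [y|] //=; rewrite cmodB [X in _ / X]mulrC. Qed.

Lemma chordal_ge0 a b : 0 <= chordal a b.
Proof.
case: a b => [x|] [y|] //=; rewrite ?invr_ge0 ?sqrtr_ge0//.
by rewrite divr_ge0 ?cmod_ge0// mulr_ge0// sqrtr_ge0.
Qed.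

Lemma chordalxx a : chordal a a = 0.
Proof. by case: a => [x|] //=; rewrite subrr cmod0 mul0r. Qed.

(** Inversion is a rotation of the sphere. This lets every local argument be made at a finite
    value. *)
Lemma chordal_sinv a b : chordal (sinv a) (sinv b) = chordal a b.
Proof.
have jap0 : jap 0 = 1 by rewrite /jap cmod0 expr0n addr0 sqrtr1.
have cx0 x : x != 0 -> cmod x != 0 by rewrite cmod_eq0.
have N x : chordal (sinv (Some x)) (Some 0) = (jap x)^-1.
  rewrite /=; case: (eqVneq x 0) => [->|x0] /=.
    by rewrite -/(jap 0) jap0.
  rewrite -/(jap _) -/(jap 0) jap0 subr0 mulr1 japV// cmodV.
  by field; rewrite cx0// gt_eqF// jap_gt0.
case: a b => [x|] [y|].
- rewrite chordalE /=; case: (eqVneq x 0) => [->|x0]; case: (eqVneq y 0) => [->|y0] //=.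
  + by rewrite subrr cmod0 mul0r.
  + rewrite -/(jap _) japV// jap0 mul1r sub0r cmodN invf_div//.
  + rewrite -/(jap _) japV// jap0 mulr1 subr0 invf_div//.
  + rewrite -!/(jap _) !japV//.
    have -> : x^-1 - y^-1 = (y - x) / (x * y) by field; rewrite x0 y0.
    rewrite cmodM cmodV cmodM cmodB; field.
    by rewrite !cx0//= !gt_eqF// jap_gt0.
- exact: N.
- by rewrite chordalC N.
- by rewrite /= subrr cmod0 mul0r.
Qed.

(** From [(x - z) (1 + |y|^2) = (x - y) (1 + conj(y) z) + (y - z) (1 + x conj(y))] and
    Cauchy-Schwarz on each term. *)
Let tri_fff x y z :
  chordal (Some x) (Some z) <= chordal (Some x) (Some y) + chordal (Some y) (Some z).
Proof.
rewrite !chordalE; have := jap_gt0 x; have := jap_gt0 y; have := jap_gt0 z.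
move=> z0 y0 x0.
have -> : cmod (x - y) / (jap x * jap y) + cmod (y - z) / (jap y * jap z) =
   (cmod (x - y) * (jap y * jap z) + cmod (y - z) * (jap x * jap y)) /
   (jap y ^+ 2) / (jap x * jap z) by field; rewrite !gt_eqF.
rewrite ler_wpM2r ?invr_ge0 ?mulr_ge0 ?(ltW x0) ?(ltW z0)//.
rewrite ler_pdivlMr ?exprn_gt0// jap_sqr.
have -> : cmod (x - z) * (1 + cmod y ^+ 2) = cmod ((x - z) * (1 + y * y^*)).
  rewrite cmodM cmod_conj -(rmorph1 (real_complex R)) -rmorphD cmodr ger0_norm//.
  by rewrite addr_ge0// sqr_ge0.
have -> : (x - z) * (1 + y * y^*) = (x - y) * (1 + y^* * z) + (y - z) * (1 + x * y^*).
  by ring.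
rewrite (le_trans (cmodD _ _))// !cmodM.
have := cauchy_schwarz (y^*) z; have := cauchy_schwarz x (y^*); rewrite jap_J => h1 h2.
by rewrite lerD// ler_wpM2l ?cmod_ge0.
Qed.

Let tri_ffi x y : chordal (Some x) None <= chordal (Some x) (Some y) + chordal (Some y) None.
Proof.
have := jap_gt0 x; have := jap_gt0 y; have := jap_triangle y x => /=.
rewrite -!/(jap _) cmodB => h y0 x0.
have -> : cmod (x - y) / (jap x * jap y) + (jap y)^-1 =
   (cmod (x - y) + jap x) / jap y / jap x by field; rewrite !gt_eqF.
by rewrite -[X in X <= _]mul1r ler_pM2r ?invr_gt0// ler_pdivlMr// mul1r.
Qed.

Let tri_fif x z : chordal (Some x) (Some z) <= chordal (Some x) None + chordal None (Some z).
Proof.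
rewrite chordalE /= -!/(jap _); have := jap_gt0 x; have := jap_gt0 z => z0 x0.
have -> : (jap x)^-1 + (jap z)^-1 = (jap x + jap z) / (jap x * jap z).
  by field; rewrite !gt_eqF.
rewrite ler_wpM2r ?invr_ge0 ?mulr_ge0 ?(ltW x0) ?(ltW z0)//.
have := cmodDB x z; have := cmod_le_jap x; have := cmod_le_jap z; lra.
Qed.

Lemma chordal_tri a b c : chordal a c <= chordal a b + chordal b c.
Proof.
case: a b c => [x|] [y|] [z|];
  [exact: tri_fff|exact: tri_ffi|exact: tri_fif| | | | |].
- by rewrite (chordalxx None) addr0.
- by rewrite !(chordalC None) addrC (chordalC (Some y)) tri_ffi.
- by rewrite chordalxx addr_ge0// chordal_ge0.
- by rewrite (chordalxx None) add0r.
- by rewrite (chordalxx None) add0r.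
Qed.

Lemma chordal_le x y : chordal (Some x) (Some y) <= cmod (x - y).
Proof.
rewrite chordalE ler_pdivrMr ?mulr_gt0 ?jap_gt0//.
by rewrite ler_peMr ?cmod_ge0// mulr_ege1 ?jap_ge1.
Qed.

Lemma chordal_away a (e : R) : 0 < e -> e <= chordal a None ->
  exists2 x, a = Some x & cmod x <= e^-1.
Proof.
case: a => [x|] e0 h; last by have := lt_le_trans e0 h; rewrite chordalxx ltxx.
exists x => //; rewrite (le_trans (cmod_le_jap x))//.
by rewrite -[leLHS]invrK lef_pV2 ?posrE ?invr_gt0 ?jap_gt0.
Qed.

(** Chordal closeness to a bounded point is Euclidean closeness: within [1 / (2 (1 + B))] of [x],
    the point [b] keeps at least that distance from infinity, so its bracket is at most
    [2 (1 + B)]. *)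
Lemma chordal_close x b (B e : R) : cmod x <= B -> chordal (Some x) b <= e ->
  e <= (2 * (1 + B))^-1 ->
  exists2 y, b = Some y & cmod (y - x) <= e * (2 * (1 + B) ^+ 2).
Proof.
move=> xB h eB; have B0 : 0 <= B := le_trans (cmod_ge0 _) xB.
have B1 : 0 < 1 + B by rewrite ltr_pwDl.
have jx := jap_le xB; have jx0 := jap_gt0 x.
have h1 : (1 + B)^-1 <= chordal (Some x) None by rewrite /= lef_pV2 ?posrE.
have h2 : (2 * (1 + B))^-1 <= chordal b None.
  have := chordal_tri (Some x) b None.
  have : (1 + B)^-1 = (2 * (1 + B))^-1 + (2 * (1 + B))^-1 by field; rewrite gt_eqF.
  lra.
case: b h h2 => [y|] h h2; last first.
  by rewrite chordalxx leNgt invr_gt0 mulr_gt0 in h2.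
exists y => //; have jy0 := jap_gt0 y.
have jy : jap y <= 2 * (1 + B) by rewrite -lef_pV2 ?posrE ?mulr_gt0.
have h' := h.
move: h; rewrite chordalE ler_pdivrMr ?mulr_gt0// cmodB => /le_trans; apply.
have e0 : 0 <= e.
  by apply: le_trans h'; exact: chordal_ge0.
rewrite ler_wpM2l//.
have -> : 2 * (1 + B) ^+ 2 = (1 + B) * (2 * (1 + B)) by ring.
by apply: ler_pM => //; exact: ltW.
Qed.

End Chordal.

(** * Local meromorphy as holomorphy of a function or of its inverse *)

Section SphereValued.
Variable (R : realType).
Local Notation C := R[i].
Local Open Scope complex_scope.
Implicit Types (p w z : C) (r rho : R) (f g : C -> sphere R) (phi : C -> C).

Definition lrep p r g phi :=
  hol p r phi /\ forall z, cmod (z - p) < r -> g z = Some (phi z).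

Definition vinv g z := sinv (g z).

Lemma vinvK g : vinv (vinv g) = g.
Proof. by apply: funext => z; exact: sinvK. Qed.

(** Symmetric under inversion and, unlike [meromorphic_at], true of the constant infinity: this is
    the notion that survives in limits. *)
Variant lmer g p : Prop :=
  | Lfin r phi of 0 < r & lrep p r g phi
  | Linf r phi of 0 < r & lrep p r (vinv g) phi.

Lemma lmer_inv g p : lmer g p -> lmer (vinv g) p.
Proof.
case=> r phi r0 h; first by apply: (@Linf _ _ r phi) => //; rewrite vinvK.
exact: (@Lfin _ _ r phi).
Qed.

Lemma lrep_sub p r p' r' g phi : cmod (p' - p) + r' <= r ->
  lrep p r g phi -> lrep p' r' g phi.
Proof.
move=> h [hphi gE]; split; first exact: hol_sub hphi.
by move=> z hz; apply: gE; have := cmod_tri z p' p; lra.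
Qed.

Lemma lmer_open g p : lmer g p ->
  exists2 r, 0 < r & forall z, cmod (z - p) < r -> lmer g z.
Proof.
case=> r phi r0 h; exists r => // z zr; have rz : 0 < r - cmod (z - p) by rewrite subr_gt0.
- by apply: (@Lfin _ _ _ phi rz); apply: lrep_sub h; rewrite addrC subrK.
- by apply: (@Linf _ _ _ phi rz); apply: lrep_sub h; rewrite addrC subrK.
Qed.

Lemma hol_affine p r phi (a b : C) : b != 0 ->
  hol (a + b * p) r phi -> hol p (r / cmod b) (fun z => phi (a + b * z)).
Proof.
move=> b0 hphi z zs.
have dz : dv id (fun z => a + b * z) z (0 + b * 1).
  by apply: dvD; [exact: dv_cst|apply: dvZ; [exact: ct_id|exact: dv_id]].
apply: dv_derivable (dv_comp (@ct_id R _) dz (hol_dv hphi _)).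
rewrite (_ : _ - _ = b * (z - p)); last by ring.
by move: zs; rewrite cmodM (mulrC (cmod b)) ltr_pdivlMr// cmod_gt0.
Qed.

Lemma lmer_affine g (a b : C) p : b != 0 -> lmer g (a + b * p) ->
  lmer (fun z => g (a + b * z)) p.
Proof.
move=> b0; have cb : 0 < cmod b by rewrite cmod_gt0.
have E z r : cmod (z - p) < r / cmod b -> cmod (a + b * z - (a + b * p)) < r.
  rewrite ltr_pdivlMr// => h.
  by rewrite (_ : _ - _ = b * (z - p)); [rewrite cmodM mulrC|ring].
case=> r phi r0 [h hE].
- apply: (@Lfin _ _ (r / cmod b) (fun z => phi (a + b * z))); first by rewrite divr_gt0.
  by split; [exact: hol_affine|move=> z /E/hE].
- apply: (@Linf _ _ (r / cmod b) (fun z => phi (a + b * z))); first by rewrite divr_gt0.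
  by split; [exact: hol_affine|move=> z /E/hE].
Qed.

Lemma lmer_cont g p e : lmer g p -> 0 < e ->
  exists2 d, 0 < d & forall z, cmod (z - p) < d -> chordal (g z) (g p) < e.
Proof.
move=> gp e0; wlog: g gp / exists r phi, 0 < r /\ lrep p r g phi => [H|].
  case: (gp) => r phi r0 h; first by apply: H => //; exists r, phi.
  have [|d d0 hd] := H (vinv g) (lmer_inv gp); first by exists r, phi.
  by exists d => // z /hd; rewrite chordal_sinv.
move=> [r [phi [r0 [hphi gE]]]].
have pr : cmod (p - p) < r by rewrite subrr cmod0.
have /ctP/(_ _ e0)/nearC[d d0 hd] := hol_ct hphi pr.
exists (Num.min d r); first by rewrite lt_min d0 r0.
move=> z; rewrite lt_min => /andP[zd zr]; rewrite !gE//.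
by rewrite (le_lt_trans (chordal_le _ _))// hd.
Qed.

Lemma lrep_finpart p r g phi : lrep p r g phi -> lrep p r g (finpart g).
Proof.
move=> [hphi gE]; split; last by move=> z zr; rewrite /finpart gE.
move=> z zr; apply: dv_derivable; apply: dv_near (hol_dv hphi zr).
by apply: filterS (near_disc zr) => w wr; rewrite /finpart gE.
Qed.

Lemma lmer_finite g p : lmer g p -> g p <> None ->
  exists2 r, 0 < r & lrep p r g (finpart g).
Proof.
case=> r phi r0 h; first by exists r => //; exact: lrep_finpart h.
move=> gp; have [hphi gE] := h.
have pr : cmod (p - p) < r by rewrite subrr cmod0.
have phi0 : phi p != 0.
  apply/eqP => phi0; apply: gp; have := gE p pr; rewrite phi0 => gp.
  by rewrite -(sinvK (g p)) -/(vinv g p) gp /= eqxx.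
have c0 : 0 < cmod (phi p) by rewrite cmod_gt0.
have /ctP/(_ _ c0)/nearC[d d0 hd] := hol_ct hphi pr.
have n0 z : cmod (z - p) < Num.min d r -> phi z != 0.
  rewrite lt_min => /andP[/hd h1 _]; rewrite -cmod_gt0.
  by have := cmod_leBr (phi z) (phi p); lra.
exists (Num.min d r); first by rewrite lt_min d0 r0.
apply: (@lrep_finpart _ _ _ (fun z => (phi z)^-1)); split.
  by apply: hol_inv n0; apply: hol_sub hphi; rewrite subrr cmod0 add0r ge_min lexx orbT.
move=> z zr; have := n0 z zr; move: zr; rewrite lt_min => /andP[_ /gE gz] pz.
by rewrite -(sinvK (g z)) -/(vinv g z) gz /= (negbTE pz).
Qed.

Lemma lrep_disc p r g : (forall z, cmod (z - p) < r -> lmer g z /\ g z <> None) ->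
  lrep p r g (finpart g).
Proof.
move=> h; split=> z /h[gz gn]; have [d d0 [hd gE]] := lmer_finite gz gn.
  by apply: hd; rewrite subrr cmod0.
by apply: gE; rewrite subrr cmod0.
Qed.

(** At a pole [1 / f] is bounded by 1 nearby, so it extends holomorphically; the extension is 0 at
    [p] because [|f|] tends to infinity, which matches the inverse of the value [None]. *)
Lemma meromorphic_lmer f p : meromorphic_at f p -> lmer f p.
Proof.
have S z : isSome (f z) -> f z = Some (finpart f z) by rewrite /finpart; case: (f z).
case=> [/nearC[e e0 he]|[fp /nearC'[e e0 he] fy]].
  apply: (@Lfin _ _ e (finpart f)) => //.
  by split=> z /he[] // /S.
have /nearC'[d d0 hd] : \forall w \near p^', 1 < cmod (finpart f w).
  by move/cvgryPgt : fy; apply.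
pose r := Num.min e d; have r0 : 0 < r by rewrite lt_min e0 d0.
have hr z : 0 < cmod (z - p) < r -> [/\ f z = Some (finpart f z),
    derivable (finpart f) z 1 & 1 < cmod (finpart f z)].
  rewrite lt_min => /and3P[z0 ze zd].
  have [|h1 h2] := he z; first by rewrite z0 ze.
  by split; [exact: S|exact: h2|apply: hd; rewrite z0 zd].
have n0 z : 0 < cmod (z - p) < r -> finpart f z != 0.
  by move=> /hr[_ _ h]; rewrite -cmod_gt0 (lt_trans _ h).
have [||g hg gE] := @removable _ p r (fun z => (finpart f z)^-1) 1 r0.
- move=> z zr; have [_ /derivable_dv h _] := hr z zr.
  exact: dv_derivable (dvV (@ct_id R _) (n0 _ zr) h).
- move=> z zr; have [_ _ h] := hr z zr.
  by rewrite cmodV invf_le1 ?(lt_trans _ h)// ltW.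
have gp : g p = 0.
  apply: cmod_lim0 => a a0.
  have pr : cmod (p - p) < r by rewrite subrr cmod0.
  have a20 : 0 < a / 2 by rewrite divr_gt0.
  have /ctP/(_ _ a20)/nearC[d1 d10 hd1] := hol_ct hg pr.
  have /nearC'[d2 d20 hd2] : \forall w \near p^', (a / 2)^-1 < cmod (finpart f w).
    by move/cvgryPgt : fy; apply.
  have [m [m0 m1 m2 m3]] : exists m, [/\ 0 < m, m < r, m < d1 & m < d2].
    exists (Num.min r (Num.min d1 d2) / 2).
    have M0 : 0 < Num.min r (Num.min d1 d2) by rewrite lt_min r0 lt_min d10 d20.
    have mm : Num.min r (Num.min d1 d2) / 2 < Num.min r (Num.min d1 d2).
      by rewrite ltr_pdivrMr// ltr_pMr// ltr1n.
    split; first by rewrite divr_gt0.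
    - by rewrite (lt_le_trans mm)// ge_min lexx.
    - by rewrite (lt_le_trans mm)// !ge_min lexx orbT.
    - by rewrite (lt_le_trans mm)// !ge_min lexx !orbT.
  pose z := p + m%:C; have zp : cmod (z - p) = m.
    by rewrite /z addrC addKr cmodr ger0_norm// ltW.
  have h1 := hd1 z; rewrite zp in h1; have {}h1 := h1 m2.
  have h2 := hd2 z; rewrite zp m0 m3 in h2; have {}h2 := h2 isT.
  have h3 := gE z; rewrite zp m0 m1 in h3; have {}h3 := h3 isT.
  have : cmod (g z) < a / 2.
    rewrite h3 cmodV -[ltRHS]invrK ltf_pV2// posrE ?invr_gt0//.
    by rewrite (lt_trans _ h2)// invr_gt0.
  have := cmod_leBr (g z) (g p); lra.
apply: (@Linf _ _ r g r0); split => // z zr; rewrite /vinv.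
have [->|zp] := eqVneq z p; first by rewrite fp gp.
have zpr : 0 < cmod (z - p) < r by rewrite zr cmod_gt0 subr_eq0 zp.
have [-> _ _] := hr z zpr; rewrite /= (negbTE (n0 _ zpr)); congr Some.
by rewrite gE.
Qed.

Lemma lmer_isolated g p c : lmer g p ->
  (exists2 r, 0 < r & forall z, cmod (z - p) < r -> g z = c) \/
  (exists2 r, 0 < r & forall z, 0 < cmod (z - p) < r -> g z <> c).
Proof.
move=> gp; wlog: g c gp / exists r phi, 0 < r /\ lrep p r g phi => [H|].
  case: (gp) => r phi r0 h; first by apply: H => //; exists r, phi.
  have [|[d d0 hd]|[d d0 hd]] := H (vinv g) (sinv c) (lmer_inv gp).
  - by exists r, phi.
  - by left; exists d => // z /hd /(congr1 (@sinv R)); rewrite !sinvK.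
  - by right; exists d => // z /hd h1 gz; apply: h1; rewrite /vinv gz.
move=> [r [phi [r0 [hphi gE]]]].
case: c => [c|]; last first.
  by right; exists r => // z /andP[_ /gE ->].
have hc : hol p r (fun z => phi z - c).
  move=> z zr; apply: dv_derivable (dvB (hol_dv hphi zr) (dv_cst _ _ _)).
have [h|[d /andP[d0 dr] hd]] := hol_isolated r0 hc.
  left; exists r => // z zr; rewrite gE//; congr Some.
  by apply/eqP; rewrite -subr_eq0 h.
right; exists d => // z /andP[z0 zd]; rewrite gE ?(lt_le_trans zd)// => -[] zc.
by have := hd z; rewrite z0 zd zc subrr eqxx => /(_ isT).
Qed.

(** The points near which [g] is constantly [c] form a relatively clopen set: at all other points
    the value [c] is avoided on a punctured disc, and both conditions are open. *)
Lemma lmer_identity (D : set C) g c : open D -> connected D ->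
  (forall z, D z -> lmer g z) -> (forall z, D z -> g z = c) \/
  (forall p, D p -> exists2 r, 0 < r & forall z, 0 < cmod (z - p) < r -> g z <> c).
Proof.
move=> oD cD gD.
pose A := [set p | D p /\ exists2 r, 0 < r & forall z, cmod (z - p) < r -> g z = c].
have [[p0 Ap0]|nA] := pselect (exists p, A p); last first.
  right => p Dp; have [h|//] := lmer_isolated c (gD _ Dp).
  by exfalso; apply: nA; exists p; split.
left; suff AD : A = D by move=> z; rewrite -AD => -[_ [r r0]]; apply; rewrite subrr cmod0.
apply: cD; first by exists p0.
  exists A; last by rewrite eqEsubset; split=> z // [].
  rewrite openE => p [Dp [r r0 hr]]; apply/nearC.
  have /nearC[d d0 hd] : nbhs p D by apply: open_nbhs_nbhs.
  exists (Num.min d r); first by rewrite lt_min d0 r0.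
  move=> w; rewrite lt_min => /andP[wd wr]; split; first exact: hd.
  exists (r - cmod (w - p)); first by rewrite subr_gt0.
  by move=> z zw; apply: hr; have := cmod_tri z w p; lra.
exists (~` [set p | D p /\ exists2 r, 0 < r & forall z, 0 < cmod (z - p) < r -> g z <> c]).
  apply: open_closedC; rewrite openE => p [Dp [r r0 hr]]; apply/nearC.
  have /nearC[d d0 hd] : nbhs p D by apply: open_nbhs_nbhs.
  exists (Num.min d r); first by rewrite lt_min d0 r0.
  move=> w; rewrite lt_min => /andP[wd wr]; split; first exact: hd.
  have [->|wp] := eqVneq w p; first by exists r.
  have w0 : 0 < cmod (w - p) by rewrite cmod_gt0 subr_eq0.
  exists (Num.min (cmod (w - p)) (r - cmod (w - p))); first by rewrite lt_min w0 subr_gt0.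
  move=> z /andP[z0]; rewrite lt_min => /andP[z1 z2]; apply: hr.
  have := cmod_tri z w p; have := cmod_tri w z p; rewrite (cmodB w z) => h1 h2.
  by apply/andP; split; lra.
rewrite eqEsubset; split=> p.
  move=> [Dp [r r0 hr]]; split => // -[_ [d d0 hd]].
  have m0 : 0 < Num.min r d by rewrite lt_min r0 d0.
  have mm : Num.min r d / 2 < Num.min r d by rewrite ltr_pdivrMr// ltr_pMr// ltr1n.
  have zp : cmod (p + (Num.min r d / 2)%:C - p) = Num.min r d / 2.
    by rewrite addrC addKr cmodr ger0_norm// divr_ge0// ltW.
  apply: (hd (p + (Num.min r d / 2)%:C)).
    by rewrite zp divr_gt0//= (lt_le_trans mm)// ge_min lexx orbT.
  by apply: hr; rewrite zp (lt_le_trans mm)// ge_min lexx.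
move=> [Dp h]; split => //; have [//|h1] := lmer_isolated c (gD _ Dp).
by exfalso; apply: h; split.
Qed.

Lemma lmer_meromorphic g p : lmer g p ->
  (exists2 r, 0 < r & forall z, 0 < cmod (z - p) < r -> g z <> None) ->
  meromorphic_at g p.
Proof.
move=> gp [d d0 hd].
have finS z : lmer g z -> g z <> None -> finite_holo_at g z.
  move=> h1 h2; have [r r0 [h gE]] := lmer_finite h1 h2.
  have zz : cmod (z - z) < r by rewrite subrr cmod0.
  by split; [rewrite gE|exact: h].
have [r r0 hr] := lmer_open gp.
have m0 : 0 < Num.min d r by rewrite lt_min d0 r0.
case Egp : (g p) => [a|].
  left; apply/nearC; exists (Num.min d r) => // w; rewrite lt_min => /andP[wd wr].
  apply: finS; first exact: hr.
  have [->|wp] := eqVneq w p; first by rewrite Egp.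
  by apply: hd; rewrite wd cmod_gt0 subr_eq0 wp.
right; split => //.
  apply/nearC'; exists (Num.min d r) => // w; rewrite lt_min => /and3P[w0 wd wr].
  by apply: finS; [exact: hr|apply: hd; rewrite w0 wd].
apply/cvgryPgt => A; apply/nearC'.
have A1 : 0 < (`|A| + 1)^-1 by rewrite invr_gt0 ltr_wpDl.
have [d1 d10 hd1] := lmer_cont gp A1.
exists (Num.min d d1); first by rewrite lt_min d0 d10.
move=> w; rewrite lt_min => /and3P[w0 wd wd1].
have gw : g w <> None by apply: hd; rewrite w0 wd.
have := hd1 _ wd1; rewrite Egp /finpart; case: (g w) gw => // x _.
rewrite /= -/(jap x) ltf_pV2 ?posrE ?jap_gt0 ?ltr_wpDl// => h.
have : jap x <= 1 + cmod x by apply: jap_le.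
by have := ler_norm A; lra.
Qed.

End SphereValued.

(** * Normality *)

Section Normality.
Variable (R : realType).
Local Notation C := R[i].
Local Notation rc := (@real_complex_def R (Phant R)).
Local Open Scope complex_scope.
Implicit Types (p w z : C) (r : R).

Lemma compact_uniform (K : set C) (P : nat -> C -> Prop) : compact K ->
  (forall p, K p -> exists2 d : R, 0 < d & exists N, forall n, (N <= n)%N ->
     forall z, cmod (z - p) < d -> P n z) ->
  exists N, forall n, (N <= n)%N -> forall z, K z -> P n z.
Proof.
move=> /compact_near_coveringP cK h.
have [|N _ hN] := cK nat \oo P _; last by exists N => n /hN; exact.
move=> p Kp; have [d d0 [N hN]] := h p Kp.
exists ([set z | cmod (z - p) < d], [set n | (N <= n)%N]) => /=.
  by split; [apply/nearC; exists d|exists N].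
by move=> [z n] /= [zd Nn]; exact: hN.
Qed.

(** Otherwise every point of the disc has a neighbourhood that the selected terms eventually avoid,
    and compactness makes them avoid the whole disc. *)
Lemma disc_cluster (P : nat -> Prop) (y : nat -> C) (B : R) :
  (forall N, exists2 n, (N <= n)%N & P n) -> (forall n, P n -> cmod (y n) <= B) ->
  exists a, forall e, 0 < e -> forall N, exists2 n, (N <= n)%N & P n /\ cmod (y n - a) < e.
Proof.
move=> fP yB; apply: contrapT => /forallNP H.
have [||N hN] := @compact_uniform [set z | cmod (z - 0) <= B] (fun n z => ~ (P n /\ y n = z)).
- exact: compact_disc.
- move=> p _; have /existsNP[e /not_implyP[e0 /existsNP[N hN]]] := H p.
  exists e => //; exists N => n Nn z zp [Pn yz]; apply: hN; exists n => //.
  by split => //; rewrite yz.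
have [n Nn Pn] := fP N.
by apply: (hN n Nn (y n)) => //=; rewrite subr0 yB.
Qed.

Definition ccvg (x : nat -> sphere R) a := forall e : R, 0 < e ->
  exists N, forall n, (N <= n)%N -> chordal (x n) a < e.

(** Either infinitely many terms lie in the unit disc, or the inverses of all but finitely many
    do. *)
Lemma sphere_cluster (x : nat -> sphere R) : exists a, forall e : R, 0 < e ->
  forall N, exists2 n, (N <= n)%N & chordal (x n) a < e.
Proof.
pose P n := exists2 z, x n = Some z & cmod z <= 1.
have [fP|nP] := pselect (forall N, exists2 n, (N <= n)%N & P n).
  have [|a ha] := @disc_cluster P (fun n => odflt 0 (x n)) 1 fP.
    by move=> n [z -> hz].
  exists (Some a) => e e0 N; have [n Nn [[z xz _] hz]] := ha e e0 N.
  by exists n => //; rewrite xz in hz *; rewrite (le_lt_trans (chordal_le _ _)).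
have /existsNP[N0 hN0] := nP.
have hx n : (N0 <= n)%N -> exists2 z, sinv (x n) = Some z & cmod z <= 1.
  move=> Nn; case E : (x n) => [z|]; last by exists 0; rewrite ?cmod0.
  have z1 : 1 < cmod z.
    by rewrite ltNge; apply/negP => z1; apply: hN0; exists n => //; exists z.
  have z0 : 0 < cmod z by rewrite (lt_trans _ z1).
  have zn : z != 0 by rewrite -cmod_gt0.
  exists z^-1; first by rewrite /= (negbTE zn).
  by rewrite cmodV invf_le1// ltW.
have [||a ha] := @disc_cluster (fun n => (N0 <= n)%N) (fun n => odflt 0 (sinv (x n))) 1.
- by move=> N; exists (maxn N N0); rewrite ?leq_maxl ?leq_maxr.
- by move=> n /hx[z -> hz].
exists (sinv (Some a)) => e e0 N; have [n Nn [/hx[z xz _] hz]] := ha e e0 N.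
exists n => //; rewrite -(sinvK (x n)) chordal_sinv xz.
by rewrite xz in hz; rewrite (le_lt_trans (chordal_le _ _)).
Qed.

Definition incr (s : nat -> nat) := {homo s : m n / (m < n)%N}.

Lemma incr_ge s n : incr s -> (n <= s n)%N.
Proof. by move=> hs; elim: n => // n ih; rewrite (leq_ltn_trans ih)// hs. Qed.

Lemma incr_comp s t : incr s -> incr t -> incr (s \o t).
Proof. by move=> hs ht m n mn; apply/hs/ht. Qed.

Lemma extraction (Q : nat -> nat -> Prop) :
  (forall k N, exists2 n, (N <= n)%N & Q k n) ->
  exists2 s, incr s & forall k, Q k (s k).
Proof.
move=> h.
have {}h k N : {n | (N <= n)%N & Q k n} by apply: cid2.
pose s := fix s k := if k is m.+1 then s2val (h k (s m).+1) else s2val (h 0%N 0%N).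
exists s; last by case=> [|k]; [exact: (s2valP' (h 0%N 0%N))|exact: (s2valP' (h _ _))].
apply: homo_ltn; first exact: ltn_trans.
by move=> k; exact: (s2valP (h _ (s k).+1)).
Qed.

(** The second hypothesis is stability under tails: the late terms of [s'] are picked from [s] at
    indices at least as large. The diagonal [S n n] is related in this way to each [S k.+1]. *)
Lemma diagonal (Q : nat -> (nat -> nat) -> Prop) :
  (forall k s, incr s -> exists2 t, incr t & Q k (s \o t)) ->
  (forall k s s', Q k s ->
     (exists N, forall n, (N <= n)%N -> exists2 m, (n <= m)%N & s' n = s m) -> Q k s') ->
  exists2 s, incr s & forall k, Q k s.
Proof.
move=> hQ hstab.
pose T k s : nat -> nat := xget (id : nat -> nat) [set t | incr t /\ Q k (s \o t)].
have TP k s : incr s -> incr (T k s) /\ Q k (s \o T k s).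
  move=> hs; rewrite /T; case: xgetP => [t _ //|].
  by have [t t1 t2] := hQ k s hs => /(_ t) []; split.
pose S := fix S k := if k is m.+1 then S m \o T m (S m) else id.
have Sincr k : incr (S k).
  by elim: k => [//|k ih] /=; apply: incr_comp => //; have [] := TP k _ ih.
have SQ k : Q k (S k.+1) by have [] := TP k _ (Sincr k).
exists (fun n => S n n).
  apply: homo_ltn; first exact: ltn_trans.
  move=> n /=; apply: (Sincr n); apply: leq_trans (_ : n.+1 <= _)%N => //.
  by apply: incr_ge; have [] := TP n _ (Sincr n).
move=> k; apply: hstab (SQ k) _; exists k.+1 => n kn.
have H m : (k.+1 <= m)%N -> exists2 t, incr t & S m = S k.+1 \o t.
  move=> /subnK <-; elim: (m - k.+1)%N => [|j [t t1 t2]]; first by exists id.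
  rewrite addSn; exists (t \o T (j + k.+1)%N (S (j + k.+1)%N)).
    by apply: incr_comp => //; have [] := TP (j + k.+1)%N _ (Sincr (j + k.+1)%N).
  by rewrite [LHS]/= t2 compA.
have [t t1 t2] := H n kn; exists (t n); first exact: incr_ge.
by rewrite t2.
Qed.

Lemma dense_seq : exists d : nat -> C, forall z (e : R), 0 < e ->
  exists k, cmod (d k - z) < e.
Proof.
exists (fun k => if unpickle k is Some (a, b) then (ratr a)%:C + 'i * (ratr b)%:C else 0).
move=> z e e0; have e2 : 0 < e / 2 by rewrite divr_gt0.
have H (x : R) : exists a : rat, `|ratr a - x| < e / 2.
  have /rat_in_itvoo[a] : x - e / 2 < x + e / 2 by lra.
  by rewrite in_itv /= => /andP[h1 h2]; exists a; rewrite ltr_distl h1 h2.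
have [a ha] := H (complex.Re z); have [b hb] := H (complex.Im z).
exists (pickle (a, b)); rewrite pickleK.
rewrite {1}(complexE z).
have -> : (ratr a)%:C + 'i%C * (ratr b)%:C - ((complex.Re z)%:C + 'i%C * (complex.Im z)%:C)
   = (ratr a - complex.Re z)%:C + 'i%C * (ratr b - complex.Im z)%:C :> C.
  by rewrite !rmorphB /=; ring.
by rewrite (le_lt_trans (cmodD _ _))// cmodM cmod_i mul1r !cmodr; lra.
Qed.

Lemma hol_lip p r phi (M : R) z w : hol p r phi ->
  (forall z, cmod (z - p) < r -> cmod (derive1 phi z) <= M) ->
  cmod (z - p) < r -> cmod (w - p) < r -> cmod (phi w - phi z) <= M * cmod (w - z).
Proof.
move=> hphi hM zr wr.
pose g (x : R) := z + x%:C * (w - z).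
have dg x : dv rc g x (w - z).
  rewrite -[X in dv _ _ _ X]add0r; apply: dvD; first exact: dv_cst.
  have := dvM (@ct_real R x) (dv_id rc x) (dv_cst rc x (w - z)).
  by rewrite mul1r mulr0 addr0.
have gr x : 0 <= x <= 1 -> cmod (g x - p) < r.
  case/andP => x0 x1.
  have -> : g x - p = (1 - x)%:C * (z - p) + x%:C * (w - p).
    by rewrite /g rmorphB rmorph1; ring.
  rewrite (le_lt_trans (cmodD _ _))// !cmodM !cmodr !ger0_norm ?subr_ge0//.
  have [->|x10] := eqVneq x 1; first by rewrite subrr mul0r add0r mul1r.
  have x1' : 0 < 1 - x by rewrite subr_gt0 lt_neqAle x10.
  have h1 : (1 - x) * cmod (z - p) < (1 - x) * r by rewrite ltr_pM2l.
  have h2 : x * cmod (w - p) <= x * r by rewrite ler_wpM2l// ltW.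
  lra.
have -> : phi w = phi (g 1) by rewrite /g rmorph1 mul1r addrC subrK.
have -> : phi z = phi (g 0) by rewrite /g rmorph0 mul0r addr0.
rewrite -[leRHS]mulr1 -[X in _ * X](subr0 (1 : R)).
apply: (@mvt_le R (fun x => phi (g x)) (fun x => derive1 phi (g x) * (w - z))).
- exact: ler01.
- move=> x hx; apply: dv_comp; [exact: ct_real|exact: dg|].
  exact: hol_dv hphi (gr _ hx).
- by move=> x hx; rewrite cmodM ler_wpM2r ?cmod_ge0// hM// gr.
Qed.

(** 0 and infinity are at distance 1, so no point is closer than 1/2 to both. *)
Lemma chordal_half (a : sphere R) :
  2^-1 <= chordal a None \/ 2^-1 <= chordal (sinv a) None.
Proof.
have [h|h] := leP (2^-1) (chordal a None); [by left|right].
have -> : None = sinv (Some (0 : C)) by rewrite /= eqxx.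
rewrite chordal_sinv; have := chordal_tri (Some (0 : C)) a None.
have -> : chordal (Some (0 : C)) None = 1.
  by rewrite /= cmod0 expr0n addr0 sqrtr1 invr1.
by rewrite (chordalC (Some 0)); lra.
Qed.

Lemma chordal_half_near (a b : sphere R) : 2^-1 <= chordal a None ->
  chordal a b <= 10^-1 -> exists2 x, b = Some x & cmod x <= 5 / 2.
Proof.
move=> ha hab; have h : (5 / 2)^-1 <= chordal b None.
  by have := chordal_tri a b None; rewrite invf_div; lra.
have e0 : 0 < (5 / 2)^-1 :> R by rewrite invr_gt0 divr_gt0.
by have [x bx] := chordal_away e0 h; rewrite invrK; exists x.
Qed.

(** After an inversion [g] is bounded by 5/2 on the disc, since 1/2 - 1/10 = 2/5, and Cauchy's
    estimate on discs of radius [r / 2] bounds the derivative by [2 (5/2) / (r/2) = 10 / r]. *)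
Lemma small_osc_lip p r (g : C -> sphere R) : 0 < r ->
  (forall z, cmod (z - p) < r -> lmer g z) ->
  (forall z w, cmod (z - p) < r -> cmod (w - p) < r -> chordal (g z) (g w) <= 10^-1) ->
  forall z w, cmod (z - p) < r / 2 -> cmod (w - p) < r / 2 ->
  chordal (g z) (g w) <= 10 / r * cmod (z - w).
Proof.
move=> r0 gm go.
have r2 : 0 < r / 2 by rewrite divr_gt0.
have pr : cmod (p - p) < r by rewrite subrr cmod0.
wlog: g gm go / 2^-1 <= chordal (g p) None => [H|gp].
  have [h|h] := chordal_half (g p); first exact: H.
  have E z w : chordal (g z) (g w) = chordal (vinv g z) (vinv g w).
    by rewrite chordal_sinv.
  move=> z w zr wr; rewrite E; apply: H zr wr => //.
  - by move=> *; apply: lmer_inv; exact: gm.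
  - by move=> *; rewrite -E; exact: go.
have gz z : cmod (z - p) < r -> exists2 x, g z = Some x & cmod x <= 5 / 2.
  by move=> zr; apply: (chordal_half_near gp); exact: go.
have [hphi gE] : lrep p r g (finpart g).
  by apply: lrep_disc => z zr; split; [exact: gm|have [x ->] := gz z zr].
have phiM z : cmod (z - p) < r -> cmod (finpart g z) <= 5 / 2.
  by move=> zr; have [x gx] := gz z zr; rewrite /finpart gx.
move=> z w zr wr; rewrite !gE; last 2 first.
- by rewrite (lt_trans wr)// ltr_pdivrMr// ltr_pMr// ltr1n.
- by rewrite (lt_trans zr)// ltr_pdivrMr// ltr_pMr// ltr1n.
rewrite (le_trans (chordal_le _ _))//.
apply: (@hol_lip p (r / 2) _ _ w z) => //.
  by apply: hol_sub hphi; rewrite subrr cmod0 add0r ler_pdivrMr// ler_pMr// ler1n.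
move=> x xr; rewrite (le_trans (@hol_derive1_center _ x (r / 2) _ (5 / 2) r2 _ _))//.
- by apply: hol_sub hphi; lra.
- by move=> y yx; apply: phiM; have := cmod_tri y x p; lra.
- by rewrite le_eqVlt; apply/orP; left; apply/eqP; field; rewrite gt_eqF.
Qed.

Lemma chordal_cvg_finpart (S : set C) (u : nat -> C -> sphere R) (g : C -> sphere R)
    (phi : C -> C) (B : R) :
  (forall z, S z -> g z = Some (phi z)) -> (forall z, S z -> cmod (phi z) <= B) -> 0 <= B ->
  (forall e : R, 0 < e -> exists N, forall n, (N <= n)%N -> forall z, S z ->
     chordal (u n z) (g z) <= e) ->
  forall e : R, 0 < e -> exists N, forall n, (N <= n)%N -> forall z, S z ->
     u n z = Some (finpart (u n) z) /\ cmod (finpart (u n) z - phi z) <= e.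
Proof.
move=> gE phiB B0 hu e e0.
have B1 : 0 < 2 * (1 + B) by rewrite mulr_gt0// ltr_pwDl.
have B2 : 0 < 2 * (1 + B) ^+ 2 by rewrite mulr_gt0// exprn_gt0// ltr_pwDl.
pose d := Num.min (2 * (1 + B))^-1 (e / (2 * (1 + B) ^+ 2)).
have d0 : 0 < d by rewrite lt_min invr_gt0 B1 divr_gt0.
have [N hN] := hu d d0; exists N => n Nn z Sz; have := hN n Nn z Sz.
rewrite gE// chordalC => h.
have [|y uy hy] := chordal_close (phiB z Sz) h; first by rewrite ge_min lexx.
rewrite /finpart uy; split => //=; rewrite (le_trans hy)//.
by rewrite -ler_pdivlMr// ge_min lexx orbT.
Qed.

(** Stands in for a local bound on spherical derivatives and yields equicontinuity. It constrains
    late terms only, as rescaled functions live on growing discs. *)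
Definition tame (D : set C) (u : nat -> C -> sphere R) :=
  forall p, D p -> exists r, [/\ 0 < r, forall z, cmod (z - p) < r -> D z &
    exists N, forall n, (N <= n)%N -> (forall z, cmod (z - p) < r -> lmer (u n) z) /\
      forall z w, cmod (z - p) < r -> cmod (w - p) < r -> chordal (u n z) (u n w) <= 10^-1].

Definition lu_cvg (D : set C) (u : nat -> C -> sphere R) (g : C -> sphere R) :=
  forall p, D p -> forall e : R, 0 < e -> exists2 d : R, 0 < d &
    exists N, forall n, (N <= n)%N -> forall z, cmod (z - p) < d -> chordal (u n z) (g z) < e.

(** The limit inherits the oscillation bound, so after an inversion it is bounded near [p]; chordal
    convergence is then uniform convergence of finite parts, and Weierstrass applies. *)
Lemma tame_lim_lmer (D : set C) u g : tame D u -> lu_cvg D u g ->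
  forall p, D p -> lmer g p.
Proof.
move=> tu ug p Dp; have [r [r0 rD [N hN]]] := tu p Dp.
have pr : cmod (p - p) < r by rewrite subrr cmod0.
have cvz z : cmod (z - p) < r -> ccvg (u ^~ z) (g z).
  move=> zr e e0; have [d d0 [M hM]] := ug z (rD z zr) e e0.
  by exists M => n Mn; apply: hM => //; rewrite subrr cmod0.
have osc z : cmod (z - p) < r -> chordal (g p) (g z) <= 10^-1.
  move=> zr; apply/ler_addgt0Pr => e e0; have e2 : 0 < e / 2 by rewrite divr_gt0.
  have [N1 h1] := cvz z zr _ e2; have [N2 h2] := cvz p pr _ e2.
  pose n := maxn N (maxn N1 N2).
  have a1 := h1 n; have a2 := h2 n; have [_ a3] := hN n (leq_maxl _ _).
  rewrite /n !leq_max leqnn !orbT in a1; rewrite /n !leq_max leqnn !orbT in a2.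
  have {}a1 := a1 isT; have {}a2 := a2 isT; have {}a3 := a3 p z pr zr.
  have b1 := chordal_tri (g p) (u n p) (g z); have b2 := chordal_tri (u n p) (u n z) (g z).
  rewrite (chordalC (g p) (u n p)) in b1; rewrite -/n in a1 a2.
  by clear -a1 a2 a3 b1 b2; lra.
wlog: u g tu ug hN cvz osc / 2^-1 <= chordal (g p) None => [H|gp].
  have [h|h] := chordal_half (g p); first exact: (H u g).
  rewrite -(vinvK g); apply: lmer_inv; apply: (H (fun n => vinv (u n)) (vinv g)).
  - move=> q Dq; have [s [s0 sD [M hM]]] := tu q Dq; exists s; split => //.
    exists M => n Mn; have [h1 h2] := hM n Mn; split=> [z zs|z w zs ws].
      by apply: lmer_inv; exact: h1.
    by rewrite chordal_sinv; exact: h2.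
  - move=> q Dq e e0; have [d d0 [M hM]] := ug q Dq e e0; exists d => //.
    by exists M => n Mn z zd; rewrite chordal_sinv; exact: hM.
  - move=> n Nn; have [h1 h2] := hN n Nn; split=> [z zs|z w zs ws].
      by apply: lmer_inv; exact: h1.
    by rewrite chordal_sinv; exact: h2.
  - move=> z zr e e0; have [M hM] := cvz z zr e e0.
    by exists M => n Mn; rewrite chordal_sinv; exact: hM.
  - by move=> z zr; rewrite chordal_sinv; exact: osc.
  - exact: h.
have gz z : cmod (z - p) < r -> exists2 x, g z = Some x & cmod x <= 5 / 2.
  by move=> zr; apply: (chordal_half_near gp); exact: osc.
have r2 : 0 < r / 2 by rewrite divr_gt0.
have r2r : r / 2 < r by rewrite ltr_pdivrMr// ltr_pMr// ltr1n.
pose K := [set z | cmod (z - p) <= r / 2].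
have KD z : K z -> cmod (z - p) < r by move=> /le_lt_trans; apply.
have unif (e : R) : 0 < e -> exists M, forall n, (M <= n)%N -> forall z, K z ->
    chordal (u n z) (g z) <= e.
  move=> e0; apply: compact_uniform; first exact: compact_disc.
  move=> q Kq; have [d d0 [M hM]] := ug q (rD q (KD q Kq)) e e0.
  by exists d => //; exists M => n Mn z zd; apply/ltW/hM.
have B0 : 0 <= 5 / 2 :> R by rewrite divr_ge0.
have gK z : K z -> g z = Some (finpart g z).
  by move=> /KD/gz[x gx _]; rewrite /finpart gx.
have gB z : K z -> cmod (finpart g z) <= 5 / 2.
  by move=> /KD/gz[x gx xB]; rewrite /finpart gx.
have fc := chordal_cvg_finpart gK gB B0 unif.
have [N1 hN1] := fc 1 ltr01.
apply: (@Lfin _ _ _ (r / 2) (finpart g) r2); split; last by move=> z /ltW/gK.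
(* The shift puts every term beyond both thresholds, so that all are holomorphic on the disc. *)
pose m n := (n + maxn N N1)%N.
apply: (@weierstrass _ p (r / 2) (fun n => finpart (u (m n)))).
  move=> n; have [] : lrep p (r / 2) (u (m n)) (finpart (u (m n))) => //.
  have mN : (N <= m n)%N by rewrite /m (leq_trans (leq_maxl N N1))// leq_addl.
  have mN1 : (N1 <= m n)%N by rewrite /m (leq_trans (leq_maxr N N1))// leq_addl.
  apply: lrep_disc => z zr; have [h1 _] := hN _ mN; split.
    by apply: h1; rewrite (lt_trans zr).
  by have [-> _] := hN1 _ mN1 z (ltW zr).
move=> e e0; have [M hM] := fc e e0; exists M => n Mn z zr.
have mM : (M <= m n)%N by rewrite (leq_trans Mn)// leq_addr.
by have [] := hM _ mM z (ltW zr).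
Qed.

(** Arzela-Ascoli: convergence on a countable dense set by a diagonal argument, then everywhere and
    locally uniformly by the common Lipschitz bound. Cluster points on the sphere do the work of
    completeness. *)
Lemma tame_subseq (D : set C) u : tame D u ->
  exists2 s, incr s & exists g, lu_cvg D (u \o s) g.
Proof.
move=> tu; have [d dd] := dense_seq.
have [||s hs Qs] := @diagonal (fun k s => exists a, ccvg (fun n => u (s n) (d k)) a).
- move=> k s _; have [a ha] := sphere_cluster (fun n => u (s n) (d k)).
  have [|t t1 t2] := @extraction (fun j n => chordal (u (s n) (d k)) a < (j.+1%:R)^-1).
    by move=> j N; apply: ha; rewrite invr_gt0.
  exists t => //; exists a => e e0; exists (Num.truncn e^-1).+1 => n Nn.
  rewrite (lt_trans (t2 n))//= -[ltRHS]invrK ltf_pV2 ?posrE ?invr_gt0//.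
  rewrite (lt_le_trans (truncnS_gt _))// ler_nat (leq_trans Nn)//.
- move=> k s s' [a ha] [N hN]; exists a => e e0; have [M hM] := ha e e0.
  exists (maxn N M) => n; rewrite geq_max => /andP[/hN[m nm ->] Mn].
  by apply: hM; rewrite (leq_trans Mn).
exists s => //.
have loc p : D p -> exists r L : R, [/\ 0 < r, 0 < L, forall z, cmod (z - p) < r -> D z &
    exists N, forall n, (N <= n)%N -> forall z w, cmod (z - p) < r -> cmod (w - p) < r ->
      chordal (u (s n) z) (u (s n) w) <= L * cmod (z - w)].
  move=> Dp; have [r [r0 rD [N hN]]] := tu p Dp.
  exists (r / 2), (10 / r); split; rewrite ?divr_gt0//.
    by move=> z zr; apply: rD; rewrite (lt_trans zr)// ltr_pdivrMr// ltr_pMr// ltr1n.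
  exists N => n Nn; have [|h1 h2] := hN (s n); first by rewrite (leq_trans Nn)// incr_ge.
  exact: small_osc_lip.
have cvz z : D z -> exists a, ccvg (fun n => u (s n) z) a.
  move=> Dz; have [a ha] := sphere_cluster (fun n => u (s n) z).
  exists a => e e0; have e4 : 0 < e / 5 by rewrite divr_gt0.
  have [r [L [r0 L0 rD [N hN]]]] := loc z Dz.
  have m0 : 0 < Num.min r (e / 5 / L) by rewrite lt_min r0 divr_gt0.
  have [k] := dd z _ m0; rewrite lt_min => /andP[kr kL].
  have [b hb] := Qs k; have [M hM] := hb _ e4.
  exists (maxn N M) => n; rewrite geq_max => /andP[Nn Mn].
  have [m] := ha _ e4 (maxn N M); rewrite geq_max => /andP[Nm Mm] hm.
  have zz : cmod (z - z) < r by rewrite subrr cmod0.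
  have Lk : L * cmod (d k - z) < e / 5 by rewrite mulrC -ltr_pdivlMr.
  have a1 := hN n Nn (d k) z kr zz; have a2 := hN m Nm (d k) z kr zz.
  have a3 := hM n Mn; have a4 := hM m Mm.
  have b1 := chordal_tri (u (s n) z) (u (s n) (d k)) a.
  have b2 := chordal_tri (u (s n) (d k)) b a.
  have b3 := chordal_tri b (u (s m) (d k)) a.
  have b4 := chordal_tri (u (s m) (d k)) (u (s m) z) a.
  rewrite (chordalC (u (s n) z) (u (s n) (d k))) in b1; rewrite (chordalC b (u (s m) (d k))) in b3.
  by clear -a1 a2 a3 a4 b1 b2 b3 b4 hm Lk; lra.
pose g z := xget None [set a | ccvg (fun n => u (s n) z) a].
have gP z : D z -> ccvg (fun n => u (s n) z) (g z).
  move=> /cvz[a ha]; rewrite /g; case: xgetP => [b _ //|].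
  by move=> /(_ a) /=.
exists g => p Dp e e0; have [r [L [r0 L0 rD [N hN]]]] := loc p Dp.
have e4 : 0 < e / 6 by rewrite divr_gt0.
exists (Num.min r (e / 6 / L)); first by rewrite lt_min r0 divr_gt0.
have pr : cmod (p - p) < r by rewrite subrr cmod0.
have [M hM] := gP p Dp _ e4.
exists (maxn N M) => n; rewrite geq_max => /andP[Nn Mn] z; rewrite lt_min => /andP[zr zL].
have Lz : L * cmod (z - p) < e / 6 by rewrite mulrC -ltr_pdivlMr.
have [M' hM'] := gP z (rD z zr) _ e4.
have a1 := hN n Nn z p zr pr; have a2 := hM n Mn.
pose m := maxn N (maxn M M').
have mN : (N <= m)%N by rewrite leq_maxl.
have mM : (M <= m)%N by rewrite !leq_max leqnn orbT.
have mM' : (M' <= m)%N by rewrite !leq_max leqnn !orbT.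
have a3 := hN m mN z p zr pr; have a4 := hM m mM; have a5 := hM' m mM'.
have b1 := chordal_tri (u (s n) z) (u (s n) p) (g z).
have b2 := chordal_tri (u (s n) p) (g p) (g z).
have b3 := chordal_tri (g p) (u (s m) p) (g z).
have b4 := chordal_tri (u (s m) p) (u (s m) z) (g z).
rewrite (chordalC (g p) (u (s m) p)) in b3.
rewrite (chordalC (u (s m) p) (u (s m) z)) in b4.
rewrite /= in a2 a4 a5 *.
by clear -a1 a2 a3 a4 a5 b1 b2 b3 b4 Lz e0; lra.
Qed.

End Normality.

(** * Totally ramified entire maps *)

Section Rigidity.
Variable (R : realType).
Local Notation C := R[i].
Local Open Scope complex_scope.
Implicit Types (p w z : C) (r : R).

(** A maximiser up to a factor 2 suffices for both rescalings below, and no maximum has to be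
    attained. *)
Lemma near_sup (S : set R) (x0 B : R) : S x0 -> 0 < x0 -> (forall x, S x -> x <= B) ->
  exists2 x, S x & x0 <= 2 * x /\ forall y, S y -> y <= 2 * x.
Proof.
move=> Sx0 x00 hB.
have hs : has_sup S by split; [exists x0|exists B].
have s0 : 0 < sup S by rewrite (lt_le_trans x00)// ub_le_sup//; exact: hs.2.
have [|x Sx hx] := @sup_adherent _ S (sup S / 2) _ hs; first by rewrite divr_gt0.
exists x => //.
have h y : S y -> y <= 2 * x.
  by move=> Sy; have : y <= sup S by [apply: ub_le_sup; [exact: hs.2|]]; lra.
by split; [exact: h|].
Qed.

Lemma cancel_limit p e n (A B : C -> C) : 0 < e -> ct A p -> ct B p ->
  (forall z, 0 < cmod (z - p) < e -> (z - p) ^+ n * A z = (z - p) ^+ n * B z) ->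
  A p = B p.
Proof.
move=> e0 cA cB h; apply: (ct_unique e0 cA cB) => z hz.
have /andP[z0 _] := hz.
apply: (mulfI _ (h z hz)).
by rewrite expf_neq0// -cmod_gt0.
Qed.

Lemma dv_pow_mul p (f q : C -> C) k z : (forall w, f w = (w - p) ^+ k.+1 * q w) ->
  derivable q z 1 ->
  derive1 f z = (z - p) ^+ k * (k.+1%:R * q z + (z - p) * derive1 q z).
Proof.
move=> fE /derivable_dv dq.
have h1 : dv id (fun w => w - p) z 1.
  by rewrite -[X in dv _ _ _ X]subr0; apply: dvB; [exact: dv_id|exact: dv_cst].
have -> : f = fun w => (w - p) ^+ k.+1 * q w by apply: funext.
by rewrite (dv_derive1 (dvM (@ct_id R z) (dvX (@ct_id R z) k h1) dq)) exprS; ring.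
Qed.

(** At a zero of order [k + 1] the two sides have orders [4 k] and [3 (k + 1)], so [k = 3]; the
    leading coefficients then give [(4 q)^4 = h q^3] at [p], while Cauchy's estimate on the circle
    of radius 1/2 gives [|q| <= 2^4 e]. *)
Lemma zero_of_ode p (phi h : C -> C) (h0 e : R) : 0 < h0 -> 256 * (16 * e) < h0 ->
  hol p 1 phi -> hol p 1 h ->
  (forall z, cmod (z - p) < 1 -> derive1 phi z ^+ 4 = h z * phi z ^+ 3) ->
  h0 <= cmod (h p) ->
  (forall z, cmod (z - p) < 1 -> cmod (phi z) <= e) ->
  (exists2 z, cmod (z - p) < 1 & phi z != 0) -> phi p != 0.
Proof.
have N1 k : (3 < k -> k.+1 * 3 + (k - 3) = k * 4)%N by clear; lia.
have N2 k : (k < 3 -> k * 4 + (3 - k) = k.+1 * 3)%N by clear; lia.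
move=> h00 eh hphi hh ode hp phie [z0 z01 phiz0]; apply/eqP => phip.
have [/(_ _ z01)/eqP|[m [q [hq qp phiE]]]] := hol_order (@ltr01 R) hphi.
  by rewrite (negbTE phiz0).
have pp : cmod (p - p) < 1 by rewrite subrr cmod0.
case: m phiE => [|k] phiE.
  by move: phip; rewrite phiE expr0 mul1r => /eqP; rewrite (negbTE qp).
pose eta z := k.+1%:R * q z + (z - p) * derive1 q z.
have cq : ct q p := hol_ct hq pp.
have ceta : ct eta p.
  apply: ctD; first by apply: ctM; [exact: ct_cst|].
  apply: ctM; last exact: (hol_ct (hol_derive1 hq) pp).
  by apply: ctB; [exact: ct_id|exact: ct_cst].
have ch : ct h p := hol_ct hh pp.
have etap : eta p = k.+1%:R * q p by rewrite /eta subrr mul0r addr0.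
have hp0 : h p != 0 by rewrite -cmod_gt0 (lt_le_trans h00).
have E z : cmod (z - p) < 1 ->
    (z - p) ^+ (k * 4) * eta z ^+ 4 = (z - p) ^+ (k.+1 * 3) * (h z * q z ^+ 3).
  move=> z1; have := ode z z1; rewrite (dv_pow_mul phiE (hq _ z1)) -/(eta z) phiE.
  by rewrite !exprMn -!exprM => ->; ring.
have k3 : k = 3%N.
  apply/eqP; rewrite eqn_leq; apply/andP; split; rewrite leqNgt; apply/negP => hk.
  - have : (p - p) ^+ (k - 3) * eta p ^+ 4 = h p * q p ^+ 3.
      apply: (@cancel_limit p 1 (k.+1 * 3) (fun z => (z - p) ^+ (k - 3) * eta z ^+ 4)
        (fun z => h z * q z ^+ 3)) => //.
      + apply: ctM; last exact: ctX.
        by apply: ctX; apply: ctB; [exact: ct_id|exact: ct_cst].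
      + by apply: ctM => //; exact: ctX.
      + move=> z /andP[_ z1]; rewrite -E// mulrA -exprD; congr (_ ^+ _ * _).
        exact: N1.
    rewrite /= subrr expr0n subn_eq0 leqNgt hk mul0r => /esym/eqP.
    by rewrite mulf_eq0 expf_eq0 /= (negbTE hp0) (negbTE qp).
  - have : eta p ^+ 4 = (p - p) ^+ (3 - k) * (h p * q p ^+ 3).
      apply: (@cancel_limit p 1 (k * 4) (fun z => eta z ^+ 4)
        (fun z => (z - p) ^+ (3 - k) * (h z * q z ^+ 3))) => //.
      + exact: ctX.
      + apply: ctM; last by apply: ctM => //; exact: ctX.
        by apply: ctX; apply: ctB; [exact: ct_id|exact: ct_cst].
      + move=> z /andP[_ z1]; rewrite E// [RHS]mulrA -exprD; congr (_ ^+ _ * _).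
        by rewrite N2.
    rewrite /= subrr expr0n subn_eq0 leqNgt hk mul0r => /eqP.
    by rewrite expf_eq0 /= etap mulf_eq0 pnatr_eq0 (negbTE qp).
have {}E : eta p ^+ 4 = h p * q p ^+ 3.
  apply: (@cancel_limit p 1 12 (fun z => eta z ^+ 4) (fun z => h z * q z ^+ 3)) => //.
  - exact: ctX.
  - by apply: ctM => //; exact: ctX.
  - by move=> z /andP[_ z1]; have := E z z1; rewrite k3.
have {}E : 256 * q p = h p.
  apply: (mulIf (expf_neq0 3 qp)); rewrite -E etap k3; ring.
have qe : cmod (q p) <= 16 * e.
  have r0 : 0 < 2^-1 :> R by rewrite invr_gt0.
  have r1 : 2^-1 < 1 :> R by rewrite invf_lt1// ltr1n.
  have := @hol_le _ p 2^-1 1 q hq r1 p (16 * e).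
  rewrite subrr cmod0 subr0 mulfK ?invr_eq0 ?pnatr_eq0//; apply => // t _.
  have := phie (circ p 2^-1 t); rewrite phiE cmodM cmodX circP ?(ltW r0)// => /(_ r1).
  by rewrite k3 exprVn; lra.
move: hp; rewrite -E cmodM cmod_nat leNgt (le_lt_trans _ eh)//.
by rewrite ler_wpM2l.
Qed.

(** Since [chi^4 = phi / h], the bound on [phi] means [|chi| <= k], and Cauchy gives [|chi'| <= 2 k]
    and [|h'| <= h1] at 0. Then [1 = 4 chi' + chi h' / h], obtained by differentiating the equation
    once, contradicts the choice of [k]. *)
Lemma nonzero_of_ode (phi h : C -> C) (h0 h1 k : R) : 0 < h0 -> 0 < k ->
  8 * k + k * (h1 / h0) < 1 ->
  hol 0 1 phi -> hol 0 1 h ->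
  (forall z, cmod z < 1 -> derive1 phi z ^+ 4 = h z * phi z ^+ 3) ->
  (forall z, cmod z < 1 -> h0 <= cmod (h z) <= h1 / 2) ->
  (forall z, cmod z < 1 -> cmod (phi z) <= h0 * k ^+ 4) ->
  (forall z, cmod z < 1 -> phi z != 0) -> False.
Proof.
move=> h00 k0 kk hphi hh ode hb phie phi0.
have D0 z : cmod z < 1 -> cmod (z - 0) < 1 by rewrite subr0.
have z0 : cmod (0 : C) < 1 by rewrite cmod0.
have hn z : cmod z < 1 -> h z != 0.
  by move=> /hb/andP[h2 _]; rewrite -cmod_gt0 (lt_le_trans h00).
have dn z : cmod z < 1 -> derive1 phi z != 0.
  move=> z1; have := ode z z1 => E; apply/eqP => E0; move/eqP: E.
  rewrite E0 expr0n eq_sym mulf_eq0 expf_eq0 /= (negbTE (hn _ z1)) (negbTE (phi0 _ z1)) //.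
pose chi z := phi z / derive1 phi z.
have d1 z : cmod z < 1 -> dv id phi z (derive1 phi z).
  by move=> z1; exact: (hol_dv hphi (D0 _ z1)).
have d2 z : cmod z < 1 -> dv id (derive1 phi) z (derive1 (derive1 phi) z).
  by move=> z1; exact: (hol_dv (hol_derive1 hphi) (D0 _ z1)).
have dchi z : cmod z < 1 -> dv id chi z (derive1 phi z * (derive1 phi z)^-1 +
    phi z * (- derive1 (derive1 phi) z / derive1 phi z ^+ 2)).
  move=> z1; have := @dvV _ _ _ _ (@ct_id R z) (derive1 phi) _ (dn _ z1) (d2 _ z1).
  by move=> h3; have := dvM (@ct_id R z) (d1 _ z1) h3.
have hchi : hol 0 1 chi by move=> z; rewrite subr0 => z1; exact: dv_derivable (dchi _ z1).
have chik z : cmod z < 1 -> cmod (chi z) <= k.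
  move=> z1; have E : chi z ^+ 4 = phi z / h z.
    rewrite /chi expr_div_n ode//.
    by field; rewrite hn// phi0.
  have := hb z z1 => /andP[b1 b2].
  rewrite -(ler_pXn2r (n := 4)) ?nnegrE ?cmod_ge0 ?(ltW k0)// -cmodX E cmodM cmodV.
  rewrite ler_pdivrMr ?(lt_le_trans h00)// (le_trans (phie _ z1))// mulrC.
  by rewrite ler_wpM2l ?exprn_ge0 ?(ltW k0).
have chi1 : cmod (derive1 chi 0) <= 2 * k.
  rewrite -[leRHS]divr1; apply: hol_derive1_center hchi _ => // z.
  by rewrite subr0; exact: chik.
have hd1 : cmod (derive1 h 0) <= h1.
  have <- : 2 * (h1 / 2) / 1 = h1 by field.
  by apply: hol_derive1_center (@ltr01 R) hh _ => z; rewrite subr0 => /hb/andP[].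
have dh : dv id h 0 (derive1 h 0) by apply: hol_dv hh _; rewrite subrr cmod0.
set f := phi 0; set f1 := derive1 phi 0; set f2 := derive1 (derive1 phi) 0.
have f10 : f1 != 0 by exact: dn.
have f00 : f != 0 by exact: phi0.
have hz0 : h 0 != 0 by exact: hn.
have E1 : f1 ^+ 4 = h 0 * f ^+ 3 by exact: ode.
have E2 : 4 * f1 ^+ 3 * f2 = derive1 h 0 * f ^+ 3 + h 0 * (3 * f ^+ 2 * f1).
  rewrite -(dv_derive1 (dvX (@ct_id R 0) 3 (d2 _ z0))).
  have hr := dvM (@ct_id R 0) dh (dvX (@ct_id R 0) 2 (d1 _ z0)).
  apply: dv_derive1; apply: dv_near hr.
  have /near_disc : cmod ((0 : C) - 0) < 1 by rewrite subrr cmod0.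
  by apply: filterS => z; rewrite subr0 => z1; rewrite -ode.
have E3 : 4 * derive1 chi 0 = 1 - chi 0 * (derive1 h 0 / h 0).
  rewrite (dv_derive1 (dchi _ z0)) -/f -/f1 -/f2 /chi -/f -/f1.
  have -> : f2 = (derive1 h 0 * f ^+ 3 + h 0 * (3 * f ^+ 2 * f1)) / (4 * f1 ^+ 3).
    by rewrite -E2; field; rewrite f10.
  have -> : h 0 = f1 ^+ 4 / f ^+ 3 by rewrite E1 mulfK// expf_neq0.
  by field; rewrite f10 f00.
have /andP[b1 b2] := hb _ z0.
have E4 : 1 <= 8 * k + k * (h1 / h0).
  have E5 : 1 = 4 * derive1 chi 0 + chi 0 * (derive1 h 0 / h 0) by rewrite E3 subrK.
  apply: (@le_trans _ _ (cmod (1 : C))); first by rewrite cmod1.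
  rewrite [X in cmod X]E5 (le_trans (cmodD _ _))// lerD//.
    rewrite cmodM cmod_nat (_ : 8 * k = 4 * (2 * k)); last by rewrite mulrA -natrM.
    by rewrite ler_wpM2l.
  rewrite cmodM ler_pM ?cmod_ge0 ?chik// cmodM cmodV.
  rewrite ler_pM ?cmod_ge0 ?invr_ge0 ?cmod_ge0// lef_pV2// posrE.
  exact: lt_le_trans b1.
by move: kk; rewrite ltNge E4.
Qed.

(** The radius 2 leaves room for a unit disc around each point of the unit disc, on which a zero at
    its centre is excluded; the zero-free case then applies on the unit disc itself. *)
Lemma small_solution (h0 h1 : R) : 0 < h0 -> 0 < h1 -> exists2 e, 0 < e &
  forall phi h : C -> C, hol 0 2 phi -> hol 0 2 h ->
  (forall z, cmod z < 2 -> derive1 phi z ^+ 4 = h z * phi z ^+ 3) ->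
  (forall z, cmod z < 2 -> h0 <= cmod (h z) <= h1) ->
  (forall z, cmod z < 2 -> cmod (phi z) <= e) ->
  (forall p, cmod p < 1 -> exists2 z, cmod (z - p) < 1 & phi z != 0) -> False.
Proof.
move=> h00 h10.
pose k := (8 + (2 * h1) / h0 + 1)^-1.
have q0 : 0 < (2 * h1) / h0 by rewrite divr_gt0// mulr_gt0.
have D0 : 0 < 8 + (2 * h1) / h0 + 1 by rewrite !addr_gt0.
have k0 : 0 < k by rewrite invr_gt0.
have kk : 8 * k + k * ((2 * h1) / h0) < 1.
  rewrite (_ : _ + _ = (8 + (2 * h1) / h0) / (8 + (2 * h1) / h0 + 1)); last first.
    by rewrite /k mulrC -mulrDr mulrC.
  by rewrite ltr_pdivrMr// mul1r ltrDl.
have hk0 : 0 < h0 * k ^+ 4 by rewrite mulr_gt0// exprn_gt0.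
(* Half of the bound allowed by [256 * (16 * e) < h0]. *)
pose e1 := h0 / 2 / 16 / 256.
have e10 : 0 < e1 by do 3 apply: divr_gt0 => //.
have e1E : 256 * (16 * e1) < h0.
  rewrite /e1 (mulrC 16) mulrA (mulrC 256) !mulfVK ?pnatr_eq0// ltr_pdivrMr//.
  by rewrite ltr_pMr// ltr1n.
exists (Num.min e1 (h0 * k ^+ 4)); first by rewrite lt_min e10.
move=> phi h hphi hh ode hb phie nz.
have D1 z : cmod z < 1 -> cmod z < 2 by move=> /lt_trans; apply; rewrite ltr1n.
apply: (@nonzero_of_ode phi h h0 (2 * h1) k) => //.
- by apply: hol_sub hphi; rewrite subrr cmod0 add0r ler1n.
- by apply: hol_sub hh; rewrite subrr cmod0 add0r ler1n.
- by move=> z /D1; exact: ode.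
- by move=> z /D1/hb; rewrite mulrAC divff// mul1r.
- move=> z /D1/phie; rewrite le_min => /andP[] //.
- move=> z z1; have D2 w : cmod (w - z) < 1 -> cmod w < 2.
    by move=> wz; have := cmodD (w - z) z; rewrite subrK; lra.
  apply: (@zero_of_ode z phi h h0 e1) => //.
  + by apply: hol_sub hphi; rewrite subr0; lra.
  + by apply: hol_sub hh; rewrite subr0; lra.
  + by move=> w /D2; exact: ode.
  + by have /andP[] := hb z (D1 z z1).
  + by move=> w /D2/phie; rewrite le_min => /andP[].
  + exact: nz.
Qed.

End Rigidity.

(** * Pairs of entire functions with a prescribed Wronskian *)

Section Wronskian.
Variable (R : realType).
Local Notation C := R[i].
Local Open Scope complex_scope.
Implicit Types (p w z : C) (r : R) (H P : C -> C).

Lemma quotient_deriv (K : fieldType) (P P' H H' a : K) : H != 0 ->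
  (P' - a * H') * H^-1 + (P - a * H) * (- H' / H ^+ 2) = (P' * H - P * H') / H ^+ 2.
Proof. by move=> H0; field. Qed.

Lemma quotient_ode (K : fieldType) (q q' H : K) : H != 0 ->
  q ^+ 3 * q' ^+ 3 / (H ^+ 2) ^+ 4 = q' ^+ 3 * (H ^+ 5)^-1 * (q * H^-1) ^+ 3.
Proof. by move=> H0; field. Qed.

Lemma rescale_wronskian (K : comRingType) (k b h p h' p' : K) :
  k * b * p' * (k * h) - k * p * (k * b * h') = k ^+ 2 * b * (p' * h - p * h').
Proof. by ring. Qed.

Definition wronsk H P z := derive1 P z * H z - P z * derive1 H z.

Lemma exp_mono n (x y : R) : 0 <= x -> x <= y -> x ^+ n <= y ^+ n.
Proof. by move=> x0 xy; apply: lerXn2r; rewrite ?nnegrE// (le_trans x0). Qed.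

Lemma exmin4 (x1 x2 x3 x4 : R) : 0 < x1 -> 0 < x2 -> 0 < x3 -> 0 < x4 ->
  exists d, 0 < d /\ [/\ d <= x1, d <= x2, d <= x3 & d <= x4].
Proof.
move=> h1 h2 h3 h4; exists (Num.min (Num.min x1 x2) (Num.min x3 x4)).
by rewrite !lt_min h1 h2 h3 h4 !ge_min !lexx !orbT.
Qed.

(** With [phi = P / H - a] one has [phi' = W / H^2], and the identity becomes [phi'^4 = h phi^3] for
    [h = ((P - b H) (P - c H))^3 / H^5]. Closeness of [P] to [a H] keeps [H] and the other two
    factors away from 0, so [h] is bounded on both sides. *)
Lemma core_disc (B : R) (a b c : C) : 1 <= B -> a != b -> a != c ->
  exists2 d, 0 < d & forall H P, hol 0 2 H -> hol 0 2 P ->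
  (forall z, cmod z < 2 -> wronsk H P z ^+ 4 =
     (P z - a * H z) ^+ 3 * ((P z - b * H z) * (P z - c * H z)) ^+ 3) ->
  (forall z, cmod z < 2 -> cmod (H z) <= B /\ cmod (P z) <= B) ->
  (forall z, cmod z < 2 -> cmod (H z - H 0) <= d /\ cmod (P z - P 0) <= d) ->
  1 <= cmod (H 0) + cmod (P 0) -> cmod (P 0 - a * H 0) <= d ->
  (forall p, cmod p < 1 -> exists2 z, cmod (z - p) < 1 & wronsk H P z != 0) -> False.
Proof.
move=> B1 ab ac.
have B0 : 0 < B by rewrite (lt_le_trans ltr01).
pose A := 1 + cmod a + cmod b + cmod c.
have [ca cb cc] : [/\ 0 <= cmod a, 0 <= cmod b & 0 <= cmod c] by split; exact: cmod_ge0.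
have A1 : 1 <= A by rewrite /A; lra.
have A0 : 0 < A by rewrite (lt_le_trans ltr01).
have [e0 [e00 eb ec]] : exists e, [/\ 0 < e, e <= cmod (a - b) & e <= cmod (a - c)].
  exists (Num.min (cmod (a - b)) (cmod (a - c))); rewrite lt_min !cmod_gt0 !subr_eq0 ab ac.
  by rewrite !ge_min !lexx orbT.
(* From [|H 0| + |P 0| >= 1] and [P 0] within 1/2 of [a H 0] follows [|H 0| >= 1 / (2 A) = 2 m];
   half of it survives on the disc. *)
pose m := (4 * A)^-1; have m0 : 0 < m by rewrite invr_gt0 mulr_gt0.
(* [(b - a) H] and [(c - a) H] have modulus at least [e0 m], and [P - a H] takes away at most half
   of it. *)
pose t := e0 * m / 2; have t0 : 0 < t by rewrite divr_gt0// mulr_gt0.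
pose h0 := (t * t) ^+ 3 / B ^+ 5; pose h1 := ((2 * A * B) * (2 * A * B)) ^+ 3 / m ^+ 5.
have h00 : 0 < h0 by rewrite divr_gt0// exprn_gt0// mulr_gt0.
have AB0 : 0 < 2 * A * B by rewrite !mulr_gt0.
have h10 : 0 < h1 by rewrite divr_gt0// exprn_gt0// mulr_gt0.
have [eps eps0 heps] := small_solution h00 h10.
have A3 : 0 < 3 * A by rewrite mulr_gt0.
have [d [d0 d1 d2 d3 d4]] : exists d,
    [/\ 0 < d, d <= 2^-1, d <= m, 3 * A * d <= t & 3 * A * d <= eps * m].
  have x1 : 0 < 2^-1 :> R by rewrite invr_gt0.
  have x3 : 0 < t / (3 * A) by rewrite divr_gt0.
  have x4 : 0 < eps * m / (3 * A) by rewrite divr_gt0// mulr_gt0.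
  have [d [d0 [l1 l2 l3 l4]]] := exmin4 x1 m0 x3 x4.
  by exists d; split => //; rewrite mulrC -ler_pdivlMr.
exists d => // H P hH hP id4 HPB HPd HP1 Q0 Wn.
have Hm z : cmod z < 2 -> m <= cmod (H z).
  move=> z2; have [hd _] := HPd z z2.
  have h2 : 2 * m <= cmod (H 0).
    have -> : 2 * m = 2^-1 / A by rewrite /m; field; rewrite gt_eqF.
    rewrite ler_pdivrMr//.
    have := cmodD (P 0 - a * H 0) (a * H 0); rewrite subrK cmodM => h3.
    have : cmod (H 0) * (1 + cmod a) <= cmod (H 0) * A.
      by rewrite ler_wpM2l ?cmod_ge0// /A; lra.
    rewrite mulrDr mulr1 (mulrC _ (cmod a)) => h4.
    clear -h3 h4 HP1 Q0 d1; lra.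
  have := cmod_leBr (H z) (H 0) => h3.
  by clear -h2 h3 hd d2; lra.
have Hn z : cmod z < 2 -> H z != 0.
  by move=> /Hm h; rewrite -cmod_gt0 (lt_le_trans m0).
pose Q z := P z - a * H z.
have Qd z : cmod z < 2 -> cmod (Q z) <= 3 * A * d.
  move=> z2; have [hd pd] := HPd z z2.
  have -> : Q z = (P 0 - a * H 0) + ((P z - P 0) - a * (H z - H 0)) by rewrite /Q; ring.
  rewrite (le_trans (cmodD _ _))//.
  have := cmodDB (P z - P 0) (a * (H z - H 0)); rewrite cmodM => h3.
  have : cmod a * cmod (H z - H 0) <= A * d.
    by rewrite ler_pM ?cmod_ge0// /A; lra.
  have : d <= A * d by rewrite ler_peMl// ltW.
  rewrite -mulrA => h4 h5; clear -h3 h4 h5 hd pd Q0; lra.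
have sep b' z : e0 <= cmod (a - b') -> cmod b' <= A -> cmod z < 2 ->
    t <= cmod (P z - b' * H z) <= 2 * A * B.
  move=> he hb z2; have [Hb Pb] := HPB z z2; apply/andP; split.
    have -> : P z - b' * H z = Q z - (b' - a) * H z by rewrite /Q; ring.
    have h2 := cmod_leBr (Q z) ((b' - a) * H z).
    have h3 : e0 * m <= cmod ((b' - a) * H z).
      by rewrite cmodM ler_pM ?Hm ?(ltW e00) ?(ltW m0)// cmodB.
    have h4 := Qd z z2; have h5 : t + t = e0 * m by rewrite /t; field.
    clear -h2 h3 h4 h5 d3; lra.
  rewrite (le_trans (cmodDB _ _))// cmodM.
  have h2 : cmod b' * cmod (H z) <= A * B by rewrite ler_pM ?cmod_ge0.
  have h3 : B <= A * B by rewrite ler_peMl// ltW.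
  by clear -h2 h3 Pb; rewrite -mulrA; lra.
have sb z : cmod z < 2 -> t <= cmod (P z - b * H z) <= 2 * A * B.
  by apply: sep => //; rewrite /A; lra.
have sc z : cmod z < 2 -> t <= cmod (P z - c * H z) <= 2 * A * B.
  by apply: sep => //; rewrite /A; lra.
pose phi z := Q z * (H z)^-1.
pose h z := ((P z - b * H z) * (P z - c * H z)) ^+ 3 * (H z ^+ 5)^-1.
have D z : cmod z < 2 -> cmod (z - 0) < 2 by rewrite subr0.
have dH z : cmod z < 2 -> dv id H z (derive1 H z).
  by move=> z2; exact: (hol_dv hH (D _ z2)).
have dP z : cmod z < 2 -> dv id P z (derive1 P z).
  by move=> z2; exact: (hol_dv hP (D _ z2)).
have dPa a' z : cmod z < 2 -> dv id (fun z => P z - a' * H z) z (derive1 P z - a' * derive1 H z).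
  by move=> z2; apply: dvB (dP _ z2) (dvZ _ _ (dH _ z2)); exact: ct_id.
have dphi z : cmod z < 2 -> dv id phi z ((derive1 P z - a * derive1 H z) * (H z)^-1 +
    Q z * (- derive1 H z / H z ^+ 2)).
  move=> z2; exact: (dvM (@ct_id R z) (dPa a z z2) (dvV (@ct_id R z) (Hn _ z2) (dH _ z2))).
apply: (heps phi h).
- by move=> z; rewrite subr0 => z2; exact: dv_derivable (dphi _ z2).
- move=> z; rewrite subr0 => z2.
  have H5 : H z ^+ 5 != 0 by rewrite expf_neq0// Hn.
  have k1 := dvX (@ct_id R z) 2 (dvM (@ct_id R z) (dPa b z z2) (dPa c z z2)).
  have k2 := dvV (@ct_id R z) H5 (dvX (@ct_id R z) 4 (dH _ z2)).
  exact: dv_derivable (dvM (@ct_id R z) k1 k2).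
- move=> z z2; rewrite (dv_derive1 (dphi _ z2)).
  have -> : (derive1 P z - a * derive1 H z) * (H z)^-1 + Q z * (- derive1 H z / H z ^+ 2) =
     wronsk H P z / H z ^+ 2.
    by apply: quotient_deriv; exact: Hn.
  by rewrite expr_div_n id4//; apply: quotient_ode; exact: Hn.
- move=> z z2; have /andP[b1 b2] := sb z z2; have /andP[c1 c2] := sc z z2.
  have [Hb _] := HPB z z2; have Hz0 : 0 < cmod (H z) by rewrite cmod_gt0 Hn.
  rewrite /h cmodM cmodV !cmodX cmodM; apply/andP; split.
    apply: ler_pM.
    + by rewrite exprn_ge0// mulr_ge0// ltW.
    + by rewrite invr_ge0 exprn_ge0// ltW.
    + apply: exp_mono; first by apply: mulr_ge0; exact: ltW.
      by apply: ler_pM => //; exact: ltW.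
    + rewrite lef_pV2 ?posrE ?exprn_gt0//.
      by apply: exp_mono => //; exact: cmod_ge0.
  apply: ler_pM.
  + by rewrite exprn_ge0// mulr_ge0// cmod_ge0.
  + by rewrite invr_ge0 exprn_ge0// cmod_ge0.
  + apply: exp_mono; first by apply: mulr_ge0; exact: cmod_ge0.
    by apply: ler_pM => //; exact: cmod_ge0.
  + rewrite lef_pV2 ?posrE ?exprn_gt0//.
    by apply: exp_mono; [exact: ltW|exact: Hm].
- move=> z z2; rewrite /phi cmodM cmodV ler_pdivrMr ?cmod_gt0 ?Hn//.
  rewrite (le_trans (Qd _ z2))// (le_trans d4)// ler_wpM2l ?(ltW eps0)//.
  exact: Hm.
- move=> p p1; have [z zp Wz] := Wn p p1; exists z => //.
  have z2 : cmod z < 2 by have := cmodD (z - p) p; rewrite subrK; lra.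
  rewrite mulf_neq0 ?invr_eq0 ?Hn//; apply/eqP => Qz.
  have := id4 z z2; rewrite -/(Q z) Qz expr0n mul0r => /eqP.
  by rewrite expf_eq0 /= (negbTE Wz).
Qed.

(** Small derivatives give [|W|^4 < d^9] at 0, so the three factors [P - x H] cannot all exceed [d]
    there; the previous lemma applies to the value whose factor is small. *)
Lemma core_disc3 (B : R) (a b c : C) : 1 <= B -> a != b -> a != c -> b != c ->
  exists2 e, 0 < e & forall H P, hol 0 2 H -> hol 0 2 P ->
  (forall z, cmod z < 2 -> wronsk H P z ^+ 4 =
     (P z - a * H z) ^+ 3 * ((P z - b * H z) * (P z - c * H z)) ^+ 3) ->
  (forall z, cmod z < 2 -> cmod (H z) <= B /\ cmod (P z) <= B) ->
  (forall z, cmod z < 2 -> cmod (derive1 H z) <= e /\ cmod (derive1 P z) <= e) ->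
  1 <= cmod (H 0) + cmod (P 0) ->
  (forall p, cmod p < 1 -> exists2 z, cmod (z - p) < 1 & wronsk H P z != 0) -> False.
Proof.
move=> B1 ab ac bc.
have B0 : 0 < B by rewrite (lt_le_trans ltr01).
have [da da0 ha] := core_disc B1 ab ac.
have ba : b != a by rewrite eq_sym.
have ca : c != a by rewrite eq_sym.
have cb : c != b by rewrite eq_sym.
have [db db0 hb] := core_disc B1 ba bc.
have [dc dc0 hc] := core_disc B1 ca cb.
have [d [d0 [d1 d2 d3 d4]]] := exmin4 da0 db0 dc0 (@ltr01 R).
have x2 : 0 < d / 2 by rewrite divr_gt0.
have x3 : 0 < (2 * B)^-1 by rewrite invr_gt0 mulr_gt0.
(* Yields [2 B e < d^9]; with [2 B e <= 1] from [x3], the fourth power of [|W 0| <= 2 B e] stays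
   below [d^9]. *)
have x4 : 0 < d ^+ 9 / (2 * B) / 2 by rewrite !divr_gt0 ?mulr_gt0 ?exprn_gt0.
have [e [e0 [e1 e2 e3 _]]] := exmin4 x2 x3 x4 x4.
exists e => // H P hH hP id4 HPB HPe HP1 Wn.
have D z : cmod z < 2 -> cmod (z - 0) < 2 by rewrite subr0.
have z02 : cmod (0 : C) < 2 by rewrite cmod0.
have lip f : hol 0 2 f -> (forall z, cmod z < 2 -> cmod (derive1 f z) <= e) ->
    forall z, cmod z < 2 -> cmod (f z - f 0) <= d.
  move=> hf fe z z2.
  have fe' w : cmod (w - 0) < 2 -> cmod (derive1 f w) <= e by rewrite subr0; exact: fe.
  rewrite (le_trans (hol_lip hf fe' (D _ z02) (D _ z2)))// subr0.
  rewrite (le_trans (y := e * 2))//; first by rewrite ler_wpM2l ?(ltW e0)// ltW.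
  by rewrite -ler_pdivlMr.
have lH z : cmod z < 2 -> cmod (H z - H 0) <= d by apply: lip => // w /HPe[].
have lP z : cmod z < 2 -> cmod (P z - P 0) <= d by apply: lip => // w /HPe[].
have W0 : cmod (wronsk H P 0) <= 2 * B * e.
  have [h1 h2] := HPB 0 z02; have [h3 h4] := HPe 0 z02.
  rewrite (le_trans (cmodDB _ _))// !cmodM.
  have k1 : cmod (derive1 P 0) * cmod (H 0) <= e * B.
    exact: (ler_pM (cmod_ge0 _) (cmod_ge0 _) h4 h1).
  have k2 : cmod (P 0) * cmod (derive1 H 0) <= B * e.
    exact: (ler_pM (cmod_ge0 _) (cmod_ge0 _) h2 h3).
  have -> : 2 * B * e = e * B + B * e by ring.
  exact: lerD k1 k2.
have W4 : cmod (wronsk H P 0) ^+ 4 < d ^+ 9.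
  have l1 : 2 * B * e <= 1 by rewrite mulrC -ler_pdivlMr ?mulr_gt0// mul1r.
  have l2 : 2 * B * e < d ^+ 9.
    rewrite mulrC -ltr_pdivlMr ?mulr_gt0// (le_lt_trans e3)//.
    by rewrite ltr_pdivrMr// ltr_pMr ?ltr1n// divr_gt0 ?exprn_gt0 ?mulr_gt0.
  rewrite (le_lt_trans _ l2)// (le_trans (exp_mono 4 (cmod_ge0 _) W0))//.
  have p0 : 0 <= 2 * B * e by rewrite mulr_ge0 ?(ltW e0)// mulr_ge0// ltW.
  by rewrite exprS ler_piMr// exprn_ile1.
pose G x := cmod (P 0 - x * H 0).
have G0 x : 0 <= G x by exact: cmod_ge0.
have [Ga|Ga] := leP (G a) d.
  apply: (ha H P) => //.
  - by move=> z z2; split; [apply: le_trans (lH z z2) _|apply: le_trans (lP z z2) _].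
  - exact: le_trans Ga _.
have [Gb|Gb] := leP (G b) d.
  apply: (hb H P) => //.
  - by move=> z z2; rewrite id4//; ring.
  - by move=> z z2; split; [apply: le_trans (lH z z2) _|apply: le_trans (lP z z2) _].
  - exact: le_trans Gb _.
have [Gc|Gc] := leP (G c) d.
  apply: (hc H P) => //.
  - by move=> z z2; rewrite id4//; ring.
  - by move=> z z2; split; [apply: le_trans (lH z z2) _|apply: le_trans (lP z z2) _].
  - exact: le_trans Gc _.
move: W4; rewrite -cmodX id4// cmodM !cmodX cmodM -/(G a) -/(G b) -/(G c) ltNge => /negP; apply.
have -> : d ^+ 9 = d ^+ 3 * (d * d) ^+ 3 by ring.
have d0' := ltW d0; have Ga' := ltW Ga; have Gb' := ltW Gb; have Gc' := ltW Gc.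
apply: ler_pM; [exact: exprn_ge0|by rewrite exprn_ge0// mulr_ge0|exact: exp_mono|].
by apply: exp_mono; [exact: mulr_ge0|exact: ler_pM].
Qed.

Lemma derive1_rescale f (a b k : C) z : derivable f (a + b * z) 1 ->
  dv id (fun z => k * f (a + b * z)) z (k * b * derive1 f (a + b * z)).
Proof.
move=> /derivable_dv h.
have dz : dv id (fun z => a + b * z) z (0 + b * 1).
  by apply: dvD; [exact: dv_cst|apply: dvZ; [exact: ct_id|exact: dv_id]].
set l := derive1 f _ in h *.
have := dvZ (@ct_id R z) k (dv_comp (@ct_id R _) dz h).
by rewrite add0r mulr1 (mulrC l) mulrA.
Qed.

(** Replacing [(H, P)] by [rho^4 (H, P)] taken at [z0 + rho z] multiplies both sides of the identity
    by [rho^36], as the Wronskian scales by [rho^(8 + 1)]. This invariance dictates the weight 4 and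
    the fourth root [u]. *)
Lemma core_entire (a b c : C) H P : a != b -> a != c -> b != c ->
  (forall z, derivable H z 1) -> (forall z, derivable P z 1) ->
  (forall z, wronsk H P z ^+ 4 =
     (P z - a * H z) ^+ 3 * ((P z - b * H z) * (P z - c * H z)) ^+ 3) ->
  (forall p r, 0 < r -> exists2 z, cmod (z - p) < r & wronsk H P z != 0) -> False.
Proof.
move=> ab ac bc hH hP id4 Wn.
pose v z := cmod (H z) + cmod (P z).
have v0 z : 0 <= v z by rewrite addr_ge0 ?cmod_ge0.
pose u z : R := Num.sqrt (Num.sqrt (v z)).
have u4 z : u z ^+ 4 = v z by rewrite (exprM _ 2 2) sqr_sqrtr ?sqrtr_ge0// sqr_sqrtr.
have u0 z : 0 <= u z by exact: sqrtr_ge0.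
have [z1 _ W1] := Wn 0 1 (@ltr01 R).
have u1 : 0 < u z1.
  rewrite !sqrtr_gt0 lt_def v0 andbT; apply: contraNneq W1 => vz.
  have := cmod_ge0 (H z1); have := cmod_ge0 (P z1); move: vz; rewrite /v => vz Pz Hz.
  have H0 : H z1 = 0 by apply/eqP; rewrite -cmod_eq0; apply/eqP; lra.
  have P0 : P z1 = 0 by apply/eqP; rewrite -cmod_eq0; apply/eqP; lra.
  by rewrite /wronsk H0 P0 mulr0 mul0r subrr.
(* On the selected disc the distance to the boundary loses at most a factor 2 and near-maximality
   costs another, so [u] is at most 4 times its value at the centre. *)
pose B : R := 4 ^+ 4.
have B1 : 1 <= B by rewrite exprn_ege1// ler1n.
have B0 : 0 < B by rewrite exprn_gt0.
have [e e0 he] := core_disc3 B1 ab ac bc.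
(* Discs of radius [N - 2] around points of [|z| < 2] stay in [|z| < N], and Cauchy's estimate on
   them gives [2 B / (N - 2) = e]. *)
pose N := 2 + 2 * B / e.
have N2 : 2 < N by rewrite ltrDl divr_gt0// mulr_gt0.
have N0 : 0 < N by rewrite (lt_trans _ N2).
(* Makes the near-maximum [s * u z0] at least [2 N], so that the rescaled disc of radius [N] fits in
   half the distance to the boundary. *)
pose L := 4 * N / u z1.
have L0 : 0 < L by rewrite divr_gt0// mulr_gt0.
have [M hM] : exists M : R, forall z, cmod (z - z1) <= L -> v z <= M.
  have [|n hn] := @compact_uniform R [set z | cmod (z - z1) <= L]
    (fun n z => v z <= n%:R) (@compact_disc R z1 L); last first.
    by exists n%:R => z; exact: (hn n (leqnn n)).
  move=> p _.
  have /ctP/(_ _ ltr01)/nearC[d1 d10 h1] := derivable_ct (hH p).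
  have /ctP/(_ _ ltr01)/nearC[d2 d20 h2] := derivable_ct (hP p).
  exists (Num.min d1 d2); first by rewrite lt_min d10.
  exists (Num.truncn (v p + 2)).+1 => n Nn z; rewrite lt_min => /andP[/h1 zH /h2 zP].
  have l1 := cmod_leB (H z) (H p); have l2 := cmod_leB (P z) (P p).
  have l3 : v p + 2 < n%:R by rewrite (lt_le_trans (truncnS_gt _))// ler_nat.
  by clear -zH zP l1 l2 l3; rewrite /v in l3 *; lra.
have uM z : cmod (z - z1) <= L -> u z <= 1 + M.
  move=> /hM vM; have M0 : 0 <= M := le_trans (v0 z) vM.
  rewrite -(ler_pXn2r (n := 4)) ?nnegrE ?addr_ge0// u4 (le_trans vM)//.
  by rewrite (le_trans (y := 1 + M)) ?lerDr// exprS ler_peMr ?exprn_ege1 ?lerDl// addr_ge0.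
pose S := [set x | exists z, cmod (z - z1) <= L /\ x = (L - cmod (z - z1)) * u z].
have Sz1 : S (L * u z1) by exists z1; rewrite subrr cmod0 subr0 ltW.
have SB x : S x -> x <= L * (1 + M).
  move=> [z [zL ->]]; apply: ler_pM; [by rewrite subr_ge0|exact: u0| |exact: uM].
  by rewrite gerBl cmod_ge0.
have [_ [z0 [z0L ->]] [hx hmax]] := near_sup Sz1 (mulr_gt0 L0 u1) SB.
set s := L - cmod (z0 - z1) in hx hmax.
have su : 0 < s * u z0.
  by have := mulr_gt0 L0 u1 => h; rewrite -(pmulr_rgt0 (x := 2))// (lt_le_trans h).
have u00 : 0 < u z0.
  rewrite lt_def u0 andbT; apply: contraTneq su => ->; by rewrite mulr0 ltxx.
have s0 : 0 < s by rewrite -(pmulr_lgt0 s u00).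
pose rho := (u z0)^-1; have rho0 : 0 < rho by rewrite invr_gt0.
have Nrho : N * rho <= s / 2.
  rewrite ler_pdivrMr//; have : L * u z1 = 4 * N by rewrite /L divfK// gt_eqF.
  by move=> E; rewrite E in hx; clear -hx; lra.
have vB z : cmod (z - z0) < N * rho -> rho ^+ 4 * v z <= B.
  move=> zN; have zs := lt_le_trans zN Nrho.
  have z1s : s / 2 <= L - cmod (z - z1).
    have := cmod_tri z z0 z1; rewrite /s in zs *; clear -zs; lra.
  have zL : cmod (z - z1) <= L by have := divr_gt0 s0 (@ltr0n R 2); clear -z1s; lra.
  have uz : u z <= 4 * u z0.
    have h1 : (L - cmod (z - z1)) * u z <= 2 * (s * u z0).
      by apply: hmax; exists z.
    have h2 : s / 2 * u z <= (L - cmod (z - z1)) * u z by rewrite ler_wpM2r.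
    have h3 : s * u z <= s * (4 * u z0).
      have := le_trans h2 h1; rewrite mulrAC ler_pdivrMr//; clear; lra.
    by rewrite -(ler_pM2l s0).
  rewrite -u4 -exprMn exp_mono// ?mulr_ge0 ?(ltW rho0)//.
  by rewrite /rho mulrC ler_pdivrMr.
pose k : C := rho%:C ^+ 4.
have kE : cmod k = rho ^+ 4 by rewrite cmodX cmodr ger0_norm// ltW.
have rc0 : rho%:C != 0 :> C by rewrite -cmod_gt0 cmodr normr_gt0 gt_eqF.
pose H' z := k * H (z0 + rho%:C * z); pose P' z := k * P (z0 + rho%:C * z).
have dH z := derive1_rescale k (hH (z0 + rho%:C * z)).
have dP z := derive1_rescale k (hP (z0 + rho%:C * z)).
have hH' r : hol 0 r H' by move=> z _; exact: dv_derivable (dH z).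
have hP' r : hol 0 r P' by move=> z _; exact: dv_derivable (dP z).
have HPB z : cmod z < N -> cmod (H' z) + cmod (P' z) <= B.
  move=> zN; rewrite !(cmodM k) kE -mulrDr; apply: vB.
  by rewrite addrC addKr cmodM cmodr ger0_norm ?(ltW rho0)// mulrC ltr_pM2r.
have W' z : wronsk H' P' z = k ^+ 2 * rho%:C * wronsk H P (z0 + rho%:C * z).
  by rewrite /wronsk (dv_derive1 (dH z)) (dv_derive1 (dP z)); exact: rescale_wronskian.
have de f : (forall z, cmod z < N -> cmod (f z) <= B) -> (forall r, hol 0 r f) ->
    forall z, cmod z < 2 -> cmod (derive1 f z) <= e.
  move=> fB hf z z2; have NN : 0 < N - 2 by rewrite subr_gt0.
  have := @hol_derive1_center R z (N - 2) f B NN.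
  rewrite (_ : 2 * B / (N - 2) = e); last first.
    by rewrite /N addrC addKr; field; rewrite !gt_eqF.
  apply; first by apply: hol_sub (hf (cmod (z - 0) + (N - 2))).
  by move=> w wz; apply: fB; have := cmodD (w - z) z; rewrite subrK; clear -wz z2; lra.
have HB z : cmod z < N -> cmod (H' z) <= B.
  by move=> /HPB; apply: le_trans; rewrite lerDl cmod_ge0.
have PB z : cmod z < N -> cmod (P' z) <= B.
  by move=> /HPB; apply: le_trans; rewrite lerDr cmod_ge0.
apply: (he H' P') => //.
- by move=> z _; rewrite W' /H' /P' exprMn id4 /k; ring.
- by move=> z z2; split; [apply: HB|apply: PB]; exact: lt_trans N2.
- by move=> z z2; split; [exact: de HB _ _ z2|exact: de PB _ _ z2].
- rewrite /H' /P' mulr0 addr0 !(cmodM k) kE -mulrDr -/(v z0) -u4 -exprMn.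
  by rewrite mulVf ?expr1n// gt_eqF.
- move=> p _; have [z zp Wz] := Wn (z0 + rho%:C * p) rho rho0.
  have zE : z0 + rho%:C * ((z - z0) / rho%:C) = z by rewrite mulrC divfK// addrC subrK.
  exists ((z - z0) / rho%:C).
    have -> : (z - z0) / rho%:C - p = (z - (z0 + rho%:C * p)) / rho%:C by field.
    by rewrite cmodM cmodV cmodr ger0_norm ?(ltW rho0)// ltr_pdivrMr// mul1r.
  by rewrite W' zE !mulf_neq0// expf_neq0// /k expf_neq0.
Qed.

End Wronskian.

(** * Regularity at poles and at ramified points *)

Section TotallyRamified.
Variable (R : realType).
Local Notation C := R[i].
Local Notation rc := (@real_complex_def R (Phant R)).
Local Open Scope complex_scope.
Implicit Types (p w z : C) (r : R).

Lemma connected_C : connected [set: C].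
Proof.
move=> B [x0 Bx0] [U oU BU] [V cV BV].
rewrite setTI in BU; rewrite setTI in BV; subst U.
apply/seteqP; split=> // x _.
pose g (t : R) : C := x0 + t%:C * (x - x0).
have cg : continuous g.
  move=> t; apply: ct_continuous; apply: ctD; first exact: ct_cst.
  by apply: ctM; [exact: ct_real|exact: ct_cst].
have cR : connected [set: R] by apply/connected_intervalP.
have E : g @^-1` B = setT.
  apply: cR.
  - by exists 0; rewrite /= /g rmorph0 mul0r addr0.
  - by exists (g @^-1` B); [exact: open_comp|rewrite setTI].
  - by exists (g @^-1` B); [rewrite BV; apply: closed_comp => // t _; exact: cg|rewrite setTI].
have : (g @^-1` B) 1 by rewrite E.
by rewrite /= /g rmorph1 mul1r addrC subrK.
Qed.

Lemma derive1_near (f g : C -> C) z : derivable f z 1 ->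
  (\forall w \near z, f w = g w) -> derive1 g z = derive1 f z.
Proof. by move=> /derivable_dv h fg; apply: dv_derive1; exact: dv_near h. Qed.

(** That derivative is [m! q p]. Used in contrapositive form: derivatives vanishing up to order 3
    force multiplicity at least 4. *)
Lemma deriv_order m p r (f q : C -> C) : 0 < r -> hol p r f -> hol p r q ->
  (forall z, cmod (z - p) < r -> derive1 f z = (z - p) ^+ m * q z) -> q p != 0 ->
  derive1n m.+1 f p != 0.
Proof.
move=> r0; have pr : cmod (p - p) < r by rewrite subrr cmod0.
elim: m f q => [|m ih] f q hf hq fE qp.
  by rewrite derive1n1 fE// expr0 mul1r.
rewrite derive1Sn.
apply: (ih (derive1 f) (fun z => m.+1%:R * q z + (z - p) * derive1 q z)).
- exact: hol_derive1.
- move=> z zr; have h1 := hol_dv hq zr; have h2 := hol_dv (hol_derive1 hq) zr.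
  have h3 := dvB (dv_id id z) (dv_cst id z p).
  exact: dv_derivable (dvD (dvZ (@ct_id R z) m.+1%:R h1) (dvM (@ct_id R z) h3 h2)).
- move=> z zr.
  have k := @dv_pow_mul R p (fun w => (w - p) ^+ m.+1 * q w) q m z (fun w => erefl) (hq z zr).
  have k' : derive1 (fun w => (w - p) ^+ m.+1 * q w) z = derive1 (derive1 f) z.
    apply: derive1_near; first exact: (hol_derive1 hf zr).
    by apply: filterS (near_disc zr) => w; exact: fE.
  exact: etrans (esym k') k.
- by rewrite subrr mul0r addr0 mulf_neq0// pnatr_eq0.
Qed.

Lemma ct_neq0_near (f : C -> C) p : ct f p -> f p != 0 ->
  exists2 r, 0 < r & forall z, cmod (z - p) < r -> f z != 0.
Proof.
move=> cf fp; have c0 : 0 < cmod (f p) by rewrite cmod_gt0.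
have /ctP/(_ _ c0)/nearC[d d0 hd] := cf; exists d => // z /hd h.
by rewrite -cmod_gt0; have := cmod_leBr (f z) (f p); clear -h; lra.
Qed.

(* The orbifold density: with q = 1/F the two functions below are
   F'^4 / prod (F - a)^3 and F times it, and both stay finite where F has a pole
   or takes one of the three values with multiplicity at least 4. *)
Definition ram_local (F : C -> C) (a b c : C) p r (h q : C -> C) :=
  [/\ hol p r h, hol p r q & forall z, 0 < cmod (z - p) < r ->
     h z * ((F z - a) ^+ 3 * ((F z - b) * (F z - c)) ^+ 3) = derive1 F z ^+ 4 /\
     q z = F z * h z].

Lemma ram_local_perm F a b c a' b' c' p r h q :
  (forall x : C, (x - a) ^+ 3 * ((x - b) * (x - c)) ^+ 3 =
     (x - a') ^+ 3 * ((x - b') * (x - c')) ^+ 3) ->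
  ram_local F a b c p r h q -> ram_local F a' b' c' p r h q.
Proof.
move=> E [h1 h2 h3]; split => // z /h3[h4 h5]; split=> //.
by rewrite -E.
Qed.

Lemma pole_identity (K : fieldType) (f f' a b c : K) : f != 0 ->
  (1 - a * f) * ((1 - b * f) * (1 - c * f)) != 0 ->
  f * f' ^+ 4 / ((1 - a * f) * ((1 - b * f) * (1 - c * f))) ^+ 3 *
    ((f^-1 - a) ^+ 3 * ((f^-1 - b) * (f^-1 - c)) ^+ 3) = (- f' / f ^+ 2) ^+ 4.
Proof.
move=> f0; rewrite !mulf_eq0 !negb_or => /and3P[h1 h2 h3]; field.
by rewrite f0 h1 h2 h3.
Qed.

(** With [phi = 1 / F], the numerator is [phi'^4 / phi^8] while the denominator contributes
    [phi^-9]; hence [q = phi'^4 / prod (1 - x phi)^3] and [h = phi q], both regular where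
    [phi = 0]. *)
Lemma ram_pole (g : C -> sphere R) a b c p : lmer g p -> g p = None ->
  (exists2 r, 0 < r & forall z, 0 < cmod (z - p) < r -> g z <> None) ->
  exists r h q, 0 < r /\ ram_local (finpart g) a b c p r h q.
Proof.
move=> gp gpN [r1 r10 hr1].
have [|r0 r00 [hphi phiE]] := lmer_finite (lmer_inv gp); first by rewrite /vinv gpN.
set phi := finpart (vinv g) in hphi phiE.
have pr0 : cmod (p - p) < r0 by rewrite subrr cmod0.
have phip : phi p = 0 by have := phiE p pr0; rewrite /vinv gpN => -[].
(* At a zero of [phi] the default value 0 of [finpart] agrees with [0^-1 = 0]. *)
have FE z : cmod (z - p) < r0 -> finpart g z = (phi z)^-1.
  move=> /phiE gz; rewrite /finpart -(sinvK (g z)) -/(vinv g z) gz /=.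
  by case: eqP => [->|_] //=; rewrite invr0.
pose G z := (1 - a * phi z) * ((1 - b * phi z) * (1 - c * phi z)).
have dG1 x z : cmod (z - p) < r0 -> dv id (fun z => 1 - x * phi z) z (0 - x * derive1 phi z).
  by move=> zr; apply: dvB (dv_cst _ _ _) (dvZ (@ct_id R z) _ (hol_dv hphi zr)).
have hG : hol p r0 G.
  move=> z zr; have k := dvM (@ct_id R z) (dG1 b z zr) (dG1 c z zr).
  exact: dv_derivable (dvM (@ct_id R z) (dG1 a z zr) k).
have [|r2 r20 Gn] := ct_neq0_near (hol_ct hG pr0).
  by rewrite /G phip !mulr0 !subr0 !mulr1 oner_eq0.
pose q z := derive1 phi z ^+ 4 * (G z ^+ 3)^-1.
have [r [r_0 [l0 l1 l2 _]]] := exmin4 r00 r10 r20 r20.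
have dq z : cmod (z - p) < r -> derivable q z 1.
  move=> zr; have zr0 := lt_le_trans zr l0; have zr2 := lt_le_trans zr l2.
  have G3 : G z ^+ 3 != 0 by rewrite expf_neq0// Gn.
  have k1 := dvX (@ct_id R z) 3 (hol_dv (hol_derive1 hphi) zr0).
  have k2 := dvV (@ct_id R z) G3 (dvX (@ct_id R z) 2 (hol_dv hG zr0)).
  exact: dv_derivable (dvM (@ct_id R z) k1 k2).
exists r, (fun z => phi z * q z), q; split; [exact: r_0|split; [move=> z zr|exact: dq|move=> z /andP[z0 zr]]].
  have := dvM (@ct_id R z) (hol_dv hphi (lt_le_trans zr l0)) (derivable_dv (dq z zr)).
  exact: dv_derivable.
have zr0 := lt_le_trans zr l0; have zr1 := lt_le_trans zr l1; have zr2 := lt_le_trans zr l2.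
have phin : phi z != 0.
  apply/eqP => phiz; apply: (hr1 z); first by rewrite z0 zr1.
  by rewrite -(sinvK (g z)) -/(vinv g z) phiE// phiz /= eqxx.
have dF : derive1 (finpart g) z = - derive1 phi z / phi z ^+ 2.
  have k := dvV (@ct_id R z) phin (hol_dv hphi zr0).
  rewrite -(dv_derive1 k); apply: derive1_near; first exact: dv_derivable k.
  by apply: filterS (near_disc zr0) => w /FE.
rewrite dF FE//; split; last by rewrite mulKf.
by rewrite /q (mulrA (phi z)); apply: pole_identity => //; exact: Gn.
Qed.

Lemma ram_regular (F : C -> C) a b c p r : 0 < r -> hol p r F ->
  F p != a -> F p != b -> F p != c ->
  exists r h q, 0 < r /\ ram_local F a b c p r h q.
Proof.
move=> r0 hF Fa Fb Fc; have pr : cmod (p - p) < r by rewrite subrr cmod0.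
pose G z := (F z - a) ^+ 3 * ((F z - b) * (F z - c)) ^+ 3.
have dF1 x z : cmod (z - p) < r -> dv id (fun z => F z - x) z (derive1 F z - 0).
  by move=> zr; apply: dvB (hol_dv hF zr) (dv_cst _ _ _).
have hG : hol p r G.
  move=> z zr; have k := dvX (@ct_id R z) 2 (dvM (@ct_id R z) (dF1 b z zr) (dF1 c z zr)).
  exact: dv_derivable (dvM (@ct_id R z) (dvX (@ct_id R z) 2 (dF1 a z zr)) k).
have [|d d0 Gn] := ct_neq0_near (hol_ct hG pr).
  by rewrite /G !(mulf_neq0, expf_neq0)// subr_eq0.
have [s [s0 [l1 l2 _ _]]] := exmin4 r0 d0 d0 d0.
pose h z := derive1 F z ^+ 4 * (G z)^-1.
have dh z : cmod (z - p) < s -> derivable h z 1.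
  move=> zs; have zr := lt_le_trans zs l1; have Gz := Gn _ (lt_le_trans zs l2).
  have k1 := dvX (@ct_id R z) 3 (hol_dv (hol_derive1 hF) zr).
  exact: dv_derivable (dvM (@ct_id R z) k1 (dvV (@ct_id R z) Gz (hol_dv hG zr))).
exists s, h, (fun z => F z * h z); split; [exact: s0|split; [exact: dh|move=> z zs|move=> z /andP[_ zs]]].
  have := dvM (@ct_id R z) (hol_dv hF (lt_le_trans zs l1)) (derivable_dv (dh z zs)).
  exact: dv_derivable.
by split; rewrite // /h -/(G z) divfK// Gn// (lt_le_trans zs).
Qed.

Lemma ram_identity (K : fieldType) n (x t e B : K) : t != 0 -> B != 0 ->
  x ^+ n * e ^+ 4 / (t ^+ 3 * B ^+ 3) * ((x ^+ (n + 4) * t) ^+ 3 * B ^+ 3) =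
  (x ^+ (n + 3) * e) ^+ 4.
Proof.
by move=> t0 B0; rewrite !exprD; field; rewrite t0 B0.
Qed.

(** Writing [F - a = (z - p)^(n + 4) t] and [F' = (z - p)^(n + 3) eta], the quotient has exponent
    [4 (n + 3) - 3 (n + 4) = n]: multiplicity 4 is exactly what regularity requires. *)
Lemma ram_ramified (F : C -> C) a b c p r : 0 < r -> hol p r F ->
  a != b -> a != c -> F p = a ->
  (forall j, (0 < j <= 3)%N -> derive1n j F p = 0) ->
  (exists2 z, cmod (z - p) < r & F z != a) ->
  exists r h q, 0 < r /\ ram_local F a b c p r h q.
Proof.
move=> r0 hF ab ac Fa dF0 [z0 z0r Fz0]; have pr : cmod (p - p) < r by rewrite subrr cmod0.
have dF1 x z : cmod (z - p) < r -> dv id (fun z => F z - x) z (derive1 F z).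
  move=> zr; rewrite -[X in dv _ _ _ X]subr0.
  by apply: dvB (hol_dv hF zr) (dv_cst _ _ _).
have hFa : hol p r (fun z => F z - a) by move=> z zr; exact: dv_derivable (dF1 a z zr).
have [/(_ _ z0r)/eqP|[m [t [ht tp FE]]]] := hol_order r0 hFa.
  by rewrite subr_eq0 (negbTE Fz0).
case: m FE => [|m] FE.
  by have := FE p; rewrite Fa subrr expr0 mul1r => /esym/eqP; rewrite (negbTE tp).
pose eta z := m.+1%:R * t z + (z - p) * derive1 t z.
have heta : hol p r eta.
  move=> z zr; have h1 := hol_dv ht zr; have h2 := hol_dv (hol_derive1 ht) zr.
  have h3 := dvB (dv_id id z) (dv_cst id z p).
  exact: dv_derivable (dvD (dvZ (@ct_id R z) m.+1%:R h1) (dvM (@ct_id R z) h3 h2)).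
have dFE z : cmod (z - p) < r -> derive1 F z = (z - p) ^+ m * eta z.
  move=> zr; rewrite -(dv_derive1 (dF1 a z zr)); apply: dv_pow_mul => //.
  exact: ht.
have etap : eta p != 0 by rewrite /eta subrr mul0r addr0 mulf_neq0// pnatr_eq0.
have m3 : (3 <= m)%N.
  rewrite leqNgt; apply/negP => m3.
  by have := deriv_order r0 hF heta dFE etap; rewrite dF0 ?eqxx//.
have [n mE] : exists n, m = (n + 3)%N by exists (m - 3)%N; rewrite subnK.
pose B z := (F z - b) * (F z - c).
have hB : hol p r B.
  by move=> z zr; exact: dv_derivable (dvM (@ct_id R z) (dF1 b z zr) (dF1 c z zr)).
have [|d1 d10 Bn] := ct_neq0_near (hol_ct hB pr).
  by rewrite /B Fa mulf_neq0// subr_eq0.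
have [d2 d20 tn] := ct_neq0_near (hol_ct ht pr) tp.
have [s [s0 [l1 l2 l3 _]]] := exmin4 r0 d10 d20 d20.
pose h z := (z - p) ^+ n * eta z ^+ 4 * (t z ^+ 3 * B z ^+ 3)^-1.
have dpow k z : dv id (fun z => (z - p) ^+ k.+1) z (k.+1%:R * (z - p) ^+ k * (1 - 0)).
  have h3 : dv id (fun w => w - p) z (1 - 0) by exact: dvB (dv_id id z) (dv_cst id z p).
  exact: (@dvX _ _ _ _ (@ct_id R z) (fun w => w - p) _ k h3).
have [l hl] : exists l : C -> C, forall z, dv id (fun z => (z - p) ^+ n) z (l z).
  case: n {mE h} => [|n]; last first.
    by exists (fun z => n.+1%:R * (z - p) ^+ n * (1 - 0)) => z; exact: dpow.
  by exists (fun=> 0) => z; exact: dv_cst.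
have dh z : cmod (z - p) < s -> derivable h z 1.
  move=> zs; have zr := lt_le_trans zs l1.
  have tz := tn _ (lt_le_trans zs l3); have Bz := Bn _ (lt_le_trans zs l2).
  have N0 : t z ^+ 3 * B z ^+ 3 != 0 by rewrite mulf_neq0// expf_neq0.
  have k1 := dvM (@ct_id R z) (hl z) (dvX (@ct_id R z) 3 (hol_dv heta zr)).
  have k2 := dvM (@ct_id R z) (dvX (@ct_id R z) 2 (hol_dv ht zr))
    (dvX (@ct_id R z) 2 (hol_dv hB zr)).
  exact: dv_derivable (dvM (@ct_id R z) k1 (dvV (@ct_id R z) N0 k2)).
exists s, h, (fun z => F z * h z); split; [exact: s0|split; [exact: dh|move=> z zs|move=> z /andP[_ zs]]].
  have := dvM (@ct_id R z) (hol_dv hF (lt_le_trans zs l1)) (derivable_dv (dh z zs)).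
  exact: dv_derivable.
have zr := lt_le_trans zs l1; split => //.
have tz := tn _ (lt_le_trans zs l3); have Bz := Bn _ (lt_le_trans zs l2).
by rewrite dFE// mE -(ram_identity n _ _ tz Bz) /h FE mE -addnS.
Qed.

End TotallyRamified.

(** * No nonconstant plane map is so ramified over three values *)

Section Constancy.
Variable (R : realType).
Local Notation C := R[i].
Local Open Scope complex_scope.
Implicit Types (p w z : C) (r : R).

Lemma wronsk_product (K : comRingType) (h h' f f' : K) :
  (f' * h + f * h') * h - f * h * h' = f' * h ^+ 2.
Proof. by ring. Qed.

Lemma wronsk_identity (K : comRingType) (a b c h f f' : K) :
  h * ((f - a) ^+ 3 * ((f - b) * (f - c)) ^+ 3) = f' ^+ 4 ->
  (f' * h ^+ 2) ^+ 4 =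
    (f * h - a * h) ^+ 3 * ((f * h - b * h) * (f * h - c * h)) ^+ 3.
Proof. by move=> E; rewrite exprMn -E; ring. Qed.

Lemma disc_pick p r : 0 < r -> exists z, 0 < cmod (z - p) < r.
Proof.
move=> r0; exists (p + (r / 2)%:C).
have r2 : 0 < r / 2 by rewrite divr_gt0.
rewrite addrC addKr cmodr ger0_norm ?(ltW r2)// r2 /=.
by rewrite ltr_pdivrMr// ltr_pMr// ltr1n.
Qed.

Lemma disc_center p r : 0 < r -> cmod (p - p) < r.
Proof. by rewrite subrr cmod0. Qed.

Lemma disc_in_punctured p r z : 0 < cmod (z - p) < r -> exists2 s, 0 < s &
  forall w, cmod (w - z) < s -> 0 < cmod (w - p) < r.
Proof.
case/andP => z0 zr; exists (Num.min (cmod (z - p)) (r - cmod (z - p))).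
  by rewrite lt_min z0 subr_gt0.
move=> w; rewrite lt_min => /andP[w1 w2].
have h1 := cmod_tri z w p; rewrite (cmodB z w) in h1.
have h2 := cmod_tri w z p; apply/andP.
by clear -w1 w2 h1 h2; split; lra.
Qed.

Section Contradiction.
Variables (g : C -> sphere R) (a b c : C).
Hypothesis gm : forall z, lmer g z.
Hypothesis ab : a != b.
Hypothesis ac : a != c.
Hypothesis bc : b != c.
Hypothesis ram : forall x, x = a \/ x = b \/ x = c ->
  forall p, g p = Some x -> forall j, (0 < j <= 3)%N -> derive1n j (finpart g) p = 0.
Hypothesis ncst : forall x, ~ (forall z, g z = x).

Let F := finpart g.

Let isolated x p : exists2 r, 0 < r & forall z, 0 < cmod (z - p) < r -> g z <> x.
Proof.
have [h|h] := lmer_identity x (@openT _) (@connected_C R) (fun z _ => gm z).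
  by exfalso; apply: (ncst (x := x)) => z; exact: h.
exact: h.
Qed.

Let good z := [/\ g z <> None, g z <> Some a, g z <> Some b & g z <> Some c].

Let good_near p : exists2 r, 0 < r & forall z, 0 < cmod (z - p) < r -> good z.
Proof.
have [r1 r10 h1] := isolated None p; have [r2 r20 h2] := isolated (Some a) p.
have [r3 r30 h3] := isolated (Some b) p; have [r4 r40 h4] := isolated (Some c) p.
have [r [r0 [l1 l2 l3 l4]]] := exmin4 r10 r20 r30 r40.
exists r => // z /andP[z0 zr]; split; [apply: h1|apply: h2|apply: h3|apply: h4];
  by rewrite z0 (lt_le_trans zr).
Qed.

Let Fval z : g z <> None -> g z = Some (F z).
Proof. by rewrite /F /finpart; case: (g z). Qed.

Let Fder z : g z <> None -> exists2 r, 0 < r & lrep z r g F.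
Proof. exact: lmer_finite. Qed.

Let Q x := (x - a) ^+ 3 * ((x - b) * (x - c)) ^+ 3.

Let Q_neq0 z : good z -> Q (F z) != 0.
Proof.
case=> /Fval gz ha hb hc; rewrite gz in ha hb hc.
rewrite /Q mulf_neq0// expf_neq0// ?mulf_neq0// subr_eq0; apply/eqP => E.
- by apply: ha; rewrite E.
- by apply: hb; rewrite E.
- by apply: hc; rewrite E.
Qed.

Let local p : exists r h q, 0 < r /\ ram_local F a b c p r h q.
Proof.
case E : (g p) => [x|]; last exact: ram_pole (gm p) E (isolated None p).
have gN : g p <> None by rewrite E.
have [r r0 [hF gE]] := Fder gN.
have Fp : F p = x by have := Fval gN; rewrite E => -[].
have nc y : F p = y -> exists2 z, cmod (z - p) < r & F z != y.
  move=> Fy; have [s s0 hs] := isolated (Some y) p.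
  have [d [d0 [l1 l2 _ _]]] := exmin4 r0 s0 s0 s0.
  have [z /andP[z0 zd]] := disc_pick p d0; have zr := lt_le_trans zd l1.
  exists z => //; apply/eqP => Fz; apply: (hs z); first by rewrite z0 (lt_le_trans zd l2).
  by rewrite gE// Fz.
have [xa|xa] := eqVneq x a.
  apply: (ram_ramified r0 hF ab ac); [by rewrite Fp|apply: ram|exact: nc (etrans Fp xa)].
    by left.
  by rewrite E xa.
have [xb|xb] := eqVneq x b.
  have [|||||s [h [q [s0 hs]]]] := @ram_ramified R F b a c p r r0 hF.
  - by rewrite eq_sym.
  - exact: bc.
  - by rewrite Fp.
  - by apply: (ram (x := b)); [right; left|rewrite E xb].
  - exact: nc (etrans Fp xb).
  - exists s, h, q; split => //; apply: ram_local_perm hs => y; ring.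
have [xc|xc] := eqVneq x c.
  have [|||||s [h [q [s0 hs]]]] := @ram_ramified R F c a b p r r0 hF.
  - by rewrite eq_sym.
  - by rewrite eq_sym.
  - by rewrite Fp.
  - by apply: (ram (x := c)); [right; right|rewrite E xc].
  - exact: nc (etrans Fp xc).
  - exists s, h, q; split => //; apply: ram_local_perm hs => y; ring.
by apply: (ram_regular r0 hF); rewrite Fp.
Qed.

(** Off isolated points [h] is determined by [F] and [F'], so the local data agree on overlaps and
    define entire [H] and [P]. There [W = F' H^2], and the identity for [W^4] extends by
    continuity. *)
Lemma ramified_contradiction : False.
Proof.
have ldata p : {rhq : R * (C -> C) * (C -> C) |
    0 < rhq.1.1 /\ ram_local F a b c p rhq.1.1 rhq.1.2 rhq.2}.
  by apply: cid; have [r [h [q hr]]] := local p; exists (r, h, q).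
pose rr p := (sval (ldata p)).1.1; pose hh p := (sval (ldata p)).1.2.
pose qq p := (sval (ldata p)).2.
have r0 p : 0 < rr p by have [] := svalP (ldata p).
have loc p : ram_local F a b c p (rr p) (hh p) (qq p) by have [] := svalP (ldata p).
(* Each value is read at the centre of its own chart; [glue] shows that every chart around the point
   gives the same. *)
pose H z := hh z z; pose P z := qq z z.
have glue p z : cmod (z - p) < rr p -> H z = hh p z /\ P z = qq p z.
  move=> zr; have [->//|zp] := eqVneq z p.
  have [h1 h2 h3] := loc z; have [k1 k2 k3] := loc p.
  have [s1 s10 hs1] : exists2 s, 0 < s & forall w, cmod (w - z) < s -> 0 < cmod (w - p) < rr p.
    by apply: disc_in_punctured; rewrite zr cmod_gt0 subr_eq0 zp.
  have [s2 s20 hs2] := good_near z.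
  have [s [s0 [l1 l2 l3 _]]] := exmin4 s10 s20 (r0 z) (r0 z).
  have E w : 0 < cmod (w - z) < s -> hh z w = hh p w.
    move=> /andP[w0 ws]; have [e1 _] := h3 w (introT andP (conj w0 (lt_le_trans ws l3))).
    have [e2 _] := k3 w (hs1 w (lt_le_trans ws l1)).
    have Qw := Q_neq0 (hs2 w (introT andP (conj w0 (lt_le_trans ws l2)))).
    by apply: (mulIf Qw); rewrite /Q e1 e2.
  have zz := disc_center z (r0 z).
  split; first by apply: (ct_unique s0 (hol_ct h1 zz) (hol_ct k1 zr)).
  apply: (ct_unique s0 (hol_ct h2 zz) (hol_ct k2 zr)) => w ws.
  have /andP[w0 ws'] := ws.
  have [_ e1] := h3 w (introT andP (conj w0 (lt_le_trans ws' l3))).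
  have [_ e2] := k3 w (hs1 w (lt_le_trans ws' l1)).
  by rewrite e1 e2 E.
have dH p : derivable H p 1.
  have [h1 _ _] := loc p; apply: dv_derivable.
  apply: dv_near (hol_dv h1 (disc_center p (r0 p))).
  by apply: filterS (near_disc (disc_center p (r0 p))) => w /glue[].
have dP p : derivable P p 1.
  have [_ h1 _] := loc p; apply: dv_derivable.
  apply: dv_near (hol_dv h1 (disc_center p (r0 p))).
  by apply: filterS (near_disc (disc_center p (r0 p))) => w /glue[].
have rel p : exists2 r, 0 < r & forall z, 0 < cmod (z - p) < r ->
    [/\ good z, H z * Q (F z) = derive1 F z ^+ 4, P z = F z * H z &
        wronsk H P z = derive1 F z * H z ^+ 2].
  have [s s0 hs] := good_near p; have [_ _ k3] := loc p.
  have [r [r_0 [l1 l2 _ _]]] := exmin4 s0 (r0 p) (r0 p) (r0 p).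
  have PE w : 0 < cmod (w - p) < r -> H w * Q (F w) = derive1 F w ^+ 4 /\ P w = F w * H w.
    move=> /andP[w0 wr]; have wr' := lt_le_trans wr l2.
    by have [-> ->] := glue p w wr'; apply: k3; rewrite w0 wr'.
  exists r => // z zr; have /andP[z0 zr'] := zr.
  have [e1 e2] := PE z zr.
  have gz : good z by apply: hs; rewrite z0 (lt_le_trans zr' l1).
  split => //; have [gN _ _ _] := gz.
  have [d d0 [hF _]] := Fder gN.
  have k := dvM (@ct_id R z) (hol_dv hF (disc_center z d0)) (derivable_dv (dH z)).
  have -> : wronsk H P z = derive1 P z * H z - P z * derive1 H z by [].
  have -> : derive1 P z = derive1 F z * H z + F z * derive1 H z.
    apply: dv_derive1; apply: dv_near k.
    have [t t0 ht] := disc_in_punctured zr.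
    by apply: filterS (near_disc (disc_center z t0)) => w /ht/PE[].
  by rewrite e2; exact: wronsk_product.
have hH p r : hol p r H by move=> z _; exact: dH.
have hP p r : hol p r P by move=> z _; exact: dP.
have cH z : ct H z by exact: derivable_ct.
have cP z : ct P z by exact: derivable_ct.
have cW z : ct (wronsk H P) z.
  have z1 := disc_center z (@ltr01 R).
  have cdH : ct (derive1 H) z := hol_ct (hol_derive1 (hH z 1)) z1.
  have cdP : ct (derive1 P) z := hol_ct (hol_derive1 (hP z 1)) z1.
  exact: (ctB (ctM cdP (cH z)) (ctM (cP z) cdH)).
have cPx x z : ct (fun z => P z - x * H z) z.
  by apply: ctB => //; apply: ctM => //; exact: ct_cst.
apply: (core_entire ab ac bc dH dP) => [p|p r r1].
  have [r r_0 hr] := rel p.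
  apply: (@ct_unique R p (fun z => wronsk H P z ^+ 4) (fun z => (P z - a * H z) ^+ 3 *
     ((P z - b * H z) * (P z - c * H z)) ^+ 3) r r_0).
  - exact: ctX.
  - by apply: ctM; apply: ctX => //; apply: ctM.
  - by move=> z /hr[_ e1 e2 e3]; rewrite e3 e2; apply: wronsk_identity.
(* A Wronskian vanishing on a disc makes [F' = 0] off its centre: either directly, or through
   [H z = 0] and [F'^4 = H Q(F)]. Then [F] is constant on a small disc, although values are
   isolated. *)
apply: contrapT => /forall2NP W0.
have [s s0 hs] := rel p.
have [d [d0 [l1 l2 _ _]]] := exmin4 s0 r1 r1 r1.
have dF0 z : 0 < cmod (z - p) < d -> derive1 F z = 0.
  move=> /andP[z0 zd].
  have [_ e1 _ e3] := hs z (introT andP (conj z0 (lt_le_trans zd l1))).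
  have [|/negP/negPn/eqP Wz] := W0 z; first by rewrite (lt_le_trans zd).
  move: e3; rewrite Wz => /esym/eqP; rewrite mulf_eq0 expf_eq0 /= => /orP[/eqP//|/eqP Hz].
  by move: e1; rewrite Hz mul0r => /esym/eqP; rewrite expf_eq0 /= => /eqP.
have [z1 hz1] := disc_pick p d0.
have [t t0 ht] := disc_in_punctured hz1.
have [gz1 _ _ _] : good z1.
  have /andP[z0 zd] := hz1.
  by have [] := hs z1 (introT andP (conj z0 (lt_le_trans zd l1))).
have [u u0 [hF gE]] := Fder gz1.
have [v [v0 [m1 m2 _ _]]] := exmin4 t0 u0 u0 u0.
have hF' : hol z1 v F by move=> w /lt_le_trans h; apply: hF; exact: h.
have Fcst w : cmod (w - z1) < v -> F w = F z1.
  move=> wv; apply/eqP; rewrite -subr_eq0 -cmod_eq0 eq_le cmod_ge0 andbT.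
  rewrite -(mul0r (cmod (w - z1))); apply: (hol_lip hF' _ (disc_center z1 v0) wv).
  by move=> x xv; rewrite dF0 ?cmod0//; exact: ht (lt_le_trans xv m1).
have [x x0 hx] := isolated (Some (F z1)) z1.
have [y [y0 [n1 n2 _ _]]] := exmin4 v0 x0 x0 x0.
have [w /andP[w0 wy]] := disc_pick z1 y0.
apply: (hx w); first by rewrite w0 (lt_le_trans wy).
have wv := lt_le_trans wy n1.
by rewrite gE ?(lt_le_trans wv)// Fcst.
Qed.

End Contradiction.
End Constancy.

(** * Zalcman rescaling *)

Section Rescaling.
Variable (R : realType).
Local Notation C := R[i].
Local Open Scope complex_scope.
Implicit Types (p w z : C) (r : R) (f g : C -> sphere R).

(** Its failure on a disc of radius [r] plays the part of a spherical derivative of size at least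
    [1 / r]. *)
Definition small_osc f z r := forall x y, cmod (x - z) < r -> cmod (y - z) < r ->
  chordal (f x) (f y) <= 10^-1.

Lemma small_osc_sub f z r r' : r' <= r -> small_osc f z r -> small_osc f z r'.
Proof. by move=> rr h x y xr yr; apply: h; [apply: lt_le_trans xr _|apply: lt_le_trans yr _]. Qed.

Lemma lmer_small_osc f p : lmer f p -> exists2 d, 0 < d &
  forall z, cmod (z - p) < d -> small_osc f z d.
Proof.
move=> fp; have e0 : 0 < 20^-1 :> R by rewrite invr_gt0.
have [d d0 hd] := lmer_cont fp e0.
exists (d / 2); first by rewrite divr_gt0.
have H z x : cmod (z - p) < d / 2 -> cmod (x - z) < d / 2 -> chordal (f x) (f p) < 20^-1.
  by move=> zd xd; apply: hd; have := cmod_tri x z p; lra.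
move=> z zd x y xd yd.
have h1 := H z x zd xd; have h2 := H z y zd yd.
have := chordal_tri (f x) (f p) (f y); rewrite (chordalC (f p)).
have -> : 10^-1 = 20^-1 + 20^-1 :> R by field.
by clear -h1 h2; lra.
Qed.

(* Choosing the disc of large oscillation that nearly maximises (L - |z - p|)/r
   makes every disc of a quarter of its radius nearby one of small oscillation. *)
Lemma zalcman_selection f p (L r : R) : 0 < L -> 0 < r ->
  (forall z, cmod (z - p) <= L -> lmer f z) -> ~ small_osc f p r ->
  exists z0 rho, [/\ 0 < rho, rho <= 2 * r, ~ small_osc f z0 rho &
    forall z, cmod (z - z0) <= rho * (L / (4 * r)) ->
      cmod (z - p) <= L /\ small_osc f z (rho / 8)].
Proof.
move=> L0 r0 fm nosc.
(* Compactness gives one radius at which no disc has large oscillation; this bounds the ratios to be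
   maximised. *)
have [N hN] : exists N, forall n, (N <= n)%N -> forall z, cmod (z - p) <= L ->
    small_osc f z (n.+1%:R^-1).
  apply: (@compact_uniform R [set z | cmod (z - p) <= L] (fun n z => small_osc f z (n.+1%:R^-1))).
    exact: compact_disc.
  move=> q qL; have [d d0 hd] := lmer_small_osc (fm q qL).
  exists d => //; exists (Num.truncn d^-1).+1 => n Nn z zd.
  apply: small_osc_sub (hd z zd).
  rewrite -[leRHS]invrK lef_pV2 ?posrE ?invr_gt0//.
  rewrite (le_trans (ltW (truncnS_gt _)))// ler_nat (leq_trans Nn)//.
pose S := [set x | exists z t, [/\ cmod (z - p) < L, 0 < t, ~ small_osc f z t &
  x = (L - cmod (z - p)) / t]].
have S0 : S (L / r) by exists p, r; split => //; rewrite subrr cmod0 ?subr0.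
have SB x : S x -> x <= L * N.+1%:R.
  move=> [z [t [zL t0 nz ->]]].
  apply: ler_pM; [by rewrite subr_ge0 ltW|by rewrite invr_ge0 ltW|by rewrite gerBl cmod_ge0|].
  rewrite -[leRHS]invrK lef_pV2 ?posrE ?invr_gt0//.
  rewrite leNgt; apply/negP => tN; apply: nz.
  exact: small_osc_sub (ltW tN) (hN N (leqnn N) z (ltW zL)).
have [_ [z0 [rho [z0L rho0 nz0 ->]]] [hx hmax]] := near_sup S0 (divr_gt0 L0 r0) SB.
set s := L - cmod (z0 - p) in hx hmax.
have s0 : 0 < s by rewrite subr_gt0.
have sL : s <= L by rewrite gerBl cmod_ge0.
have hx' : L * rho <= 2 * s * r.
  by move: hx; rewrite mulrA ler_pdivrMr// mulrAC ler_pdivlMr.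
exists z0, rho; split => //.
  have h : L * rho <= L * (2 * r).
    rewrite (le_trans hx')// mulrAC mulrC ler_wpM2r// mulr_ge0// ltW//.
  by move: h; rewrite ler_pM2l.
move=> z zz.
have zs : cmod (z - z0) <= s / 2.
  rewrite (le_trans zz)// mulrA ler_pdivrMr ?mulr_gt0// mulrC.
  by move: hx'; clear; lra.
have zL : cmod (z - p) <= L - s / 2.
  by have := cmod_tri z z0 p; move: zs; rewrite /s; clear; lra.
have s2 : 0 < s / 2 by rewrite divr_gt0.
split; first by move: zL s2; clear; lra.
(* A bad disc of radius [rho / 8] here would have ratio at least [4 s / rho], more than twice the
   near-maximum [s / rho]. *)
apply: contrapT => nz; have r8 : 0 < rho / 8 by rewrite divr_gt0.
have Sz : S ((L - cmod (z - p)) / (rho / 8)).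
  by exists z, (rho / 8); split => //; move: zL s2; clear; lra.
have := hmax _ Sz; rewrite ler_pdivrMr// leNgt => /negP; apply.
have -> : 2 * (s / rho) * (rho / 8) = s / 4 by field; rewrite gt_eqF.
by move: zL s0; clear; lra.
Qed.

Lemma hol_derive1n p r (f : C -> C) n : hol p r f -> hol p r (derive1n n f).
Proof. by move=> hf; elim: n => [//|n ih]; rewrite derive1nS; exact: hol_derive1. Qed.

Lemma derive1n_affine n p r (h : C -> C) (a b : C) : b != 0 -> hol (a + b * p) r h ->
  forall z, cmod (z - p) < r / cmod b ->
  derive1n n (fun z => h (a + b * z)) z = b ^+ n * derive1n n h (a + b * z).
Proof.
move=> b0 hh; elim: n => [z _|n ih z zr]; first by rewrite mul1r.
have cb : 0 < cmod b by rewrite cmod_gt0.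
have zr' : cmod (a + b * z - (a + b * p)) < r.
  rewrite (_ : _ - _ = b * (z - p)); last by ring.
  by rewrite cmodM mulrC -ltr_pdivlMr.
have k := derive1_rescale (b ^+ n) (hol_derive1n (n := n) hh zr').
rewrite derive1nS (@derive1_near _ (fun z => b ^+ n * derive1n n h (a + b * z))).
- by rewrite (dv_derive1 k) exprSr.
- exact: dv_derivable k.
- by apply: filterS (near_disc zr) => w wr; rewrite ih.
Qed.

Definition ucvg p r (fn : nat -> C -> C) (f : C -> C) := forall e : R, 0 < e ->
  exists N, forall n, (N <= n)%N -> forall z, cmod (z - p) < r -> cmod (fn n z - f z) <= e.

Lemma ucvg_derive1 p r (fn : nat -> C -> C) (f : C -> C) : 0 < r -> (forall n, hol p r (fn n)) -> hol p r f ->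
  ucvg p r fn f -> ucvg p (r / 2) (fun n => derive1 (fn n)) (derive1 f).
Proof.
move=> r0 hfn hf h e e0; have r2 : 0 < r / 2 by rewrite divr_gt0.
have e1 : 0 < e * (r / 2) / 2 by rewrite divr_gt0// mulr_gt0.
have [N hN] := h _ e1; exists N => n Nn z zr.
have zr' : cmod (z - p) < r by move: zr r0; clear; lra.
have dB w : cmod (w - p) < r -> dv id (fun w => fn n w - f w) w (derive1 (fn n) w - derive1 f w).
  by move=> wr; apply: dvB; [exact: hol_dv (hfn n) wr|exact: hol_dv hf wr].
rewrite -(dv_derive1 (dB z zr')).
have D w : cmod (w - z) < r / 2 -> cmod (w - p) < r.
  by have := cmod_tri w z p; move: zr; clear; lra.
have := @hol_derive1_center R z (r / 2) (fun w => fn n w - f w) (e * (r / 2) / 2) r2.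
rewrite (_ : 2 * (e * (r / 2) / 2) / (r / 2) = e); last by field; rewrite gt_eqF.
apply; first by move=> w /D wr; exact: dv_derivable (dB w wr).
by move=> w /D wr; exact: hN.
Qed.

End Rescaling.

(** * Derivatives of the limit at the exceptional values *)

Section NormalityCriterion.
Variable (R : realType).
Local Notation C := R[i].
Local Open Scope complex_scope.
Implicit Types (p w z : C) (r : R).

(** The [j]-th derivatives converge uniformly around [p], so their smallness at the [x]-points
    supplied by Hurwitz, which tend to [p], carries over to [p]. *)
Lemma limit_derive1n_eq0 (v : nat -> C -> sphere R) (g : C -> sphere R) p x j :
  tame setT v -> lu_cvg setT v g -> g p = Some x ->
  (forall r, 0 < r -> exists2 z, cmod (z - p) < r & g z <> Some x) ->
  (forall e : R, 0 < e -> exists N, forall n, (N <= n)%N -> forall z, cmod (z - p) < 1 ->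
     v n z = Some x -> cmod (derive1n j (finpart (v n)) z) <= e) ->
  derive1n j (finpart g) p = 0.
Proof.
move=> tv vg gp gx hj.
have gm z : lmer g z by exact: (@tame_lim_lmer _ _ _ _ tv vg z).
have [r r0 [hF gE]] : exists2 r, 0 < r & lrep p r g (finpart g).
  by apply: lmer_finite => //; rewrite gp.
have [r1 [r10 _ [N1 hN1]]] := tv p I.
have Fp : finpart g p = x by rewrite /finpart gp.
have /ctP/(_ 1 ltr01)/nearC[d d0 hd] := hol_ct hF (disc_center p r0).
have [t [t0 [l1 l2 l3 l4]]] := exmin4 r0 r10 d0 (@ltr01 R).
pose s := t / 2; have s0 : 0 < s by rewrite divr_gt0.
have st : s < t by rewrite ltr_pdivrMr// ltr_pMr// ltr1n.
pose S := [set z | cmod (z - p) <= s].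
have gS z : S z -> g z = Some (finpart g z).
  by move=> zs; apply: gE; apply: le_lt_trans zs (lt_le_trans st l1).
have FS z : S z -> cmod (finpart g z) <= cmod x + 1.
  move=> zs; have := hd z (le_lt_trans zs (lt_le_trans st l3)); rewrite Fp.
  by have := cmod_leB (finpart g z) x; clear; lra.
have B0 : 0 <= cmod x + 1 by rewrite addr_ge0 ?cmod_ge0.
have unif (e : R) : 0 < e -> exists N, forall n, (N <= n)%N -> forall z, S z ->
    chordal (v n z) (g z) <= e.
  move=> e0; apply: compact_uniform; first exact: compact_disc.
  move=> q _; have [c c0 [M hM]] := vg q I e e0.
  by exists c => //; exists M => n Mn z zc; apply/ltW/hM.
have fc := chordal_cvg_finpart gS FS B0 unif.
have [N2 hN2] := fc 1 ltr01.
pose m n := (n + maxn N1 N2)%N; pose fn n := finpart (v (m n)).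
have mN1 n : (N1 <= m n)%N by rewrite /m (leq_trans (leq_maxl N1 N2))// leq_addl.
have mN2 n : (N2 <= m n)%N by rewrite /m (leq_trans (leq_maxr N1 N2))// leq_addl.
have vE n z : cmod (z - p) < s -> v (m n) z = Some (fn n z).
  by move=> zs; have [] := hN2 _ (mN2 n) z (ltW zs).
have hfn n : hol p s (fn n).
  have [] : lrep p s (v (m n)) (fn n) => //.
  apply: lrep_disc => z zs; split; last by rewrite vE.
  by have [h1 _] := hN1 _ (mN1 n); apply: h1; apply: lt_trans zs (lt_le_trans st l2).
have hFs : hol p s (finpart g).
  by move=> z zs; apply: hF; apply: lt_trans zs (lt_le_trans st l1).
have cv : ucvg p s fn (finpart g).
  move=> e e0; have [N hN] := fc e e0; exists N => n Nn z zs.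
  have mN : (N <= m n)%N by rewrite (leq_trans Nn)// leq_addr.
  by have [] := hN _ mN z (ltW zs).
have zeros c : 0 < c -> exists N, forall n, (N <= n)%N ->
    exists2 z, cmod (z - p) < c & cmod (z - p) < s /\ fn n z = x.
  move=> c0; have [y [y0 [k1 k2 _ _]]] := exmin4 c0 s0 s0 s0.
  have sub f : hol p s f -> hol p s (fun z => f z - x).
    by move=> hf z zs; apply: dv_derivable (dvB (hol_dv hf zs) (dv_cst _ _ _)).
  have [|||N hN] := hurwitz s0 y0 (fun n => sub _ (hfn n)) (sub _ hFs).
  - move=> e e0; have [N hN] := cv e e0; exists N => n Nn z zs.
    by rewrite opprB addrA subrK; exact: hN.
  - by rewrite Fp subrr.
  - have [z zs gz] := gx s s0; exists z => //; rewrite subr_eq0.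
    by apply/eqP => Fz; apply: gz; rewrite gS ?Fz//; exact: ltW.
  exists N => n /hN[z zy /eqP]; rewrite subr_eq0 => /eqP fz.
  exists z; first exact: lt_le_trans zy k1.
  by split => //; exact: lt_le_trans zy k2.
(* Each differentiation costs half of the radius. *)
have [y y0 [ys cvj]] : exists2 y, 0 < y & y <= s /\
    ucvg p y (fun n => derive1n j (fn n)) (derive1n j (finpart g)).
  elim: (j) => [|i [y y0 [ys ih]]]; first by exists s.
  have sub f : hol p s f -> hol p y (derive1n i f).
    by move=> hf z zy; apply: (hol_derive1n hf); exact: lt_le_trans zy ys.
  exists (y / 2); first by rewrite divr_gt0.
  split; first by rewrite (le_trans _ ys)// ler_pdivrMr// ler_pMr// ler1n.
  by apply: ucvg_derive1 y0 (fun n => sub _ (hfn n)) (sub _ hFs) ih.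
apply: cmod_lim0 => e e0; have e3 : 0 < e / 3 by rewrite divr_gt0.
have /ctP/(_ _ e3)/nearC[c c0 hc] := hol_ct (hol_derive1n (n := j) hFs) (disc_center p s0).
have [N3 hN3] := cvj _ e3; have [N4 hN4] := hj _ e3.
have [q [q0 [k1 k2 _ _]]] := exmin4 c0 y0 y0 y0.
have [N5 hN5] := zeros q q0.
pose n := maxn N3 (maxn N4 N5).
have n3 : (N3 <= n)%N by rewrite leq_maxl.
have n4 : (N4 <= m n)%N by rewrite (leq_trans _ (leq_addr _ _))// !leq_max leqnn orbT.
have n5 : (N5 <= n)%N by rewrite !leq_max leqnn !orbT.
have [z zq [zs fz]] := hN5 n n5.
have h1 := hc z (lt_le_trans zq k1); have h2 := hN3 n n3 z (lt_le_trans zq k2).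
have z1 : cmod (z - p) < 1 := lt_trans zs (lt_le_trans st l4).
have h3 : cmod (derive1n j (fn n) z) <= e / 3.
  by apply: (hN4 _ n4 z z1); rewrite vE// fz.
set A := derive1n j (finpart g) p in h1 *.
set B := derive1n j (finpart g) z in h1 h2; set E := derive1n j (fn n) z in h2 h3.
have t1 := cmod_tri A B 0; have t2 := cmod_tri B E 0.
rewrite !subr0 in t1 t2; rewrite (cmodB A B) in t1; rewrite (cmodB B E) in t2.
by clear -h1 h2 h3 t1 t2; lra.
Qed.

Lemma tame_comp (D : set C) (u : nat -> C -> sphere R) s :
  incr s -> tame D u -> tame D (u \o s).
Proof.
move=> hs tu p Dp; have [r [r0 rD [N hN]]] := tu p Dp; exists r; split => //.
by exists N => n Nn; apply: hN; rewrite (leq_trans Nn)// incr_ge.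
Qed.

(** Iterates [|f^(j+1)| <= M (1 + |f^(j)|^2)], the spherical bound cleared of its denominator,
    starting from [|f| = c]. *)
Fixpoint deriv_bound (M c : R) j :=
  if j is i.+1 then M * (1 + deriv_bound M c i ^+ 2) else c.

Lemma deriv_bound_ge0 (M c : R) j : 0 <= M -> 0 <= c -> 0 <= deriv_bound M c j.
Proof. by move=> M0 c0; case: j => //= j; rewrite mulr_ge0// addr_ge0// sqr_ge0. Qed.

Lemma mderiv_bounded (f : C -> sphere R) z x (M : R) : 0 <= M -> f z = Some x ->
  (forall j, (j < 3)%N -> sph_deriv f j z <= M) ->
  forall j, (j <= 3)%N -> cmod (mderiv f j z) <= deriv_bound M (cmod x) j.
Proof.
move=> M0 fz hM; elim=> [_|j ih j3]; first by rewrite /mderiv /= /finpart fz.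
have D0 : 0 < 1 + cmod (mderiv f j z) ^+ 2 by rewrite ltr_pwDl// sqr_ge0.
have := hM j j3; rewrite /sph_deriv ler_pdivrMr// => /le_trans; apply.
rewrite /= ler_wpM2l// lerD2l; apply: lerXn2r (ih (ltnW j3)); rewrite nnegrE ?cmod_ge0//.
exact: deriv_bound_ge0 (cmod_ge0 _).
Qed.

End NormalityCriterion.

(** * Rescaling a sequence without uniform oscillation bound *)

Section Zalcman.
Variable (R : realType).
Local Notation C := R[i].
Local Open Scope complex_scope.
Implicit Types (p w z : C) (r : R).
Variables (u : nat -> C -> sphere R) (p : C) (L : R).
Hypothesis L0 : 0 < L.
Hypothesis um : forall n z, cmod (z - p) <= L -> lmer (u n) z.

(** Chosen so that [L / (4 * rad m) = m + 1] is the radius of the rescaled window. *)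
Let rad m : R := L / (4 * m.+1%:R).

Let rad_gt0 m : 0 < rad m.
Proof. by rewrite divr_gt0// mulr_gt0. Qed.

(** The indices [k m] may repeat: what matters is that [rho m] tends to 0 while the windows grow,
    and the assumptions on [u n] hold for every [n]. *)
Lemma zalcman_rescaling : (forall r : R, 0 < r -> exists n, ~ small_osc (u n) p r) ->
  exists (k : nat -> nat) (z0 : nat -> C) (rho : nat -> R), forall m,
  [/\ 0 < rho m, rho m <= L / m.+1%:R, ~ small_osc (u (k m)) (z0 m) (rho m) &
     forall z, cmod z <= m.+1%:R -> cmod (z0 m + (rho m)%:C * z - p) <= L /\
       small_osc (u (k m)) (z0 m + (rho m)%:C * z) (rho m / 8)].
Proof.
move=> nosc.
have H m : {x : nat * C * R | [/\ 0 < x.2, x.2 <= L / m.+1%:R,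
    ~ small_osc (u x.1.1) x.1.2 x.2 &
     forall z, cmod z <= m.+1%:R -> cmod (x.1.2 + x.2%:C * z - p) <= L /\
       small_osc (u x.1.1) (x.1.2 + x.2%:C * z) (x.2 / 8)]}.
  apply: cid; have [n hn] := nosc _ (rad_gt0 m).
  have [z0 [rho [h1 h2 h3 h4]]] := zalcman_selection L0 (rad_gt0 m) (@um n) hn.
  have m0 : m.+1%:R != 0 :> R by rewrite pnatr_eq0.
  exists (n, z0, rho); split => //=.
    apply: le_trans h2 _; rewrite /rad.
    have -> : 2 * (L / (4 * m.+1%:R)) = L / m.+1%:R / 2 by field.
    by rewrite ler_pdivrMr// ler_peMr ?ler1n// divr_ge0// ltW.
  move=> z zm; apply: h4.
  rewrite addrC addKr cmodM cmodr gtr0_norm// ler_wpM2l// ?(ltW h1)//.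
  have -> // : L / (4 * rad m) = m.+1%:R.
  by rewrite /rad; move: m.+1%:R m0 (lt0r_neq0 L0) => y y0 x0; field; rewrite y0 x0.
exists (fun m => (sval (H m)).1.1), (fun m => (sval (H m)).1.2), (fun m => (sval (H m)).2).
by move=> m; exact: (svalP (H m)).
Qed.

Variables (a b c : C) (M : R).
Hypothesis ab : a != b.
Hypothesis ac : a != c.
Hypothesis bc : b != c.
Hypothesis M0 : 0 <= M.
Hypothesis hM : forall n z x, cmod (z - p) <= L -> x = a \/ x = b \/ x = c ->
  u n z = Some x -> forall j, (j < 3)%N -> sph_deriv (u n) j z <= M.

(** Small oscillation on discs of radius [rho / 8] becomes tameness at scale 1/8 after rescaling,
    while its failure at radius [rho] forces a nonconstant limit: a constant one would leave at most
    1/20 + 1/20 on the unit disc. *)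
Lemma uniform_small_osc : exists2 r, 0 < r & forall n, small_osc (u n) p r.
Proof.
apply: contrapT => nosc.
have [|k [z0 [rho hk]]] := zalcman_rescaling.
  move=> r r0; apply: contrapT => h; apply: nosc; exists r => // n.
  by apply: contrapT => nn; apply: h; exists n.
have rho0 m : 0 < rho m by have [] := hk m.
have rhoC m : (rho m)%:C != 0 by rewrite -cmod_gt0 cmodr normr_gt0 gt_eqF.
pose v m z := u (k m) (z0 m + (rho m)%:C * z).
have far q : exists N, forall n, (N <= n)%N -> forall z, cmod (z - q) < 1 -> cmod z <= n.+1%:R.
  exists (Num.truncn (cmod q + 1)) => n Nn z zq.
  have h1 := cmod_tri z q 0; rewrite !subr0 in h1.
  have h2 : cmod q + 1 <= n.+1%:R.
    by rewrite (le_trans (ltW (truncnS_gt _)))// ler_nat ltnS.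
  by rewrite (le_trans h1)// (le_trans _ h2)// addrC lerD2l ltW.
have tv : tame setT v.
  move=> q _; exists (8^-1); split => //.
  have e1 : 8^-1 < 1 :> R by rewrite invf_lt1// ltr1n.
  have q1 := disc_center q (@ltr01 R).
  have [N hN] := far q; exists N => n Nn; have [_ _ _ h] := hk n; split=> [z zq|].
    apply: lmer_affine => //; apply: um.
    by have [] := h z (hN n Nn z (lt_trans zq e1)).
  have [_ ho] := h q (hN n Nn q q1).
  have E z : cmod (z - q) < 8^-1 ->
      cmod (z0 n + (rho n)%:C * z - (z0 n + (rho n)%:C * q)) < rho n / 8.
    move=> zq; rewrite (_ : _ - _ = (rho n)%:C * (z - q)); last by ring.
    by rewrite cmodM cmodr gtr0_norm// ltr_pM2l.
  by move=> z w zq wq; apply: ho; exact: E.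
have nv m : ~ small_osc (v m) 0 1.
  have [_ _ h _] := hk m; move=> ho; apply: h => x y xr yr.
  have E t : t = z0 m + (rho m)%:C * (((rho m)%:C)^-1 * (t - z0 m)).
    by rewrite mulrA mulfV// mul1r addrC subrK.
  have I t : cmod (t - z0 m) < rho m -> cmod (((rho m)%:C)^-1 * (t - z0 m) - 0) < 1.
    by move=> tr; rewrite subr0 cmodM cmodV cmodr gtr0_norm// mulrC ltr_pdivrMr// mul1r.
  by rewrite (E x) (E y); apply: ho; exact: I.
have [s hs [g vg]] := tame_subseq tv.
have tvs := tame_comp hs tv.
have gm z : lmer g z by exact: (@tame_lim_lmer _ _ _ _ tvs vg z).
have ncst x : ~ (forall z, g z = x).
  move=> gx; have e0 : 0 < 20^-1 :> R by rewrite invr_gt0.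
  have [|q _|N hN] := @compact_uniform R [set z | cmod (z - 0) <= 1]
      (fun n z => chordal (v (s n) z) (g z) < 20^-1).
  - exact: compact_disc.
  - exact: vg.
  - apply: (nv (s N)) => y z y1 z1.
    have h1 := hN N (leqnn N) y (ltW y1); have h2 := hN N (leqnn N) z (ltW z1).
    rewrite !gx in h1 h2; rewrite (chordalC _ x) in h2.
    have -> : 10^-1 = 20^-1 + 20^-1 :> R by field.
    by rewrite (le_trans (chordal_tri _ x _))// lerD// ltW.
apply: (ramified_contradiction gm ab ac bc _ ncst) => x hx q gq j /andP[j0 j3].
apply: (limit_derive1n_eq0 tvs vg gq).
  move=> r r0.
  have [h|h] := lmer_identity (Some x) (@openT _) (@connected_C R) (fun z _ => gm z).
    by exfalso; apply: (ncst (Some x)) => z; exact: h.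
  have [d d0 hd] := h q I; have [y [y0 [l1 l2 _ _]]] := exmin4 r0 d0 d0 d0.
  have [z /andP[z1 zy]] := disc_pick q y0.
  exists z; first exact: lt_le_trans zy l1.
  by apply: hd; rewrite z1 (lt_le_trans zy).
move=> e e0; pose B := deriv_bound M (cmod x) j.
have B0 : 0 <= B by apply: deriv_bound_ge0 => //; exact: cmod_ge0.
have [N hN] := far q.
(* Beyond [L], [rho <= 1] and so [rho^j <= rho] for [j > 0]; beyond [L B / e], [rho B <= e]. *)
pose A := Num.max L (L * B / e).
exists (maxn N (Num.truncn A)) => n; rewrite geq_max => /andP[Nn An] z zq vz.
have sn := incr_ge n hs.
have [_ rL _ /(_ z)[|Zp _]] := hk (s n).
  by rewrite (le_trans (hN n Nn z zq))// ler_nat ltnS.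
set Z := z0 (s n) + (rho (s n))%:C * z in Zp.
have uZ : u (k (s n)) Z = Some x := vz.
have [|t t0 [ht _]] := lmer_finite (um (k (s n)) Zp); first by rewrite uZ.
have zz : cmod (z - z) < t / cmod (rho (s n))%:C.
  by rewrite subrr cmod0 divr_gt0// cmod_gt0.
have -> : derive1n j (finpart ((v \o s) n)) z =
    (rho (s n))%:C ^+ j * derive1n j (finpart (u (k (s n)))) Z.
  exact: (derive1n_affine j (rhoC (s n)) ht zz).
have As : A <= (s n).+1%:R.
  by rewrite (le_trans (ltW (truncnS_gt _)))// ler_nat ltnS (leq_trans An).
have /andP[A1 A2] : (L <= (s n).+1%:R) && (L * B / e <= (s n).+1%:R).
  by rewrite -ge_max.
have S0 : 0 < (s n).+1%:R :> R by [].
have r1 : rho (s n) <= 1 by rewrite (le_trans rL)// ler_pdivrMr// mul1r.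
rewrite cmodM cmodX cmodr gtr0_norm//.
have dB : cmod (derive1n j (finpart (u (k (s n)))) Z) <= B.
  apply: (@mderiv_bounded R _ Z x M M0 uZ _ j j3) => i i3.
  exact: (@hM _ Z x Zp hx uZ i i3).
have rj : rho (s n) ^+ j <= rho (s n).
  by rewrite -[leRHS]expr1 ler_wiXn2l// ltW.
apply: le_trans (ler_pM (exprn_ge0 _ (ltW (rho0 _))) (cmod_ge0 _) rj dB) _.
apply: le_trans (ler_wpM2r B0 rL) _.
by rewrite mulrAC ler_pdivrMr// (mulrC e) -ler_pdivrMr.
Qed.

End Zalcman.

Lemma card_eq3_distinct (T : Type) (E : set T) : (E #= `I_3)%card ->
  exists a b c, [/\ E a, E b & E c] /\ [/\ a <> b, a <> c & b <> c].
Proof.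
move=> /eq_cardSP[a Ea /eq_cardSP[b [Eb ba] /eq_cardSP[c [[Ec ca] cb] _]]].
exists a, b, c; split => //; split => h; [apply: ba|apply: ca|apply: cb]; exact: esym h.
Qed.

(** * Normality on the domain *)

Section Conclusion.
Variable (R : realType).
Local Notation C := R[i].
Implicit Types (D : set C) (u : nat -> C -> sphere R).

Lemma open_closed_disc D p : open D -> D p ->
  exists2 r : R, 0 < r & [set z | cmod (z - p) <= r] `<=` D.
Proof.
move=> oD Dp; have /nearC[r r0 hr] : nbhs p D by apply: open_nbhs_nbhs.
exists (r / 2); first by rewrite divr_gt0.
by move=> z /= zr; apply: hr; apply: le_lt_trans zr _; rewrite ltr_pdivrMr// ltr_pMr// ltr1n.
Qed.

(** The identity theorem on the connected [D] gives the alternative: infinity is the value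
    everywhere or at isolated points, which are then poles. *)
Lemma tame_normal D u : domain D -> (forall n, meromorphic D (u n)) -> tame D u ->
  exists phi : nat -> nat, {homo phi : m n / (m < n)%N} /\
  exists g : C -> sphere R, (meromorphic D g \/ forall z, D z -> g z = None) /\
    cvg_spherically_locally_uniformly D (u \o phi) g.
Proof.
move=> [oD cD _] um tu; have [s hs [g ug]] := tame_subseq tu.
have gm := tame_lim_lmer (tame_comp hs tu) ug.
exists s; split => //; exists g; split.
  have [h|h] := lmer_identity None oD cD gm; [by right|left => z Dz].
  exact: lmer_meromorphic (gm z Dz) (h z Dz).
move=> K cK KD e e0; have [|N hN] := compact_uniform (K := K)
    (P := fun n z => chordal ((u \o s) n z) (g z) < e) cK; last by exists N.
by move=> p /KD Dp; exact: ug.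
Qed.

End Conclusion.

Unset Implicit Arguments.
Set Strict Implicit.
Set Printing Implicit Defensive.
Local Open Scope card_scope.

Theorem theorem2p1 (R : realType) (k : nat) (hk : (2 < k)%N)
    (D : set R[i]) (hD : domain D)
    (F : set (R[i] -> sphere R)) (hF : forall f, F f -> meromorphic D f)
    (hE : forall K : set R[i], compact K -> K `<=` D ->
       exists (E : set R[i]) (M : R), E #= `I_3 /\ 0 < M /\
         forall f, F f -> forall z, (K `&` f @^-1` (Some @` E)) z ->
         forall j : nat, (j < k)%N -> sph_deriv f j z <= M) :
  normal_family D F.
Proof.
move=> u Fu; have um n := hF _ (Fu n).
apply: tame_normal => // p Dp; have [oD _ _] := hD.
have [L L0 LD] := open_closed_disc oD Dp.
(* A closed disc around [p] serves as the compact set; the three values and [M] may depend on [p],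
   since tameness is local. *)
have [E [M [/card_eq3_distinct[a [b [c [[Ea Eb Ec] [/eqP ab /eqP ac /eqP bc]]]]] [M0 hM]]]] :=
  hE _ (@compact_disc R p L) LD.
have [||r r0 hr] := @uniform_small_osc R u p L L0 _ a b c M ab ac bc (ltW M0).
- by move=> n z zL; apply/meromorphic_lmer/um/LD.
(* The indices 0, 1, 2 are available because [2 < k]. *)
- move=> n z x zL hx uz j j3; apply: (hM _ (Fu n)); last exact: leq_trans j3 hk.
  split => //; exists x; last by rewrite uz.
  by case: hx => [->|[->|->]].
have [d [d0 [l1 l2 _ _]]] := exmin4 L0 r0 r0 r0.
exists d; split => //; first by move=> z zd; apply: LD; apply/ltW; exact: lt_le_trans zd l1.
exists 0%N => n _; split; last exact: small_osc_sub l2 (hr n).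
move=> z zd; apply/meromorphic_lmer/um/LD/ltW; exact: lt_le_trans zd l1.
Qed.
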